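(* Suppose $t(z,w)=\sum_{j=-n}^{n}\sum_{k=-m}^{m}t_{jk}z^jw^k>0$ for all $(z,w)\in\mathbb{T}^2$. Then there exists $p\in\mathbb{C}[z,w]$ of degree at most $(n,m)$ with no zeros on $\mathbb{T}\times\overline{\mathbb{D}}$ such that $t=|p|^2$ on $\mathbb{T}^2$ if and only if the positive linear form $\mathcal{T}$ on $\mathcal{L}_{n,m}$ given by $$\mathcal{T}(z^jw^k)=\int_{\mathbb{T}^2} z^jw^k\,\frac{|dz||dw|}{(2\pi)^2t(z,w)},\qquad |j|\le n,\ |k|\le m,$$ satisfies the split-shift condition.
   Context: $\mathbb{D}=\{|z|<1\}$, $\mathbb{T}=\partial\mathbb{D}$; $n,m$ are nonnegative integers, $t_{jk}\in\mathbb{C}$. $\mathcal{L}_{j,k}$ is the complex span of $z^sw^t$, $-j\le s\le j$, $-k\le t\le k$, and $\mathcal{P}_{j,k}$ the complex span of $z^sw^t$, $0\le s\le j$, $0\le t\le k$ (with $\mathcal{P}_{j,k}=\{0\}$ if $j<0$ or $k<0$). Degree at most $(n,m)$ means membership in $\mathcal{P}_{n,m}$. For a polynomial $g$, $\bar g(z,w)=\overline{g(\bar z,\bar w)}$. A linear form $\mathcal{T}:\mathcal{L}_{n,m}\to\mathbb{C}$ is positive if $\mathcal{T}(f(z,w)\bar f(1/z,1/w))>0$ for all nonzero $f\in\mathcal{P}_{n,m}$. $\mathcal{H}_{\mathcal T}$ is $\mathcal{P}_{n,m}$ with inner product $\langle f,g\rangle_{\mathcal T}=\mathcal{T}(f(z,w)\bar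 g(1/z,1/w))$; orthogonality is in $\mathcal{H}_{\mathcal T}$. $\mathcal{E}^1_{k,l}=\mathcal{P}_{k,l}\ominus w\mathcal{P}_{k,l-1}$. Split-shift condition: there exist subspaces of polynomials $\mathcal{K}_1,\mathcal{K}_2\subset\mathcal{H}_{\mathcal T}$ with (1) $\mathcal{E}^1_{n-1,m}=\mathcal{K}_1\oplus\mathcal{K}_2$ (orthogonal direct sum), (2) $\mathcal{K}_1\perp z\mathcal{K}_2$, (3) $\mathcal{K}_1,\ z\mathcal{K}_2\subset\mathcal{E}^1_{n,m}$. *)

(* Defs.v *)
From mathcomp Require Import all_boot all_order all_algebra.
From mathcomp Require Import polyXY complex.
From mathcomp Require Import all_classical all_reals all_analysis.

Set Implicit Arguments.
Unset Strict Implicit.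
Unset Printing Implicit Defensive.

Import Order.TTheory GRing.Theory Num.Theory.

Local Open Scope classical_set_scope.
Local Open Scope complex_scope.
Local Open Scope ring_scope.

(* C[z, w]: the outer variable 'X is z and the inner variable 'Y = 'X%:P is w,
   so p`_s`_k is the coefficient of z^s w^k and p.[z, w] is evaluation. *)
Notation bipoly R := {poly {poly R[i]}}.

(* L_{n,m}, as coefficient arrays: the (a, b) entry is the coefficient of
   z^(a - n) w^(b - m). *)
Notation laurent R n m := 'M[R[i]]_(n.*2.+1, m.*2.+1).

Section BernsteinSzego.
Variable R : realType.
Local Notation C := R[i].

(* P_{j,k}; the indices are integers so that P_{-1,k} = P_{j,-1} = {0}. *)
Definition polys (j k : int) : set (bipoly R) :=
  [set p : bipoly R | forall s l : nat, p`_s`_l != 0 -> s%:Z <= j /\ l%:Z <= k].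

Definition subspace (K : set (bipoly R)) : Prop :=
  K 0 /\ forall (c : C) f g, K f -> K g -> K (c%:P%:P * f + g).

Definition mulset (q : bipoly R) (A : set (bipoly R)) : set (bipoly R) :=
  [set q * f | f in A].

(* e^(i x) *)
Definition cis (x : R) : C := Complex (cos x) (sin x).

(* The integral over T^2 against |dz||dw|. *)
Definition torus_integral (F : C -> C -> C) : C :=
  let D := `[0, 2 * pi] `*` `[0, 2 * pi] in
  Complex
    (\int[(@lebesgue_measure R \x @lebesgue_measure R)%E]_(x in D)
       complex.Re (F (cis x.1) (cis x.2)))
    (\int[(@lebesgue_measure R \x @lebesgue_measure R)%E]_(x in D)
       complex.Im (F (cis x.1) (cis x.2))).

Section Forms.
Variables n m : nat.

(* z^j w^k, for |j| <= n and |k| <= m. *)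
Definition lmon (j k : int) : laurent R n m :=
  \matrix_(a, b) ((a%:Z - n%:Z == j) && (b%:Z - m%:Z == k))%:R.

Definition leval (t : laurent R n m) (z w : C) : C :=
  \sum_a \sum_b t a b * z ^ (a%:Z - n%:Z) * w ^ (b%:Z - m%:Z).

(* f(z,w) \bar g(1/z,1/w), for f, g in P_{n,m}, expanded in monomials. *)
Definition lprod (f g : bipoly R) : laurent R n m :=
  \sum_(s < n.+1) \sum_(k < m.+1) \sum_(s' < n.+1) \sum_(k' < m.+1)
    (f`_s`_k * Num.conj g`_s'`_k') *: lmon (s%:Z - s'%:Z) (k%:Z - k'%:Z).

Variable T : {scalar laurent R n m}.

Definition positive_form : Prop :=
  forall f, polys n m f -> f != 0 -> 0 < T (lprod f f).

(* The inner product of H_T; only meaningful on P_{n,m}. *)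
Definition inner (f g : bipoly R) : C := T (lprod f g).

Definition orth (A B : set (bipoly R)) : Prop :=
  forall f g, A f -> B g -> inner f g = 0.

Definition ominus (A B : set (bipoly R)) : set (bipoly R) :=
  [set f | A f /\ orth [set f] B].

Definition orth_dsum (A K1 K2 : set (bipoly R)) : Prop :=
  [/\ A = [set f + g | f in K1 & g in K2], K1 `&` K2 = [set 0] & orth K1 K2].

(* E^1_{k,l} *)
Definition E1 (k l : int) : set (bipoly R) :=
  ominus (polys k l) (mulset 'Y (polys k (l - 1))).

Definition split_shift : Prop :=
  exists K1 K2 : set (bipoly R),
    [/\ subspace K1 /\ K1 `<=` polys n m,
        subspace K2 /\ K2 `<=` polys n m,
        orth_dsum (E1 (n%:Z - 1) m) K1 K2,
        orth K1 (mulset 'X K2) &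
        K1 `<=` E1 n m /\ mulset 'X K2 `<=` E1 n m].

End Forms.
End BernsteinSzego.

(* Main.v *)
(* Split-shift condition -> factorization. E^1_{n,m} contains a unit vector p
   orthogonal to K1 and zK2. For |z0| = 1, evaluation at z0 is injective on the
   complement X of P_{n-1,m} in P_{n,m} and transports the inner product to polynomials
   in w. The split-shift condition turns the kernel of P_{n,m} into a recurrence in m
   for the transported kernels; hence the transported form is Toeplitz, and p(z0, .) is
   its reversed orthonormal polynomial, so that p(z0, .) has no zeros in the closed disc
   and the form is integration against 1/|p(z0, .)|^2. Integrating over z0, the weights
   1/t and 1/|p|^2 define the same form on X, and X is orthogonal to P_{n-1,m} for both
   (iterate the compression of multiplication by z to P_{n-1,m}); as both forms are
   Toeplitz, they agree on P_{n,m}. Finally the integral of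
   (|p|^2 - t) (1/t - 1/|p|^2) vanishes, whence t = |p|^2.

   Factorization -> split-shift condition. Write p(z,0) = a(z) b(z), the zeros of a
   inside the circle and those of b outside. K1 consists of the f in E^1_{n-1,m} with
   f(z,0) = b v, deg v < deg a, and K2 of those with f(z,0) divisible by a. Then K1 is
   orthogonal to z^j p for j >= 0 and K2 for j < 0, and such one-sided orthogonality
   propagates to all z^j w^k with 1 <= k <= m. *)

Require Import Defs.
From mathcomp Require Import all_boot all_order all_algebra.
From mathcomp Require Import polyXY complex.
From mathcomp Require Import all_classical all_reals all_analysis.
From mathcomp Require Import ring lra zify.

Set Implicit Arguments.
Unset Strict Implicit.
Unset Printing Implicit Defensive.

Import Order.TTheory GRing.Theory Num.Theory.
Import numFieldNormedType.Exports.

Local Open Scope classical_set_scope.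
Local Open Scope complex_scope.
Local Open Scope ring_scope.

(** * The normalized integral over the torus and its elementary properties *)

Section TorusIntegral.
Variable R : realType.
Local Notation C := R[i].
Local Notation mu := (@lebesgue_measure R).
Local Notation RR := (measurableTypeR R * measurableTypeR R)%type.

(** No function theory is used. Cauchy's formula and expansions at 0 or at infinity are replaced by
    one device: Bessel's inequality bounds the moments of a continuous function, and a bounded
    sequence annihilated by a polynomial in the shift without zeros in the closed disc vanishes.

    The point z0 lies on the circle because multiplication by z, an isometry, becomes a unimodular
    scalar there. Hence the complements of P_{n-1,m} and of zP_{n-1,m} in P_{n,m} transport the same
    form to polynomials in w. Reversal of coefficients exchanges these complements, so the
    transported form is symmetric under reversal, in degree m and likewise in degree m - 1. The
    recurrence compares the two degrees, and two reversals compose to a shift.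

    In the converse, orthogonality to z^j w^k is given only for j < n and has to reach all j. The
    basis dual to the powers of w for 1/|p(z, .)|^2 is, times z^n, polynomial in z of degree at most
    2n. Truncating at z^N therefore costs only the next n powers of z, which is where the geometric
    growth comes from. *)

Lemma measurable_open_box (U : set (R * R)) : open U -> measurable (U : set RR).
Proof.
move=> oU.
(* The product sigma-algebra is generated by boxes, so an open set is exhibited as a countable union
   of boxes with rational corners. *)
pose box (a b c d : rat) : set (R * R) :=
  `]ratr a, ratr b[%classic `*` `]ratr c, ratr d[%classic.
have -> : U = \bigcup_a \bigcup_b \bigcup_c \bigcup_d
    (if `[< box a b c d `<=` U >] then box a b c d else set0).
  apply/seteqP; split => [[x y] Uxy|x [a _] [b _] [c _] [d _]]; last first.
    by case: ifPn => // /asboolP; apply.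
  have /nbhs_ballP[e /= e0 He] : nbhs (x, y) U by exact: open_nbhs_nbhs.
  have [a] := @rat_in_itvoo R (x - e) x ltac:(by rewrite ltrBlDr ltrDl); rewrite in_itv /= => /andP[a1 a2].
  have [b] := @rat_in_itvoo R x (x + e) ltac:(by rewrite ltrDl); rewrite in_itv /= => /andP[b1 b2].
  have [c] := @rat_in_itvoo R (y - e) y ltac:(by rewrite ltrBlDr ltrDl); rewrite in_itv /= => /andP[c1 c2].
  have [d] := @rat_in_itvoo R y (y + e) ltac:(by rewrite ltrDl); rewrite in_itv /= => /andP[d1 d2].
  exists a => //; exists b => //; exists c => //; exists d => //.
  rewrite asboolT; first by split; rewrite /= in_itv /=; apply/andP.
  move=> [u v] [/= ]; rewrite !in_itv /= => /andP[u1 u2] /andP[v1 v2].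
  by apply: He; split; rewrite /ball /= ltr_distlC; lra.
do 4! (apply: bigcupT_measurable_rat => ?).
by case: ifPn => _ //; apply: measurableX; exact: measurable_itv.
Qed.

Lemma continuous2_measurable (f : R * R -> R) :
  continuous f -> measurable_fun setT (f : RR -> R).
Proof.
move=> cf; apply: (measurability _ (measurable_realfun.RGenOInfty.measurableE R)).
move=> /= _ [_ [a ->]] <-; rewrite setTI.
by apply: measurable_open_box; apply: open_comp => // y _; exact: cf.
Qed.

Let D : set (R * R) := `[0, 2 * pi] `*` `[0, 2 * pi].
Let mu2 := (mu \x mu)%E.

Lemma measurable_square : measurable (D : set RR). Proof. by apply: measurableX; exact: measurable_itv. Qed.

Lemma measure_period : mu `[0, 2 * pi]%classic = (2 * pi)%:E.
Proof.
rewrite lebesgue_measure_itv /= lte_fin mulr_gt0 ?pi_gt0 //.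
by rewrite -EFinD subr0.
Qed.

Lemma measure_square : mu2 D = ((2 * pi) ^+ 2)%:E.
Proof. by rewrite /mu2 /D product_measure1E //= measure_period -EFinM -expr2. Qed.

Lemma integrable_square (f : R * R -> R) : continuous f -> mu2.-integrable D (EFin \o f).
Proof.
move=> cf; apply: measurable_bounded_integrable; first exact: measurable_square.
- by apply: (le_lt_trans _ (ltry ((2 * pi) ^+ 2))); rewrite -measure_square.
- by apply: measurable_funTS; exact: continuous2_measurable.
- have cD : compact D by apply: compact_setX; exact: segment_compact.
  have [|M [_ HM]] := @compact_bounded R R^o (f @` D) _.
    by apply: (@continuous_compact _ R^o) => //; apply: continuous_subspaceT.
  exists M; split; rewrite ?num_real // => N MN x Dx.
  by apply: (HM N MN); exists x.
Qed.

Definition J2 (f : R * R -> R) : R := \int[mu2]_(x in D) f x.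

Lemma J2D (f g : R * R -> R) : continuous f -> continuous g -> J2 (f \+ g) = J2 f + J2 g.
Proof. by move=> cf cg; rewrite /J2 RintegralD //; [exact: measurable_square|exact: integrable_square..]. Qed.

Lemma J2Z (c : R) (f : R * R -> R) : continuous f -> J2 (fun x => c * f x) = c * J2 f.
Proof. by move=> cf; rewrite /J2 RintegralZl //; [exact: measurable_square|exact: integrable_square]. Qed.

Lemma J2_ge0 (f : R * R -> R) : (forall x, 0 <= f x) -> 0 <= J2 f.
Proof. by move=> f0; apply: Rintegral_ge0. Qed.

Lemma J2_gt0 (f : R * R -> R) x : continuous f -> (forall y, 0 <= f y) -> D x -> 0 < f x -> 0 < J2 f.
Proof.
move=> cf f0 Dx fx.
have : nbhs x (f @^-1` `]f x / 2, +oo[%classic).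
  apply: cf; apply: open_nbhs_nbhs; split=> /=; first exact: interval_open.
  by rewrite in_itv /= andbT; lra.
move=> /nbhs_ballP[e /= e0 He].
case: x Dx fx He => x y [] /=; rewrite !in_itv /= => /andP[x0 x1] /andP[y0 y1] fx He.
(* The point may lie on the boundary of the square, so the interval extends to one side of [u] only,
   the side on which the period leaves room. *)
have itv u : 0 <= u -> u <= 2 * pi -> exists a b : R, [/\ a < b, 0 <= a, b <= 2 * pi, u - e < a & b < u + e].
  move=> u0 u1; have p0 := @pi_gt0 R.
  have [h|h] := leP u pi.
    by exists u, (Num.min (u + e / 2) (2 * pi)); split; rewrite ?lt_min ?ge_min ?gt_min; lra.
  by exists (Num.max (u - e / 2) 0), u; split; rewrite ?gt_max ?le_max ?lt_max; lra.
have [a [b [ab a0 b1 a1 b2]]] := itv x x0 x1.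
have [c [d [cd c0 d1 c1 d2]]] := itv y y0 y1.
pose B := `[a, b]%classic `*` `[c, d]%classic.
have mB : measurable (B : set RR) by apply: measurableX; exact: measurable_itv.
have BD : B `<=` D.
  move=> [u v] [] /=; rewrite !in_itv /= => /andP[u1 u2] /andP[v1 v2].
  by split; rewrite /= in_itv /=; lra.
have muB : mu2 B = ((b - a) * (d - c))%:E.
  rewrite /mu2 /B product_measure1E ?measurable_itv //.
  by rewrite [in LHS]/= !lebesgue_measure_itv /= !lte_fin ab cd -!EFinD -EFinM.
have H : 0 < \int[mu2]_(z in B) (f (x, y) / 2).
  rewrite Rintegral_cst //.
  set u := fine _; have -> : u = (b - a) * (d - c) by rewrite /u; exact: (congr1 fine muB).
  by rewrite mulr_gt0 ?divr_gt0 ?mulr_gt0 ?subr_gt0.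
apply: (lt_le_trans H); rewrite /J2.
have le1 : \int[mu2]_(z in B) (f (x, y) / 2) <= \int[mu2]_(z in B) f z.
  apply: le_Rintegral => //.
  - apply: measurable_bounded_integrable => //; last exact: bounded_cst.
    by apply: (le_lt_trans _ (ltry ((b - a) * (d - c)))); rewrite -muB.
  - exact: (integrableS measurable_square mB BD (integrable_square cf)).
  - move=> [u v] [] /=; rewrite !in_itv /= => /andP[u1 u2] /andP[v1 v2].
    have /(He (u, v)) : ball (x, y) e (u, v) by split; rewrite /ball /= ltr_distlC; lra.
    by rewrite /= in_itv /= andbT => /ltW.
apply: (le_trans le1).
have -> : B = D `&` B by apply/seteqP; split => [z Bz|z []//]; split=> //; exact: BD.
rewrite Rintegral_mkcondr; apply: le_Rintegral => //; first exact: measurable_square.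
- rewrite -restrict_EFin.  apply: (iffLR (integrable_restrict _ mB measurable_square _)).
  have DB : D `&` B `<=` D by move=> z [].
  exact: (integrableS measurable_square (measurableI _ _ measurable_square mB) DB (integrable_square cf)).
- exact: integrable_square.
- by move=> z _; rewrite patchE; case: ifP.
Qed.

Let II : set R := `[0, 2 * pi].
Definition J1 (f : R -> R) : R := \int[mu]_(x in II) f x.

Lemma measurable_period : measurable (II : set (measurableTypeR R)). Proof. exact: measurable_itv. Qed.

Lemma integrable_period (f : R -> R) : continuous f -> mu.-integrable II (EFin \o f).
Proof.
move=> cf; apply: continuous_compact_integrable; first exact: segment_compact.
exact: continuous_subspaceT.
Qed.

Lemma continuous_snd (T : topologicalType) (f : R * R -> T) (x : R) :
  continuous f -> continuous (fun y => f (x, y)).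
Proof.
move=> cf y; apply: (@continuous_comp _ _ _ (fun y : R => (x, y)) f); last exact: cf.
exact: (cvg_pair (cvg_cst x) (@cvg_id _ _)).
Qed.

Lemma J2_iter (f : R * R -> R) : continuous f -> J2 f = J1 (fun x => J1 (fun y => f (x, y))).
Proof.
move=> cf; rewrite /J2 /J1 /Rintegral integral_mkcond.
have i2 : mu2.-integrable setT ((EFin \o f) \_ D).
  apply/integrable_restrict; [exact: measurable_square|exact: measurableT|rewrite setTI; exact: integrable_square].
have := integral12_prod_meas1 i2; rewrite /fubini_F => <-.
congr fine; rewrite [RHS]integral_mkcond; apply: eq_integral => x _.
rewrite [in RHS]patchE.
have cx := @continuous_snd _ f x cf.
case: ifPn => xI.
  rewrite fineK; last by have := integrable_fin_num measurable_period (integrable_period cx).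
  rewrite [RHS]integral_mkcond; apply: eq_integral => y _.
  rewrite !patchE /D in_setX xI /=; by case: ifP.
by apply: integral0_eq => y _; rewrite patchE /D in_setX (negPf xI).
Qed.
Lemma J2_snd (g : R -> R) : continuous g -> J2 (fun p => g p.2) = 2 * pi * J1 g.
Proof.
move=> cg; rewrite J2_iter /=; last by move=> x; apply: continuous_comp; [exact: cvg_snd|exact: cg].
rewrite /J1 Rintegral_cst; last exact: measurable_period.
by rewrite mulrC; congr (_ * _); rewrite -[RHS]/(fine (2 * pi)%:E) -measure_period.
Qed.

Lemma J2_fst (g : R -> R) : continuous g -> J2 (fun p => g p.1) = 2 * pi * J1 g.
Proof.
move=> cg; rewrite J2_iter /=; last by move=> x; apply: continuous_comp; [exact: cvg_fst|exact: cg].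
rewrite -[in RHS]/(fine (2 * pi)%:E) -measure_period.
rewrite {1}/J1; under eq_Rintegral do rewrite /J1 (Rintegral_cst _ measurable_period).
rewrite RintegralZr; [by rewrite mulrC|exact: measurable_period|exact: integrable_period].
Qed.

(** The inner integral is also written as a double integral, of a function constant in the first
    variable. Fubini's theorem thus becomes a statement about the torus mean alone, which is the
    form of [tm_fub]. *)
Lemma J2_fubini (f : R * R -> R) (phi : R -> R) : continuous f -> continuous phi ->
  (forall x, J2 (fun p => f (x, p.2)) = (2 * pi) ^+ 2 * phi x) -> J2 f = J2 (fun p => phi p.1).
Proof.
move=> cf cphi H; have p0 : 2 * pi != 0 :> R by rewrite lt0r_neq0 // mulr_gt0 ?pi_gt0.
rewrite J2_fst // J2_iter // -RintegralZl; [|exact: measurable_period|exact: integrable_period].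
apply: eq_Rintegral => x _; apply: (mulfI p0); rewrite mulrA -expr2 -H.
by rewrite (@J2_snd (fun y => f (x, y))) //; apply: (@continuous_snd _ f _ cf).
Qed.

Lemma continuous_scale (k : R) : continuous (fun x : R => k * x).
Proof. exact: mulrl_continuous. Qed.

Lemma J1_derive (f F : R -> R) : continuous f -> (forall x : R, is_derive x 1 F (f x)) ->
  F (2 * pi) = F 0 -> J1 f = 0.
Proof.
move=> cf dF F0; have cF : continuous F.
  move=> x; apply: differentiable_continuous; apply/derivable1_diffP; exact: (@ex_derive _ _ _ _ _ _ _ (dF x)).
rewrite /J1 /Rintegral (@continuous_FTC2 _ _ F) ?mulr_gt0 ?pi_gt0 //.
- by rewrite F0 -EFinB subrr.
- exact: continuous_subspaceT.
- split => [x _||]; first exact: (@ex_derive _ _ _ _ _ _ _ (dF x)).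
  + by apply: cvg_at_right_filter; exact: cF.
  + by apply: cvg_at_left_filter; exact: cF.
- by move=> x _; rewrite derive1E; apply: derive_val.
Qed.

Lemma J1_cos (k : R) : k != 0 -> sin (k * (2 * pi)) = 0 -> J1 (fun x => cos (k * x)) = 0.
Proof.
move=> k0 s0; apply: (@J1_derive _ (fun x => k^-1 * sin (k * x))).
- move=> x; apply: (@continuous_comp _ _ _ (fun x => k * x)); last exact: continuous_cos.
  exact: continuous_scale.
- move=> x; apply: is_derive_eq.
  by rewrite /GRing.scale /=; field.
- by rewrite s0 !mulr0 sin0 mulr0.
Qed.

Lemma J1_sin (k : R) : cos (k * (2 * pi)) = 1 -> J1 (fun x => sin (k * x)) = 0.
Proof.
move=> s0; have [->|k0] := eqVneq k 0.
  by rewrite /J1; under eq_Rintegral do rewrite mul0r sin0; rewrite Rintegral_cst ?mul0r //; exact: measurable_period.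
apply: (@J1_derive _ (fun x => - k^-1 * cos (k * x))).
- move=> x; apply: (@continuous_comp _ _ _ (fun x => k * x)); last exact: continuous_sin.
  exact: continuous_scale.
- move=> x; apply: is_derive_eq.
  by rewrite /GRing.scale /=; field.
- by rewrite s0 mulr0 cos0.
Qed.

Definition rc2 (f : R * R -> C) : Prop :=
  continuous (fun x => complex.Re (f x)) /\ continuous (fun x => complex.Im (f x)).

Definition pull (F : C -> C -> C) (x : R * R) : C := F (cis x.1) (cis x.2).

(* Admissible integrands: continuous on the torus. *)
Definition adm (F : C -> C -> C) : Prop := rc2 (pull F).

Lemma normr_cis (x : R) : `|cis x| = 1.
Proof. by rewrite normc_def /cis /= cos2Dsin2 sqrtr1. Qed.

Lemma cis_surj (z : C) : `|z| = 1 -> exists2 x : R, 0 <= x <= 2 * pi & z = cis x.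
Proof.
case: z => a b; rewrite normc_def /= => -[].
move=> /(congr1 (fun x => x ^+ 2)); rewrite sqr_sqrtr ?addr_ge0 ?sqr_ge0 // expr1n => ab.
have p0 := @pi_gt0 R.
have a1 : -1 <= a <= 1.
  by rewrite -ler_norml -(@ler_pXn2r _ 2) ?nnegrE // real_normK ?num_real // expr1n -ab lerDl sqr_ge0.
have := acosK a1; have := acos_ge0 a1; have := acos_lepi a1; set x := acos a => x1 x0 cx.
have sx : sin x ^+ 2 = b ^+ 2 by rewrite -[RHS](addKr (a ^+ 2)) ab -cx sin2cos2 addrC.
move/eqP: sx; rewrite eqf_sqr => /orP[]/eqP sx.
  by exists x; [lra|rewrite /cis cx sx].
exists (2 * pi - x); first lra.
rewrite /cis mulrC mulr_natr; apply/eqP; rewrite eq_complex /=.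
by rewrite cosB sinB cos2pi sin2pi !mul1r !mul0r addr0 sub0r cx sx opprK !eqxx.
Qed.

Lemma adm_cst (c : C) : adm (fun _ _ => c).
Proof. by split=> x; exact: cvg_cst. Qed.

Lemma adm_z : adm (fun z _ => z).
Proof.
by split=> x; apply: continuous_comp; [exact: cvg_fst|exact: continuous_cos|exact: cvg_fst|exact: continuous_sin].
Qed.

Lemma adm_w : adm (fun _ w => w).
Proof.
by split=> x; apply: continuous_comp; [exact: cvg_snd|exact: continuous_cos|exact: cvg_snd|exact: continuous_sin].
Qed.

Lemma complex_ReD (x y : C) : complex.Re (x + y) = complex.Re x + complex.Re y. Proof. by case: x y => ? ? []. Qed.
Lemma complex_ImD (x y : C) : complex.Im (x + y) = complex.Im x + complex.Im y. Proof. by case: x y => ? ? []. Qed.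
Lemma complex_ReM (x y : C) : complex.Re (x * y) = complex.Re x * complex.Re y - complex.Im x * complex.Im y.
Proof. by case: x y => ? ? []. Qed.
Lemma complex_ImM (x y : C) : complex.Im (x * y) = complex.Re x * complex.Im y + complex.Im x * complex.Re y.
Proof. by case: x y => ? ? []. Qed.

Lemma adm_add F G : adm F -> adm G -> adm (fun z w => F z w + G z w).
Proof.
move=> [F1 F2] [G1 G2]; split=> x; rewrite /pull.
  under eq_fun do rewrite complex_ReD; exact: cvgD (F1 x) (G1 x).
under eq_fun do rewrite complex_ImD; exact: cvgD (F2 x) (G2 x).
Qed.

Lemma adm_mul F G : adm F -> adm G -> adm (fun z w => F z w * G z w).
Proof.
move=> [F1 F2] [G1 G2]; split=> x; rewrite /pull.
  under eq_fun do rewrite complex_ReM; exact: cvgB (cvgM (F1 x) (G1 x)) (cvgM (F2 x) (G2 x)).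
under eq_fun do rewrite complex_ImM; exact: cvgD (cvgM (F1 x) (G2 x)) (cvgM (F2 x) (G1 x)).
Qed.

Lemma adm_conj F : adm F -> adm (fun z w => (F z w)^* ).
Proof.
move=> [F1 F2]; split=> x; rewrite /pull.
  rewrite (_ : (fun _ => _) = (fun x => complex.Re (pull F x))); first exact: F1.
  by apply/funext => y; rewrite /pull; case: (F _ _).
rewrite (_ : (fun _ => _) = (fun x => - complex.Im (pull F x))); first exact: cvgN (F2 x).
by apply/funext => y; rewrite /pull; case: (F _ _).
Qed.

Lemma adm_inv F : (forall z w, `|z| = 1 -> `|w| = 1 -> F z w != 0) -> adm F -> adm (fun z w => (F z w)^-1).
Proof.
move=> F0 [F1 F2].
pose N x := complex.Re (pull F x) ^+ 2 + complex.Im (pull F x) ^+ 2.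
have N0 x : N x != 0.
  have := F0 _ _ (normr_cis x.1) (normr_cis x.2).
  rewrite /N /pull; apply: contra_neq => /eqP; rewrite paddr_eq0 ?sqr_ge0 // !sqrf_eq0.
  by move=> /andP[/eqP a /eqP b]; apply/eqP; rewrite eq_complex a b /= eqxx.
have cN : continuous N by move=> x; apply: cvgD; apply: cvgM; [exact: F1|exact: F1|exact: F2|exact: F2].
have cNV : continuous (fun x => (N x)^-1) by move=> x; apply: cvgV; [exact: N0|exact: cN].
split=> x; rewrite /pull.
  rewrite (_ : (fun _ => _) = (fun x => complex.Re (pull F x) * (N x)^-1)); first exact: cvgM (F1 x) (cNV x).
  by apply/funext => y; rewrite /N /pull; case: (F _ _).
rewrite (_ : (fun _ => _) = (fun x => - (complex.Im (pull F x) * (N x)^-1))); first exact: cvgN (cvgM (F2 x) (cNV x)).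
by apply/funext => y; rewrite /N /pull; case: (F _ _) => a b /=.
Qed.

Lemma adm_sum (I : Type) (r : seq I) (P : pred I) (F : I -> C -> C -> C) :
  (forall i, adm (F i)) -> adm (fun z w => \sum_(i <- r | P i) F i z w).
Proof.
move=> aF; elim: r => [|i r IH].
  by rewrite (_ : (fun _ _ => _) = fun _ _ => 0); [exact: adm_cst|(apply/funext => z; apply/funext => w); rewrite big_nil].
rewrite (_ : (fun _ _ => _) = fun z w => (if P i then F i z w else 0) + \sum_(j <- r | P j) F j z w).
  by apply: adm_add IH; case: (P i) => //; exact: adm_cst.
by (apply/funext => z; apply/funext => w); rewrite big_cons; case: ifP => _ //; rewrite add0r.
Qed.

Lemma adm_ext (F G : C -> C -> C) : (forall z w, `|z| = 1 -> `|w| = 1 -> F z w = G z w) -> adm F -> adm G.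
Proof.
move=> FG; rewrite /adm (_ : pull G = pull F) //.
by apply/funext => x; rewrite /pull FG ?normr_cis.
Qed.

Lemma adm_expn F k : adm F -> adm (fun z w => F z w ^+ k).
Proof.
move=> aF; elim: k => [|k IH]; first exact: adm_cst.
rewrite (_ : (fun _ _ => _) = fun z w => F z w * F z w ^+ k); first exact: adm_mul.
by (apply/funext => z; apply/funext => w); rewrite exprS.
Qed.

Lemma adm_expz F (k : int) : (forall z w, `|z| = 1 -> `|w| = 1 -> F z w != 0) -> adm F -> adm (fun z w => F z w ^ k).
Proof.
move=> F0 aF; case: k => k; first exact: (adm_expn k aF).
apply: (@adm_inv (fun z w => F z w ^+ k.+1)); last exact: adm_expn.
by move=> z w z1 w1; rewrite expf_neq0 // F0.
Qed.

(* The properties of the normalized integral over T^2 that are used; unlike the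
   integral itself they are visibly stable under z -> 1/z. *)
Record torus_mean (I : (C -> C -> C) -> C) : Prop := TorusMean {
  tm_ext : forall F G, (forall z w, `|z| = 1 -> `|w| = 1 -> F z w = G z w) -> I F = I G;
  tm_lin : forall c F G, adm F -> adm G -> I (fun z w => c * F z w + G z w) = c * I F + I G;
  tm_conj : forall F, adm F -> I (fun z w => (F z w)^* ) = (I F)^*;
  tm_ge0 : forall F, adm F -> (forall z w, `|z| = 1 -> `|w| = 1 -> 0 <= F z w) -> 0 <= I F;
  tm_eq0 : forall F, adm F -> (forall z w, `|z| = 1 -> `|w| = 1 -> 0 <= F z w) -> I F = 0 ->
    forall z w, `|z| = 1 -> `|w| = 1 -> F z w = 0;
  tm_mon : forall j k : int, I (fun z w => z ^ j * w ^ k) = ((j == 0) && (k == 0))%:R;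
  tm_fub : forall F phi, adm F -> adm (fun z _ => phi z) ->
    (forall z, `|z| = 1 -> I (fun _ w => F z w) = phi z) -> I F = I (fun z _ => phi z) }.

Definition torus_avg (F : C -> C -> C) : C := torus_integral F / ((2 * pi) ^+ 2)%:C.

Lemma sqr_2pi_neq0 : ((2 * pi) ^+ 2)%:C != 0 :> C.
Proof. by rewrite -[0]/(0%:C) (inj_eq (@complexI R)) expf_neq0 // lt0r_neq0 // mulr_gt0 ?pi_gt0. Qed.

Lemma torus_integralE F : torus_integral F =
  Complex (J2 (fun x => complex.Re (pull F x))) (J2 (fun x => complex.Im (pull F x))).
Proof. by []. Qed.

Lemma J2_lin (c : R) f g : continuous f -> continuous g -> J2 (fun x => c * f x + g x) = c * J2 f + J2 g.
Proof.
move=> cf cg; rewrite -J2Z // -J2D //.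
by move=> x; apply: cvgM; [exact: cvg_cst|exact: cf].
Qed.

Lemma cis_expz (x : R) (k : int) : cis x ^ k = cis (k%:~R * x).
Proof.
have Hn (n : nat) : cis x ^+ n = cis (n%:R * x).
  elim: n => [|n IH]; first by rewrite expr0 mul0r /cis cos0 sin0.
  rewrite exprS IH -addn1 natrD mulrDl mul1r addrC /cis cosD sinD.
  by apply/eqP; rewrite eq_complex /= eqxx /= addrC; apply/eqP; ring.
case: k => n; first by rewrite -exprnP Hn.
rewrite NegzE -exprnN Hn mulrNz mulNr /cis cosN sinN.
apply/eqP; rewrite eq_complex /= cos2Dsin2 !divr1 !eqxx //.
Qed.

Lemma torus_avg_lin c F G : adm F -> adm G -> torus_avg (fun z w => c * F z w + G z w) = c * torus_avg F + torus_avg G.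
Proof.
move=> aF aG; rewrite /torus_avg mulrA -mulrDl; congr (_ / _).
  have [[F1 F2] [G1 G2]] := (aF, aG).
  rewrite !torus_integralE; case: c => a b.
  have -> : (fun x => complex.Re (pull (fun z w => (a +i* b) * F z w + G z w) x)) =
     fun x => a * complex.Re (pull F x) + ((- b) * complex.Im (pull F x) + complex.Re (pull G x)).
    by apply/funext => x; rewrite /pull complex_ReD complex_ReM /=; ring.
  have -> : (fun x => complex.Im (pull (fun z w => (a +i* b) * F z w + G z w) x)) =
     fun x => a * complex.Im (pull F x) + (b * complex.Re (pull F x) + complex.Im (pull G x)).
    by apply/funext => x; rewrite /pull complex_ImD complex_ImM /=; ring.
  have cZ (d : R) (f : R * R -> R) : continuous f -> continuous (fun x => d * f x).
    by move=> cf x; apply: cvgM; [exact: cvg_cst|exact: cf].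
  have cD (f g : R * R -> R) : continuous f -> continuous g -> continuous (fun x => f x + g x).
    by move=> cf cg x; apply: cvgD; [exact: cf|exact: cg].
  rewrite !J2_lin //; [|by apply: cD => //; exact: cZ..].
  by apply/eqP; rewrite eq_complex /=; apply/andP; split; apply/eqP; ring.
Qed.

Lemma torus_avg_fub F phi : adm F -> adm (fun z _ => phi z) ->
  (forall z, `|z| = 1 -> torus_avg (fun _ w => F z w) = phi z) -> torus_avg F = torus_avg (fun z _ => phi z).
Proof.
move=> [F1 F2] [p1 p2] H; rewrite /torus_avg !torus_integralE; congr (_ / _).
have {}H x : Complex (J2 (fun p => complex.Re (F (cis x) (cis p.2)))) (J2 (fun p => complex.Im (F (cis x) (cis p.2))))
    = ((2 * pi) ^+ 2)%:C * phi (cis x).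
  by rewrite -(H _ (normr_cis x)) /torus_avg mulrC divfK ?sqr_2pi_neq0.
have c1 : continuous (fun x => complex.Re (phi (cis x))).
  move=> x; apply: (@continuous_comp _ _ _ (fun y : R => (y, 0 : R)) (fun p => complex.Re (phi (cis p.1)))); last exact: p1.
  exact: (cvg_pair (@cvg_id _ _) (cvg_cst 0)).
have c2 : continuous (fun x => complex.Im (phi (cis x))).
  move=> x; apply: (@continuous_comp _ _ _ (fun y : R => (y, 0 : R)) (fun p => complex.Im (phi (cis p.1)))); last exact: p2.
  exact: (cvg_pair (@cvg_id _ _) (cvg_cst 0)).
rewrite (@J2_fubini (fun x => complex.Re (pull F x)) (fun x => complex.Re (phi (cis x)))) //; last first.
  by move=> x; have /(congr1 (@complex.Re R)) := H x; rewrite complex_ReM /= mul0r subr0.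
rewrite (@J2_fubini (fun x => complex.Im (pull F x)) (fun x => complex.Im (phi (cis x)))) //.
by move=> x; have /(congr1 (@complex.Im R)) := H x; rewrite complex_ImM /= mul0r addr0.
Qed.

Lemma cis_period (u : int) : cis (u%:~R * (2 * pi) : R) = 1.
Proof.
rewrite -cis_expz /cis (_ : 2 * pi = pi *+ 2 :> R) ?cos2pi ?sin2pi ?exp1rz //.
by rewrite mulrC mulr_natr.
Qed.

Lemma J1_cis (u : int) :
  J1 (fun x => complex.Re (cis x ^ u)) = (if u == 0 then 2 * pi else 0) /\
  J1 (fun x => complex.Im (cis x ^ u)) = 0.
Proof.
have e1 : (fun x : R => complex.Re (cis x ^ u)) = (fun x : R => cos (u%:~R * x)).
  by apply/funext => x; rewrite cis_expz.
have e2 : (fun x : R => complex.Im (cis x ^ u)) = (fun x : R => sin (u%:~R * x)).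
  by apply/funext => x; rewrite cis_expz.
have [h1 h2] := cis_period u.
rewrite e1 e2; split; last exact: J1_sin.
case: eqVneq => [->|u0]; last by rewrite J1_cos // intr_eq0.
rewrite /J1; under eq_Rintegral do rewrite mul0r cos0.
by rewrite Rintegral_cst; [rewrite mul1r -[RHS]/(fine (2 * pi)%:E) -measure_period|exact: measurable_period].
Qed.

Lemma unit_neq0 (z : C) : `|z| = 1 -> z != 0.
Proof. by move=> z1; rewrite -normr_eq0 z1 oner_eq0. Qed.

Lemma adm_expz_z (k : int) : adm (fun z _ => z ^ k).
Proof. by apply: (adm_expz k _ adm_z) => z w z1 _; exact: unit_neq0. Qed.

Lemma adm_expz_w (k : int) : adm (fun _ w => w ^ k).
Proof. by apply: (adm_expz k _ adm_w) => z w _; exact: unit_neq0. Qed.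

Lemma torus_avg_mon (j k : int) : torus_avg (fun z w => z ^ j * w ^ k) = ((j == 0) && (k == 0))%:R.
Proof.
have p0 : 2 * pi != 0 :> R by rewrite lt0r_neq0 // mulr_gt0 ?pi_gt0.
have Hs (u : int) : Complex (2 * pi * (if u == 0 then 2 * pi else 0)) (2 * pi * 0) / ((2 * pi) ^+ 2)%:C
    = (u == 0)%:R :> C.
  case: eqP => _; last by rewrite !mulr0 /= mul0r.
  by rewrite mulr0 -expr2 -[Complex _ 0]/(_%:C) divff ?sqr_2pi_neq0.
have Hw (u : int) : torus_avg (fun _ w => w ^ u) = (u == 0)%:R.
  rewrite /torus_avg torus_integralE -Hs; have [j1 j2] := J1_cis u.
  congr (Complex _ _ / _).
    rewrite -j1; apply: (@J2_snd (fun y => complex.Re (cis y ^ u))) => x; have [h _] := adm_expz_w u; exact: (@continuous_snd _ _ 0 h).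
  rewrite -j2; apply: (@J2_snd (fun y => complex.Im (cis y ^ u))) => x; have [_ h] := adm_expz_w u; exact: (@continuous_snd _ _ 0 h).
have Hz (u : int) : torus_avg (fun z _ => z ^ u) = (u == 0)%:R.
  rewrite /torus_avg torus_integralE -Hs; have [j1 j2] := J1_cis u.
  congr (Complex _ _ / _).
    rewrite -j1; apply: (@J2_fst (fun y => complex.Re (cis y ^ u))) => x; have [h _] := adm_expz_w u; exact: (@continuous_snd _ _ 0 h).
  rewrite -j2; apply: (@J2_fst (fun y => complex.Im (cis y ^ u))) => x; have [_ h] := adm_expz_w u; exact: (@continuous_snd _ _ 0 h).
have lin1 c F : adm F -> torus_avg (fun z w => c * F z w) = c * torus_avg F.
  move=> aF; have := torus_avg_lin c aF (adm_cst 0).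
  rewrite (_ : torus_avg (fun _ _ => 0) = 0) ?addr0 => [<-|].
    by congr torus_avg; apply/funext => z; apply/funext => w; rewrite addr0.
  have e := torus_avg_lin (-1) (adm_cst 0) (adm_cst 0); apply: etrans (etrans _ e) _; last by rewrite mulN1r addNr.
  by congr torus_avg; apply/funext => z; apply/funext => w; rewrite mulr0 addr0.
rewrite (@torus_avg_fub _ (fun z => (k == 0)%:R * z ^ j)).
- by rewrite lin1 ?Hz; [rewrite -natrM mulnb andbC|exact: adm_expz_z].
- by apply: adm_mul; [exact: adm_expz_z|exact: adm_expz_w].
- by apply: adm_mul; [exact: adm_cst|exact: adm_expz_z].
- by move=> z _; rewrite lin1 ?Hw 1?mulrC //; exact: adm_expz_w.
Qed.

Lemma torus_avg_mean : torus_mean torus_avg.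
Proof.
split.
- move=> F G FG; rewrite /torus_avg !torus_integralE (_ : pull F = pull G) //.
  by apply/funext => x; rewrite /pull FG ?normr_cis.
- exact: torus_avg_lin.
- move=> F [F1 F2].
  have conjV (c : C) (r : R) : (c / r%:C)^* = c^* / r%:C.
    by rewrite (rmorphM Num.conj) (fmorphV Num.conj); congr (_ * _^-1); exact: conjc_real.
  rewrite /torus_avg conjV !torus_integralE; congr (_ / _).
  have -> : (fun x => complex.Re (pull (fun z w => (F z w)^* ) x)) = (fun x => complex.Re (pull F x)).
    by apply/funext => x; rewrite /pull; case: (F _ _).
  have -> : (fun x => complex.Im (pull (fun z w => (F z w)^* ) x)) = (fun x => (- 1) * complex.Im (pull F x)).
    by apply/funext => x; rewrite /pull mulN1r; case: (F _ _).
  by rewrite J2Z // mulN1r.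
- move=> F aF F0; rewrite /torus_avg divr_ge0 //; last by rewrite ler0c sqr_ge0.
  rewrite torus_integralE lecE /=; apply/andP; split; last first.
    by apply: J2_ge0 => x; have := F0 _ _ (normr_cis x.1) (normr_cis x.2); rewrite lecE => /andP[].
  have -> : (fun x => complex.Im (pull F x)) = (fun x => 0 * complex.Im (pull F x)).
    apply/funext => x; rewrite mul0r; have := F0 _ _ (normr_cis x.1) (normr_cis x.2).
    by rewrite lecE => /andP[/eqP].
  by rewrite J2Z ?mul0r //; case: aF.
- move=> F aF F0 /eqP; rewrite /torus_avg mulf_eq0 invr_eq0 (negPf sqr_2pi_neq0) orbF torus_integralE.
  rewrite eq_complex /= => /andP[/eqP re0 _] z w z1 w1.
  have [x xi ez] := cis_surj z1; have [y yi ew] := cis_surj w1; subst z w.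
  have := F0 _ _ z1 w1; rewrite lecE /= => /andP[/eqP im0 re_ge0].
  move: re_ge0; rewrite le_eqVlt => /orP[/eqP re00|re_gt0].
    by apply/eqP; rewrite eq_complex /= im0 -re00 !eqxx.
  suff: 0 < J2 (fun x => complex.Re (pull F x)) by rewrite re0 ltxx.
  apply: (@J2_gt0 _ (x, y)) => //; first by case: aF.
  - by move=> u; have := F0 _ _ (normr_cis u.1) (normr_cis u.2); rewrite lecE => /andP[].
- exact: torus_avg_mon.
- exact: torus_avg_fub.
Qed.
End TorusIntegral.

(** * Hermitian forms on finite-dimensional subspaces of a ring containing the scalars *)

Section FormsOnModules.
Variables (C : numClosedFieldType) (L : comNzRingType) (iota : {rmorphism C -> L}).
Implicit Types (f g h : L) (K P : set L) (ip : L -> L -> C) (a : L -> C).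

Definition subsp K := K 0 /\ forall c f g, K f -> K g -> K (iota c * f + g).

Definition linf a := forall c f g, a (iota c * f + g) = c * a f + a g.

Definition herm ip := (forall h, linf (ip ^~ h)) /\ forall f g, ip g f = (ip f g)^*.

Definition posdef P ip := forall f, P f -> f != 0 -> 0 < ip f f.

(** Finite dimension is encoded by [d] linear functionals that separate points: this passes to
    subspaces at once and needs no basis. *)
Definition fdim d (a : nat -> L -> C) K :=
  (forall i, linf (a i)) /\ forall f, K f -> (forall i, (i < d)%N -> a i f = 0) -> f = 0.

Lemma linf0 a : linf a -> a 0 = 0.
Proof. by move=> la; have := la (-1) 0 0; rewrite mulr0 addr0 mulN1r addNr. Qed.

Lemma linfD a f g : linf a -> a (f + g) = a f + a g.
Proof. by move=> la; have := la 1 f g; rewrite rmorph1 !mul1r. Qed.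

Lemma linfZ a c f : linf a -> a (iota c * f) = c * a f.
Proof. by move=> la; have := la c f 0; rewrite (linf0 la) !addr0. Qed.

Lemma linfN a f : linf a -> a (- f) = - a f.
Proof. by move=> la; rewrite -mulN1r -[X in X * _](rmorphN1 iota) linfZ // mulN1r. Qed.

Lemma linfB a f g : linf a -> a (f - g) = a f - a g.
Proof. by move=> la; rewrite linfD // linfN. Qed.

Lemma linf_sum a (I : Type) (r : seq I) (p : pred I) (F : I -> L) : linf a ->
  a (\sum_(i <- r | p i) F i) = \sum_(i <- r | p i) a (F i).
Proof.
by move=> la; apply: (big_morph a) => [f g|]; [exact: linfD|exact: linf0].
Qed.

Lemma subspD K f g : subsp K -> K f -> K g -> K (f + g).
Proof. by move=> [_ sK] Kf Kg; have := sK 1 f g Kf Kg; rewrite rmorph1 mul1r. Qed.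

Lemma subspZ K c f : subsp K -> K f -> K (iota c * f).
Proof. by move=> [K0 sK] Kf; have := sK c f 0 Kf K0; rewrite addr0. Qed.

Lemma subspN K f : subsp K -> K f -> K (- f).
Proof. by move=> sK Kf; have := subspZ (-1) sK Kf; rewrite rmorphN1 mulN1r. Qed.

Lemma subspB K f g : subsp K -> K f -> K g -> K (f - g).
Proof. by move=> sK Kf Kg; apply: subspD => //; exact: subspN. Qed.

Lemma subsp_sum K (I : Type) (r : seq I) (p : pred I) (F : I -> L) : subsp K ->
  (forall i, p i -> K (F i)) -> K (\sum_(i <- r | p i) F i).
Proof. by move=> sK KF; elim/big_ind: _ => //; [case: sK|move=> *; exact: subspD]. Qed.

Lemma subsp_mul K Z : subsp K -> subsp (fun f => exists2 g, K g & f = Z * g).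
Proof.
move=> [K0 sK]; split; first by exists 0; rewrite ?mulr0.
move=> c _ _ [f Kf ->] [g Kg ->]; exists (iota c * f + g); first exact: sK.
by rewrite mulrDr mulrCA.
Qed.

Lemma lin0 (F : L -> L) : (forall c f g, F (iota c * f + g) = iota c * F f + F g) -> F 0 = 0.
Proof. by move=> lF; have := lF (-1) 0 0; rewrite mulr0 addr0 rmorphN1 mulN1r addNr. Qed.

Lemma linZ (F : L -> L) c f : (forall c f g, F (iota c * f + g) = iota c * F f + F g) ->
  F (iota c * f) = iota c * F f.
Proof. by move=> lF; have := lF c f 0; rewrite (lin0 lF) !addr0. Qed.

Section Herm.
Variable ip : L -> L -> C.
Hypothesis hip : herm ip.

Lemma ipC f g : ip g f = (ip f g)^*. Proof. by case: hip. Qed.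
Lemma ip0l h : ip 0 h = 0. Proof. by case: hip => l _; exact: (linf0 (l h)). Qed.
Lemma ipDl f g h : ip (f + g) h = ip f h + ip g h.
Proof. by case: hip => l _; exact: (linfD f g (l h)). Qed.
Lemma ipZl c f h : ip (iota c * f) h = c * ip f h.
Proof. by case: hip => l _; exact: (linfZ c f (l h)). Qed.
Lemma ipBl f g h : ip (f - g) h = ip f h - ip g h.
Proof. by case: hip => l _; exact: (linfB f g (l h)). Qed.
Lemma ip0r h : ip h 0 = 0. Proof. by rewrite ipC ip0l conjC0. Qed.
Lemma ipDr f g h : ip h (f + g) = ip h f + ip h g.
Proof. by rewrite ipC ipDl rmorphD /= -!ipC. Qed.
Lemma ipZr c f h : ip h (iota c * f) = c^* * ip h f.
Proof. by rewrite ipC ipZl rmorphM /= -ipC. Qed.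
Lemma ipBr f g h : ip h (f - g) = ip h f - ip h g.
Proof. by rewrite ipC ipBl rmorphB /= -!ipC. Qed.
Lemma ip_suml (I : Type) (r : seq I) (p : pred I) (F : I -> L) h :
  ip (\sum_(i <- r | p i) F i) h = \sum_(i <- r | p i) ip (F i) h.
Proof. by case: hip => l _; exact: (linf_sum _ _ _ (l h)). Qed.
Lemma ip_sumr (I : Type) (r : seq I) (p : pred I) (F : I -> L) h :
  ip h (\sum_(i <- r | p i) F i) = \sum_(i <- r | p i) ip h (F i).
Proof.
by rewrite ipC ip_suml rmorph_sum; apply: eq_bigr => i _; rewrite /= -ipC.
Qed.
Lemma ip_eq0C f g : ip f g = 0 -> ip g f = 0.
Proof. by move=> h; rewrite ipC h conjC0. Qed.

Lemma orth_subsp K S (Z : L -> L) : subsp K -> subsp (fun f => K f /\ forall g, S g -> ip f (Z g) = 0).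
Proof.
move=> [K0 sK]; split=> [|c f g [Kf f0] [Kg g0]]; first by split=> // g _; exact: ip0l.
by split=> [|h Sh]; [exact: sK|rewrite ipDl ipZl f0 // g0 // mulr0 addr0].
Qed.

Lemma posdef_eq0 P f : posdef P ip -> P f -> ip f f = 0 -> f = 0.
Proof. by move=> pP Pf f0; apply/eqP; apply: contra_eqT f0 => /(pP f Pf)/lt0r_neq0. Qed.

(** Induction on the number of separating functionals: the representative on the kernel of the last
    one is corrected by a multiple of a vector [v] orthogonal to that kernel. *)
Lemma riesz d (a : nat -> L -> C) K (al : L -> C) : subsp K -> fdim d a K -> posdef K ip -> linf al ->
  exists2 r, K r & forall f, K f -> al f = ip f r.
Proof.
move=> sK [la]; elim: d K sK al => [|d IH] K sK al inj pK lal.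
  exists 0; first by case: sK.
  by move=> f /inj ->; rewrite ?ip0l ?(linf0 lal).
case: (pselect (forall f, K f -> a d f = 0)) => [ad0|].
  apply: IH => // f Kf fd; apply: inj => // i; rewrite ltnS leq_eqVlt => /predU1P[->|/fd //].
  exact: ad0.
move=> /existsNP[u /not_implyP[Ku /eqP adu]].
pose K' f := K f /\ a d f = 0.
have sK' : subsp K'.
  split; first by split; [case: sK|rewrite (linf0 (la d))].
  move=> c f g [Kf f0] [Kg g0]; split; first by case: sK => _; exact.
  by rewrite (la d) f0 g0 mulr0 addr0.
have pK' : posdef K' ip by move=> f [Kf _]; exact: pK.
have inj' : forall f, K' f -> (forall i, (i < d)%N -> a i f = 0) -> f = 0.
  by move=> f [Kf f0] fd; apply: inj => // i; rewrite ltnS leq_eqVlt => /predU1P[->|/fd].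
have [r0 K'r0 Hr0] := IH K' sK' (ip^~ u) inj' pK' (hip.1 u).
have [r K'r Hr] := IH K' sK' al inj' pK' lal.
have [[Kr0 ar0] [Kr ar]] := (K'r0, K'r).
pose v := u - r0.
have Kv : K v by exact: subspB.
have av : a d v = a d u by rewrite (linfB _ _ (la d)) ar0 subr0.
have v0 : v != 0 by apply: contra_neq adu; rewrite -av => ->; rewrite (linf0 (la d)).
have vv := pK v Kv v0.
have K'v f : K' f -> ip f v = 0 by move=> K'f; rewrite ipBr Hr0 // subrr.
clearbody v; exists (iota (al v / ip v v)^* * v + r).
  by apply: subspD => //; exact: subspZ.
move=> f Kf; pose c := a d f / a d u.
pose f' := f - iota c * v.
have K'f' : K' f'.
  split; first by apply: subspB => //; exact: subspZ.
  by rewrite (linfB _ _ (la d)) (linfZ _ _ (la d)) av /c divfK // subrr.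
have -> : f = f' + iota c * v by rewrite subrK.
rewrite (linfD _ _ lal) (linfZ _ _ lal) ipDl ipZl !ipDr !ipZr (K'v _ K'f') mulr0 add0r.
rewrite (ip_eq0C (K'v _ K'r)) addr0 conjCK divfK ?lt0r_neq0 //.
by rewrite Hr.
Qed.

Lemma proj_exists d (a : nat -> L -> C) K f : subsp K -> fdim d a K -> posdef K ip ->
  exists2 r, K r & forall g, K g -> ip (f - r) g = 0.
Proof.
move=> sK fK pK; have [r Kr Hr] := riesz sK fK pK (hip.1 f).
by exists r => // g Kg; apply: ip_eq0C; rewrite ipBr Hr // subrr.
Qed.

End Herm.

Lemma fdimS d (a : nat -> L -> C) K K' : K' `<=` K -> fdim d a K -> fdim d a K'.
Proof. by move=> KK [la inj]; split => // f /KK; exact: inj. Qed.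

Lemma posdefS ip K K' : K' `<=` K -> posdef K ip -> posdef K' ip.
Proof. by move=> KK p f /KK; exact: p. Qed.

(** Stands in for dimension counts: a matrix with [d.+1] rows and [d] columns has a nonzero left
    kernel. *)
Lemma more_unknowns d (a : nat -> L -> C) (v : nat -> L) : (forall i, linf (a i)) ->
  exists2 c : nat -> C, exists2 i, (i <= d)%N & c i != 0 &
  forall i, (i < d)%N -> a i (\sum_(j < d.+1) iota (c j) * v j) = 0.
Proof.
move=> la; pose A : 'M[C]_(d.+1, d) := \matrix_(j, i) a i (v j).
have : kermx A != 0.
  rewrite kermx_eq0 /row_free; apply/negP => /eqP rA.
  by have := rank_leq_col A; rewrite rA ltnn.
case/rowV0Pn => u /sub_kermxP uA u0.
exists (fun j => u 0 (inord j)).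
  have /rV0Pn[j uj] := u0.
  by exists j; [rewrite -ltnS|rewrite inord_val].
move=> i id; rewrite (linf_sum _ _ _ (la i)).
have /rowP/(_ (Ordinal id)) := uA; rewrite !mxE => e; apply: etrans e.
by apply: eq_bigr => j _; rewrite (linfZ _ _ (la i)) inord_val mxE.
Qed.

(* The orthogonal complement of the radical N of D is contained in P' and
   invariant under Z, hence vanishes. *)
Lemma toeplitz_form_eq0 d (a : nat -> L -> C) P P' (Z : L) ip (D : L -> L -> C) :
  subsp P -> subsp P' -> P' `<=` P -> (forall f, P' f -> P (Z * f)) ->
  fdim d a P -> herm ip -> posdef P ip -> herm D ->
  (forall f g, P' f -> P' g -> ip (Z * f) (Z * g) = ip f g) ->
  (forall f g, P' f -> P' g -> D (Z * f) (Z * g) = D f g) ->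
  (forall f, (forall k, P' (Z ^+ k * f)) -> f = 0) ->
  (forall x h, P x -> (forall g, P' g -> ip x g = 0) -> P h -> D h x = 0) ->
  (forall x h, P x -> (forall g, P' g -> ip x (Z * g) = 0) -> P h -> D h x = 0) ->
  forall f g, P f -> P g -> D f g = 0.
Proof.
move=> sP sP' PP ZP fP hip pP hD ZT ZD nilp X X'.
pose N g := P g /\ forall h, P h -> D h g = 0.
have sN : subsp N.
  split; first by split; [case: sP|move=> h _; rewrite (ip0r hD)].
  move=> c f g [Pf f0] [Pg g0]; split; first by case: sP => _; exact.
  by move=> h Ph; rewrite (ipDr hD) (ipZr hD) f0 // g0 // mulr0 addr0.
have NP : N `<=` P by move=> f [].
pose ZP' f := exists2 g, P' g & f = Z * g.
have sZP' : subsp ZP' by exact: subsp_mul.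
have ZPP : ZP' `<=` P by move=> _ [g Pg ->]; exact: ZP.
pose Q f := P f /\ forall g, N g -> ip f g = 0.
(* The component of [f] orthogonal to P' is in the radical, so it is orthogonal to [f] as well as to
   P', and hence to itself. *)
have QP' f : Q f -> P' f.
  move=> [Pf Qf]; have [r Pr Hr] := proj_exists hip f sP' (fdimS PP fP) (posdefS PP pP).
  have Px : P (f - r) by apply: subspB => //; exact: PP.
  have Nx : N (f - r) by split => // h Ph; exact: X.
  suff -> : f = r by [].
  apply/eqP; rewrite -subr_eq0; apply/eqP; apply: (posdef_eq0 pP Px).
  by rewrite {1}(ipBl hip) Qf // (ip_eq0C hip (Hr _ Pr)) subr0.
(* Split an element [nu] of N as [Z * g + y] with [y] orthogonal to ZP'. Then [y] is in N, so
   [Z * g] is, and the Toeplitz property of D pulls this back to [g] in N. Both terms are then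
   orthogonal to [Z * f]. *)
have QZ f : Q f -> Q (Z * f).
  move=> Qf; have P'f := QP' f Qf; split; first exact: ZP.
  move=> nu Nnu; have [_ [g P'g ->] Hr] := proj_exists hip nu sZP' (fdimS ZPP fP) (posdefS ZPP pP).
  set y := nu - Z * g in Hr; have Pnu := NP _ Nnu.
  have Ny : N y.
    split; first by apply: subspB => //; exact: ZP.
    move=> h Ph; apply: X' => //; first by apply: subspB => //; exact: ZP.
    by move=> g' P'g'; apply: Hr; exists g'.
  have NZg : N (Z * g) by rewrite (_ : Z * g = nu - y); [exact: subspB|rewrite /y subKr].
  have Ng : N g.
    split=> [|h Ph]; first exact: PP.
    have [h' P'h' Hh'] := proj_exists hip h sP' (fdimS PP fP) (posdefS PP pP).
    rewrite (_ : h = (h - h') + h'); last by rewrite subrK.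
    have Px : P (h - h') by apply: subspB => //; exact: PP.
    rewrite (ipDl hD) (ip_eq0C hD (X _ _ Px Hh' (PP _ P'g))) add0r -ZD //.
    by case: NZg => _; apply; exact: ZP.
  have -> : nu = y + Z * g by rewrite subrK.
  rewrite (ipDr hip) ZT // (ip_eq0C hip (Hr _ _)); last by exists f.
  by rewrite add0r; case: Qf => _; exact.
have Q0 f : Q f -> f = 0.
  move=> Qf; apply: nilp => k; apply: QP'.
  by elim: k => [|k IH]; rewrite ?mul1r // exprS -mulrA; exact: QZ.
move=> f g Pf Pg; have [r Nr Hr] := proj_exists hip g sN (fdimS NP fP) (posdefS NP pP).
have /Q0/eqP : Q (g - r) by split => //; apply: subspB => //; exact: NP.
by rewrite subr_eq0 => /eqP ->; case: Nr => _; exact.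
Qed.

End FormsOnModules.

(** * Polynomials in the shift acting on sequences *)

Section PolyAction.
Variables (C : comNzRingType) (L : comNzRingType) (iota : {rmorphism C -> L}).
Implicit Types (A B : {poly C}) (x : nat -> L).

(** Entry [k] of B(S)x, where S is the shift of sequences. *)
Definition appr B x k := \sum_(s < size B) iota B`_s * x (k + s)%N.

Lemma apprE B x k N : (size B <= N)%N -> appr B x k = \sum_(s < N) iota B`_s * x (k + s)%N.
Proof.
move=> le; rewrite /appr (big_ord_widen N (fun s => iota B`_s * x (k + s)%N)) // big_mkcond.
by apply: eq_bigr => s _; case: ltnP => // h; rewrite nth_default ?rmorph0 ?mul0r.
Qed.

Lemma apprX B x k : appr (B * 'X) x k = appr B x k.+1.
Proof.
rewrite (@apprE _ _ _ (size B).+1); last first.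
  by have [->|B0] := eqVneq B 0; [rewrite mul0r size_poly0|rewrite size_mulX].
rewrite big_ord_recl coefMX rmorph0 mul0r add0r; apply: eq_bigr => s _.
by rewrite coefMX /= addnS addSn.
Qed.

Lemma apprZD c A B x k : appr (c *: A + B) x k = iota c * appr A x k + appr B x k.
Proof.
pose N := maxn (size A) (size B).
have hA : (size A <= N)%N by rewrite leq_maxl.
have hB : (size B <= N)%N by rewrite leq_maxr.
have hC : (size (c *: A + B)%R <= N)%N.
  by rewrite (leq_trans (size_polyD _ _)) // geq_max hB (leq_trans (size_scale_leq _ _)).
rewrite (apprE _ _ hA) (apprE _ _ hB) (apprE _ _ hC).
rewrite mulr_sumr -big_split; apply: eq_bigr => s _ /=.
by rewrite coefD coefZ rmorphD rmorphM mulrDl mulrA.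
Qed.

Lemma appr_XsubC B c x k : appr (B * ('X - c%:P)) x k = appr B x k.+1 - iota c * appr B x k.
Proof.
rewrite (_ : B * _ = (- c) *: B + B * 'X); last by rewrite mulrBr scaleNr mulrC [B * _%:P]mulrC mul_polyC addrC mulrC.
by rewrite apprZD apprX rmorphN mulNr addrC.
Qed.

End PolyAction.

(** * Bounded solutions of linear recurrences *)

Section BoundedRecurrence.
Variable R : realType.
Local Notation C := R[i].

Lemma geometric_eq0 (a y M : C) : `|a| < 1 -> (forall N, `|y| <= `|a| ^+ N * M) -> y = 0.
Proof.
move=> a1 H; have rE (u : C) : `|u| = (complex.Re `|u|)%:C by rewrite RRe_real ?normr_real.
set r := complex.Re `|a|; set s := complex.Re `|y|.
have r0 : 0 <= r by rewrite -ler0c -rE.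
have r1 : r < 1 by rewrite -ltcR -rE.
have s0 : 0 <= s by rewrite -ler0c -rE.
pose m := complex.Re M.
have Hs N : s <= r ^+ N * m.
  have := H N; rewrite (rE y) (rE a) -rmorphXn /= lecE => /andP[_].
  by rewrite -/s -/r complex_ReM /= mul0r subr0.
have cv : (fun N => r ^+ N * m) @ \oo --> 0 * m.
  by apply: cvgMl; apply: cvg_expr; rewrite ger0_norm.
have s00 : s <= 0.
  rewrite -(mul0r m); apply: (ler_cvg_to (cvg_cst s) cv).
  by apply: nearW => N; exact: Hs.
apply/eqP; rewrite -normr_eq0 rE -/s; apply/eqP; congr (_%:C).
by apply/eqP; rewrite eq_le s00.
Qed.

(** B(S) is a product of factors S - mu with |mu| > 1. A bounded sequence u with Su = mu u satisfies
    u_j = mu^(-N) u_(j+N) for all N and is zero, so the factors can be removed one by one. *)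
Lemma bounded_rec_eq0 (B : {poly C}) (x : nat -> C) M : (forall k, `|x k| <= M) ->
  (forall w, `|w| <= 1 -> B.[w] != 0) -> (forall k, appr idfun B x k = 0) -> forall k, x k = 0.
Proof.
move=> xM; have M0 : 0 <= M := le_trans (normr_ge0 _) (xM 0%N).
have [r ->] := closed_field_poly_normal B.
have [->|c0] := eqVneq (lead_coef B) 0.
  by move=> /(_ 0); rewrite normr0 ler01 scale0r horner0 eqxx => /(_ isT).
set c := lead_coef B in c0 *; move: c c0 => c c0 {B}.
elim: r c c0 => [|mu r IH] c c0 Br H k.
  have := H k; rewrite big_nil -[c *: 1]addr0 apprZD {2}/appr size_poly0 big_ord0 addr0.
  rewrite (@apprE _ _ _ 1 _ _ 1) ?size_poly1 // big_ord1 coef1 mul1r addn0 => /eqP.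
  by rewrite mulf_eq0 (negPf c0) => /eqP.
apply: (IH c c0) => [w w1|].
  have := Br w w1; rewrite big_cons !hornerZ hornerM !mulf_eq0 !negb_or.
  by case/and3P => -> _ ->.
have mu1 : 1 < `|mu|.
  rewrite real_ltNge ?normr_real ?real1 //; apply/negP => /Br.
  by rewrite big_cons hornerZ hornerM hornerXsubC subrr mul0r mulr0 eqxx.
have mu0 : mu != 0 by rewrite -normr_gt0 (lt_trans ltr01).
set B := c *: _; have HB j : appr idfun B x j = mu^-1 * appr idfun B x j.+1.
  have := H j; rewrite big_cons scalerAr -/B mulrC appr_XsubC => /eqP.
  by rewrite subr_eq0 => /eqP ->; rewrite mulKf.
have HBN j N : appr idfun B x j = mu^-1 ^+ N * appr idfun B x (j + N)%N.
  elim: N => [|N IHN]; first by rewrite addn0 mul1r.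
  by rewrite IHN HB exprSr -mulrA addnS.
move=> j; apply: (@geometric_eq0 mu^-1 _ (\sum_(s < size B) `|B`_s| * M)).
  by rewrite normfV invf_lt1 ?normr_gt0.
move=> N; rewrite (HBN j N) normrM normrX ler_wpM2l ?exprn_ge0 //.
apply: (le_trans (ler_norm_sum _ _ _)); apply: ler_sum => s _.
by rewrite normrM ler_wpM2l.
Qed.

End BoundedRecurrence.

(** * Means of rational functions on the circle *)

Section CircleMean.
Variable R : realType.
Local Notation C := R[i].
Implicit Types (f g : C -> C) (M : (C -> C) -> C).

Definition adm1 f := adm (fun _ w => f w).

(** Instantiated below by either variable of a torus mean; [cm_bound] is the part of Bessel's
    inequality that is needed. *)
Record circ_mean M : Prop := CircMean {
  cm_ext : forall f g, (forall z, `|z| = 1 -> f z = g z) -> M f = M g;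
  cm_lin : forall c f g, adm1 f -> adm1 g -> M (fun z => c * f z + g z) = c * M f + M g;
  cm_mon : forall k : int, M (fun z => z ^ k) = (k == 0)%:R;
  cm_bound : forall f, adm1 f -> exists B, forall k : int, `|M (fun z => z ^ k * f z)| <= B }.

Lemma adm1_horner (p : {poly C}) : adm1 (fun z => p.[z]).
Proof.
apply: (@adm_ext _ (fun _ w => \sum_(i < size p) p`_i * w ^+ i)) => [z w _ _|].
  by rewrite horner_coef.
by apply: adm_sum => i; apply: adm_mul; [exact: adm_cst|exact: adm_expn (adm_w R)].
Qed.

Lemma adm1_mul f g : adm1 f -> adm1 g -> adm1 (fun z => f z * g z).
Proof. exact: adm_mul. Qed.

Lemma adm1_inv f : (forall z, `|z| = 1 -> f z != 0) -> adm1 f -> adm1 (fun z => (f z)^-1).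
Proof. by move=> f0; apply: adm_inv => z w _; exact: f0. Qed.

Lemma adm1_expz k : adm1 (fun z => z ^ k). Proof. exact: adm_expz_w. Qed.

Lemma adm1_horner_div (g B : {poly C}) : (forall w, `|w| <= 1 -> B.[w] != 0) ->
  adm1 (fun z => g.[z] / B.[z]).
Proof.
move=> B0; apply: adm1_mul; first exact: adm1_horner.
by apply: adm1_inv; [move=> z z1; apply: B0; rewrite z1|exact: adm1_horner].
Qed.

Variable M : (C -> C) -> C.
Hypothesis hM : circ_mean M.

Lemma cm_eq0 f : (forall z, `|z| = 1 -> f z = 0) -> M f = 0.
Proof.
move=> f0; have := cm_lin hM (-1) (adm_cst 0) (adm_cst 0).
move=> e; apply: etrans (etrans _ e) _; last by rewrite mulN1r addNr.
by apply: (cm_ext hM) => z /f0 ->; rewrite mulr0 addr0.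
Qed.

Lemma cm_Z c f : adm1 f -> M (fun z => c * f z) = c * M f.
Proof.
move=> af; rewrite -[RHS]addr0 -(@cm_eq0 (fun=> 0)) // -(cm_lin hM) //; last exact: adm_cst.
by apply: (cm_ext hM) => z _; rewrite addr0.
Qed.

Lemma cm_D f g : adm1 f -> adm1 g -> M (fun z => f z + g z) = M f + M g.
Proof.
move=> af ag; rewrite -[M f]mul1r -(cm_lin hM) //.
by apply: (cm_ext hM) => z _; rewrite mul1r.
Qed.

Lemma cm_cst c : M (fun=> c) = c.
Proof.
have e := @cm_Z c (fun z => z ^ (0 : int)) (@adm1_expz 0).
have e0 := cm_mon hM 0; apply: etrans (etrans _ e) _; last by rewrite e0 mulr1.
by apply: (cm_ext hM) => z _; rewrite mulr1.
Qed.

Lemma cm_sum (I : Type) (r : seq I) (P : pred I) (F : I -> C -> C) :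
  (forall i, adm1 (F i)) -> M (fun z => \sum_(i <- r | P i) F i z) = \sum_(i <- r | P i) M (F i).
Proof.
move=> aF; elim: r => [|i r IH]; first by rewrite big_nil; apply: cm_eq0 => z _; rewrite big_nil.
rewrite big_cons; case: ifP => Pi.
  rewrite -IH -cm_D //; last exact: adm_sum.
  by apply: (cm_ext hM) => z _; rewrite big_cons Pi.
by rewrite -IH; apply: (cm_ext hM) => z _; rewrite big_cons Pi.
Qed.

(** The moments of g/B of positive index form a bounded sequence. Applying B(S) to it cancels the
    denominator and leaves moments of the polynomial g of positive index, which are zero. *)
Lemma cm_div_eq0 (g B : {poly C}) k : (forall w, `|w| <= 1 -> B.[w] != 0) ->
  M (fun z => z ^+ k.+1 * (g.[z] / B.[z])) = 0.
Proof.
move=> B0; have aG := adm1_horner_div g B0.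
have [m Hm] := cm_bound hM aG.
apply: (@bounded_rec_eq0 _ B (fun k => M (fun z => z ^+ k.+1 * (g.[z] / B.[z]))) m) => // [j|j].
  exact: (Hm (Posz j.+1)).
have aj i : adm1 (fun z => z ^+ i * (g.[z] / B.[z])).
  by apply: adm1_mul aG; exact: (adm1_expz (Posz i)).
rewrite /appr /=; under eq_bigr do rewrite -cm_Z //.
rewrite -cm_sum; last by move=> i; apply: adm1_mul; [exact: adm_cst|exact: aj].
transitivity (M (fun z => \sum_(s < size g) g`_s * z ^ (Posz (s + j.+1)))).
  apply: (cm_ext hM) => z z1; have Bz : B.[z] != 0 by apply: B0; rewrite z1.
  transitivity ((\sum_(s < size B) B`_s * z ^+ s) * (z ^+ j.+1 * (g.[z] / B.[z]))).
    by rewrite mulr_suml; apply: eq_bigr => s _; rewrite -addSn exprD; ring.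
  rewrite -horner_coef (_ : \sum_(s < size g) _ = g.[z] * z ^+ j.+1); first by field.
  by rewrite horner_coef mulr_suml; apply: eq_bigr => i _; rewrite -exprnP exprD mulrA.
rewrite cm_sum; last by move=> s; apply: adm1_mul; [exact: adm_cst|exact: adm1_expz].
rewrite big1 // => s _; rewrite cm_Z; last exact: adm1_expz.
by have -> := cm_mon hM (s + j.+1)%N; rewrite addnS mulr0.
Qed.

(** Cauchy's formula at 0: g/B minus its value at 0 has the form zh/B, whose mean vanishes. *)
Lemma cm_div (g B : {poly C}) : (forall w, `|w| <= 1 -> B.[w] != 0) ->
  M (fun z => g.[z] / B.[z]) = g.[0] / B.[0].
Proof.
move=> B0; set c := g.[0] / B.[0].
have B00 : B.[0] != 0 by apply: B0; rewrite normr0 ler01.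
have : root (g - c *: B) 0 by rewrite /root !hornerE /c divfK // subrr.
rewrite -{1}[X in root _ X]oppr0 => /factor_theorem[h]; rewrite oppr0 polyC0 subr0 => gh.
have -> : M (fun z => g.[z] / B.[z]) = M (fun z => c + z ^+ 1 * (h.[z] / B.[z])).
  apply: (cm_ext hM) => z z1; have Bz : B.[z] != 0 by apply: B0; rewrite z1.
  have : g.[z] = c * B.[z] + h.[z] * z.
    by have := congr1 (horner^~ z) gh; rewrite !hornerE => <-; ring.
  by move=> ->; field.
rewrite cm_D ?cm_cst ?cm_div_eq0 ?addr0 //; first exact: adm_cst.
by apply: adm1_mul; [exact: (adm1_expz 1)|exact: adm1_horner_div].
Qed.

End CircleMean.

(** * Bessel's inequality for the torus mean *)

Section TorusMean.
Variable R : realType.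
Local Notation C := R[i].
Implicit Types (F G : C -> C -> C).
Variable I : (C -> C -> C) -> C.
Hypothesis hI : torus_mean I.

Lemma tm_0 F : (forall z w, `|z| = 1 -> `|w| = 1 -> F z w = 0) -> I F = 0.
Proof.
move=> F0; have e := tm_lin hI (-1) (adm_cst 0) (adm_cst 0).
apply: etrans (etrans _ e) _; last by rewrite mulN1r addNr.
by apply: (tm_ext hI) => z w z1 w1; rewrite F0 // mulr0 addr0.
Qed.

Lemma tm_Z c F : adm F -> I (fun z w => c * F z w) = c * I F.
Proof.
move=> aF; have e := tm_lin hI c aF (adm_cst 0).
apply: etrans (etrans _ e) _; last by rewrite (@tm_0 (fun _ _ => 0)) ?addr0.
by apply: (tm_ext hI) => z w _ _; rewrite addr0.
Qed.

Lemma tm_D F G : adm F -> adm G -> I (fun z w => F z w + G z w) = I F + I G.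
Proof.
move=> aF aG; rewrite -[I F]mul1r -(tm_lin hI) //.
by apply: (tm_ext hI) => z w _ _; rewrite mul1r.
Qed.

Lemma tm_B F G : adm F -> adm G -> I (fun z w => F z w - G z w) = I F - I G.
Proof.
move=> aF aG; rewrite addrC -mulN1r -(tm_lin hI) //.
by apply: (tm_ext hI) => z w _ _; rewrite mulN1r addrC.
Qed.

Lemma tm_sum (J : Type) (r : seq J) (P : pred J) (F : J -> C -> C -> C) :
  (forall i, adm (F i)) -> I (fun z w => \sum_(i <- r | P i) F i z w) = \sum_(i <- r | P i) I (F i).
Proof.
move=> aF; elim: r => [|i r IH]; first by rewrite big_nil; apply: tm_0 => z w _ _; rewrite big_nil.
rewrite big_cons; case: ifP => Pi.
  rewrite -IH -tm_D //; last exact: adm_sum.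
  by apply: (tm_ext hI) => z w _ _; rewrite big_cons Pi.
by rewrite -IH; apply: (tm_ext hI) => z w _ _; rewrite big_cons Pi.
Qed.

Lemma conj_unit (z : C) : `|z| = 1 -> z^* = z^-1.
Proof. by move=> z1; rewrite invC_norm z1 expr1n invr1 mul1r. Qed.

Lemma conj_unitXz (z : C) (k : int) : `|z| = 1 -> (z ^ k)^* = z ^ (- k).
Proof. by move=> z1; rewrite rmorphXz ?unitfE ?unit_neq0 // /= conj_unit // exprz_inv. Qed.

Lemma adm_mon (j k : int) : adm (fun z w : C => z ^ j * w ^ k).
Proof. by apply: adm_mul; [exact: adm_expz_z|exact: adm_expz_w]. Qed.

Lemma tm_cst c : I (fun _ _ => c) = c.
Proof.
have e := @tm_Z c (fun z w => z ^ (0 : int) * w ^ (0 : int)) (adm_mon 0 0).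
have e0 := tm_mon hI 0 0; apply: etrans (etrans _ e) _; last by rewrite e0 mulr1.
by apply: (tm_ext hI) => z w _ _; rewrite !expr0z !mulr1.
Qed.

Definition fcoef F (j k : int) := I (fun z w => F z w * (z ^ (- j) * w ^ (- k))).

(** Removing from [F] the Fourier term of the first index lowers the squared norm by exactly |c|^2
    and leaves the coefficients at the other indices unchanged. *)
Lemma bessel F (r : seq (int * int)) : adm F -> uniq r ->
  \sum_(s <- r) `|fcoef F s.1 s.2| ^+ 2 <= I (fun z w => F z w * (F z w)^* ).
Proof.
elim: r F => [|s r IH] F aF /=.
  by rewrite big_nil => _; apply: (tm_ge0 hI); [exact: adm_mul aF (adm_conj aF)|move=> z w _ _; exact: mul_conjC_ge0].
case/andP => sr ur; rewrite big_cons.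
pose e z w : C := z ^ s.1 * w ^ s.2.
pose e' z w : C := z ^ (- s.1) * w ^ (- s.2).
have ae : adm e by exact: adm_mon.
have ae' : adm e' by exact: adm_mon.
set c := fcoef F _ _.
pose F' z w := F z w - c * e z w.
have ace : adm (fun z w => - c * e z w) by exact: adm_mul (adm_cst _) ae.
have aF' : adm F'.
  by apply: (@adm_ext _ (fun z w => F z w + (- c) * e z w)); [move=> z w _ _; rewrite mulNr|exact: adm_add].
have F'c t : t \in r -> fcoef F' t.1 t.2 = fcoef F t.1 t.2.
  move=> tr; have st : (s.1 - t.1 == 0) && (s.2 - t.2 == 0) = false.
    apply: contraNF sr; rewrite !subr_eq0 => /andP[/eqP e1 /eqP e2].
    by rewrite (surjective_pairing s) e1 e2 -surjective_pairing.
  rewrite /fcoef -[RHS]subr0 -[X in _ = _ - X](mulr0 c).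
  have h := tm_mon hI (s.1 - t.1) (s.2 - t.2); rewrite st in h; rewrite -[X in _ = _ - _ * X]h.
  rewrite -tm_Z; last exact: adm_mon.
  rewrite -tm_B.
  - apply: (tm_ext hI) => z w z1 w1; rewrite /F' /e !expfzDr ?unit_neq0 //; ring.
  - by apply: adm_mul => //; exact: adm_mon.
  - by apply: adm_mul; [exact: adm_cst|exact: adm_mon].
have F'n : I (fun z w => F' z w * (F' z w)^* ) = I (fun z w => F z w * (F z w)^* ) - `|c| ^+ 2.
  have aFe : adm (fun z w => F z w * e' z w) by exact: adm_mul.
  have -> : I (fun z w => F' z w * (F' z w)^* ) =
    I (fun z w => F z w * (F z w)^* - (c^* * (F z w * e' z w) + (c * (F z w * e' z w)^* - c * c^* ))).
    apply: (tm_ext hI) => z w z1 w1; rewrite /F' /e'.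
    have -> : z ^ (- s.1) * w ^ (- s.2) = (e z w)^* by rewrite /e rmorphM /= !conj_unitXz.
    have ee : e z w * (e z w)^* = 1.
      by rewrite /e rmorphM /= !conj_unitXz // mulrACA -!expfzDr ?unit_neq0 // !subrr !expr0z mulr1.
    rewrite -[X in _ - (_ + (_ - X))]mulr1 -ee; clearbody e; rewrite !rmorphB !rmorphM /= conjCK; ring.
  rewrite tm_B; last 2 first.
  - exact: adm_mul aF (adm_conj aF).
  - apply: adm_add; first exact: adm_mul (adm_cst _) aFe.
    apply: (@adm_ext _ (fun z w => c * (F z w * e' z w)^* + (- (c * c^* )))) => //.
    by apply: adm_add (adm_cst _); exact: adm_mul (adm_cst _) (adm_conj aFe).
  rewrite tm_D; last 2 first.
  - exact: adm_mul (adm_cst _) aFe.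
  - apply: (@adm_ext _ (fun z w => c * (F z w * e' z w)^* + (- (c * c^* )))) => //.
    by apply: adm_add (adm_cst _); exact: adm_mul (adm_cst _) (adm_conj aFe).
  rewrite tm_Z // tm_B; last 2 first.
  - exact: adm_mul (adm_cst _) (adm_conj aFe).
  - exact: adm_cst.
  rewrite tm_Z; last exact: adm_conj.
  rewrite (tm_conj hI) // -/(fcoef F s.1 s.2) -/c.
  rewrite tm_cst.
  by rewrite subrr addr0 normCKC.
have := IH F' aF' ur; rewrite F'n lerBrDl; apply: le_trans.
by rewrite lerD2l; rewrite le_eqVlt; apply/orP; left; apply/eqP; apply: eq_big_seq => t tr; rewrite F'c.
Qed.

(** Trades the square root in Bessel's inequality for a cruder bound; only boundedness of the
    coefficients matters. *)
Lemma le_1sqr (x N : C) : 0 <= x -> x ^+ 2 <= N -> x <= 1 + N.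
Proof.
move=> x0 xN; have N0 : 0 <= N by apply: le_trans xN; rewrite exprn_ge0.
have [x1|x1] := real_leP (ger0_real x0) (ger0_real ler01); first by rewrite (le_trans x1) // lerDl.
apply: (le_trans (y := x ^+ 2)); first by rewrite expr2 ler_peMl // ltW.
by apply: (le_trans xN); rewrite lerDr ler01.
Qed.

Lemma fcoef_bound F j k : adm F -> `|fcoef F j k| <= 1 + I (fun z w => F z w * (F z w)^* ).
Proof.
by move=> aF; apply: le_1sqr => //; have := bessel (r := [:: (j, k)]) aF isT; rewrite big_seq1.
Qed.

End TorusMean.

(** * Means in one variable and the substitution z -> 1/z *)

Section MeanInstances.
Variable R : realType.
Local Notation C := R[i].
Implicit Types (F G : C -> C -> C).

Lemma adm_swap F : adm F -> adm (fun z w => F w z).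
Proof.
move=> [F1 F2].
have cs : continuous (fun x : R * R => (x.2, x.1)).
  by move=> x; apply: (cvg_pair (@cvg_snd _ _ _ _ _) (@cvg_fst _ _ _ _ _)).
by split=> x; [apply: (@continuous_comp _ _ _ _ (fun y => complex.Re (pull F y)) x (cs x) (F1 _))|
  apply: (@continuous_comp _ _ _ _ (fun y => complex.Im (pull F y)) x (cs x) (F2 _))].
Qed.

Lemma cisN (x : R) : cis (- x) = (cis x)^-1.
Proof. by have := cis_expz x (-1); rewrite mulN1r exprN1. Qed.

Lemma adm_zV F : adm F -> adm (fun z w => F z^-1 w).
Proof.
move=> [F1 F2].
have cs : continuous (fun x : R * R => (- x.1, x.2)).
  have cN : continuous (fun x : R * R => - x.1) by move=> y; apply: cvgN; exact: cvg_fst.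
  by move=> x; apply: (cvg_pair (cN x) (@cvg_snd _ _ _ _ _)).
split=> x.
  rewrite (_ : (fun _ => _) = (fun x : R * R => complex.Re (pull F (- x.1, x.2)))).
    exact: (@continuous_comp _ _ _ _ (fun y => complex.Re (pull F y)) x (cs x) (F1 _)).
  by apply/funext => y; rewrite /pull /= cisN.
rewrite (_ : (fun _ => _) = (fun x : R * R => complex.Im (pull F (- x.1, x.2)))).
  exact: (@continuous_comp _ _ _ _ (fun y => complex.Im (pull F y)) x (cs x) (F2 _)).
by apply/funext => y; rewrite /pull /= cisN.
Qed.

Lemma adm_leval n m (t : laurent R n m) : adm (fun z w => leval t z w).
Proof.
apply: adm_sum => a; apply: adm_sum => b.
apply: adm_mul; first by apply: adm_mul; [exact: adm_cst|exact: adm_expz_z].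
exact: adm_expz_w.
Qed.

Variable I : (C -> C -> C) -> C.
Hypothesis hI : torus_mean I.

Lemma normV_unit (z : C) : `|z| = 1 -> `|z^-1| = 1.
Proof. by move=> z1; rewrite normfV z1 invr1. Qed.

Lemma torus_mean_zV : torus_mean (fun F => I (fun z w => F z^-1 w)).
Proof.
split.
- by move=> F G FG; apply: (tm_ext hI) => z w z1 w1; apply: FG => //; exact: normV_unit.
- by move=> c F G aF aG; apply: (tm_lin hI); exact: adm_zV.
- by move=> F aF; apply: (tm_conj hI); exact: adm_zV.
- by move=> F aF F0; apply: (tm_ge0 hI) => [|z w z1 w1]; [exact: adm_zV|apply: F0 => //; exact: normV_unit].
- move=> F aF F0 IF z w z1 w1; rewrite -(invrK z).
  apply: (tm_eq0 hI (adm_zV aF) _ IF) => //; last exact: normV_unit.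
  by move=> u v u1 v1; apply: F0 => //; exact: normV_unit.
- move=> j k; rewrite -oppr_eq0 -(tm_mon hI); apply: (tm_ext hI) => z w _ _.
  by rewrite exprz_inv.
- move=> F phi aF ap H; apply: (tm_fub hI (adm_zV aF) (adm_zV ap)) => z z1.
  by apply: H; exact: normV_unit.
Qed.

Lemma circ_mean_w : circ_mean (fun f => I (fun _ w => f w)).
Proof.
split.
- by move=> f g fg; apply: (tm_ext hI) => z w _; exact: fg.
- by move=> c f g af ag; exact: (tm_lin hI).
- by move=> k; have := tm_mon hI 0 k; rewrite eqxx /= => <-; apply: (tm_ext hI) => z w _ _; rewrite mul1r.
- move=> f af; eexists=> k; have := fcoef_bound hI 0 (- k) af; rewrite (_ : fcoef _ _ _ _ = I (fun _ w => w ^ k * f w)).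
    exact.
  by apply: (tm_ext hI) => z w _ _; rewrite oppr0 expr0z mul1r opprK mulrC.
Qed.

Lemma circ_mean_z : circ_mean (fun f => I (fun z _ => f z)).
Proof.
split.
- by move=> f g fg; apply: (tm_ext hI) => z w z1 _; exact: fg.
- by move=> c f g af ag; apply: (tm_lin hI); exact: (adm_swap).
- by move=> k; have := tm_mon hI k 0; rewrite eqxx andbT /= => <-; apply: (tm_ext hI) => z w _ _; rewrite mulr1.
- move=> f /adm_swap af; eexists=> k; have := fcoef_bound hI (- k) 0 af; rewrite (_ : fcoef _ _ _ _ = I (fun z _ => z ^ k * f z)).
    exact.
  by apply: (tm_ext hI) => z w _ _; rewrite oppr0 expr0z mulr1 opprK mulrC.
Qed.

End MeanInstances.

(** * Bivariate polynomials: coefficients, reversal, evaluation in z *)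

Section BiPoly.
Variable R : realType.
Local Notation C := R[i].
Implicit Types (f g h : bipoly R).

Local Notation ii := ((polyC \o polyC)%FUN : {rmorphism C -> bipoly R}).
(* [box a b] is P_{a-1,b-1}; [box 1 b] plays the role of the polynomials in w. *)
Definition box a b : set (bipoly R) := fun f => forall s l, ~~ ((s < a) && (l < b))%N -> f`_s`_l = 0.

Lemma coefXz f s l : ('X * f)`_s`_l = if s is s'.+1 then f`_s'`_l else 0.
Proof. by rewrite coefXM; case: s => [|s] //=; rewrite coef0. Qed.

Lemma coefYz f s l : ('Y * f)`_s`_l = if l is l'.+1 then f`_s`_l' else 0.
Proof. by rewrite coefCM coefXM; case: l. Qed.

Lemma coefCz c f s l : (c%:P%:P * f)`_s`_l = c * f`_s`_l.
Proof. by rewrite !coefCM. Qed.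

Lemma box_size a b f : box a b f -> (size f <= a)%N.
Proof.
move=> bf; apply/leq_sizeP => s sa; apply/polyP => l; rewrite bf ?coef0 //.
by rewrite ltnNge sa.
Qed.

Lemma box_size2 a b f s : box a b f -> (size (f`_s)%R <= b)%N.
Proof.
by move=> bf; apply/leq_sizeP => l lb; rewrite bf // [(l < b)%N]ltnNge lb andbF.
Qed.

Lemma box_self f : exists a b, box a b f.
Proof.
exists (size f), (\max_(s < size f) size (f`_s)%R)%N => s l; rewrite negb_and -!leqNgt.
case/orP => h; first by rewrite (nth_default _ h) coef0.
case: (ltnP s (size f)) => sf; last by rewrite (nth_default _ sf) coef0.
by rewrite nth_default // (leq_trans _ h) // (bigop.bigmax_sup (Ordinal sf)).
Qed.

Lemma box_subsp a b : subsp ii (box a b).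
Proof.
split=> [s l _|c f g bf bg s l h]; first by rewrite !coef0.
by rewrite !coefD coefCz bf // bg // mulr0 addr0.
Qed.

Lemma boxS a b a' b' f : (a <= a')%N -> (b <= b')%N -> box a b f -> box a' b' f.
Proof. by move=> aa bb bf s l h; apply: bf; apply: contra h => /andP[sa lb]; rewrite (leq_trans sa) // (leq_trans lb). Qed.

Lemma box_X a b f : box a b f -> box a.+1 b ('X * f).
Proof. by move=> bf [|s] l h; rewrite coefXz // bf. Qed.

Lemma box_Y a b f : box a b f -> box a b.+1 ('Y * f).
Proof. by move=> bf s [|l] h; rewrite coefYz // bf. Qed.

Definition bcoef b i f : C := f`_(i %/ b)`_(i %% b).

Lemma box_fdim a b : fdim ii (a * b) (bcoef b) (box a b).
Proof.
split=> [i c f g|f bf H]; first by rewrite /bcoef !coefD coefCz.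
apply/polyP => s; apply/polyP => l; rewrite !coef0.
have [/andP[sa lb]|] := boolP ((s < a) && (l < b))%N; last exact: bf.
have := H (s * b + l)%N; rewrite /bcoef divnMDl ?(leq_ltn_trans _ lb) //.
rewrite divn_small // addn0 modnMDl modn_small //; apply.
by rewrite (leq_trans (n := s * b + b)) ?ltn_add2l // -mulSnr leq_mul2r sa orbT.
Qed.

Lemma evalE a b f z w : box a b f ->
  f.[z, w] = \sum_(s < a) \sum_(l < b) f`_s`_l * z ^+ s * w ^+ l.
Proof.
move=> bf; rewrite (@horner_coef_wide _ a f) ?(box_size bf) // horner_sum.
apply: eq_bigr => s _; rewrite hornerM -rmorphXn hornerC (@horner_coef_wide _ b) ?(box_size2 _ bf) //.
by rewrite mulr_suml; apply: eq_bigr => l _; rewrite mulrAC.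
Qed.

Lemma adm_eval f : adm (fun z w => f.[z, w]).
Proof.
have [a [b bf]] := box_self f.
apply: (@adm_ext _ (fun z w => \sum_(s < a) \sum_(l < b) f`_s`_l * z ^+ s * w ^+ l)).
  by move=> z w _ _; rewrite (evalE _ _ bf).
apply: adm_sum => s; apply: adm_sum => l; apply: adm_mul; last exact: adm_expn (adm_w R).
by apply: adm_mul; [exact: adm_cst|exact: adm_expn (adm_z R)].
Qed.

Lemma fcoef_eval (I : (C -> C -> C) -> C) f (s l : nat) : torus_mean I ->
  fcoef I (fun z w => f.[z, w]) s l = f`_s`_l.
Proof.
move=> hI; have [a [b bf]] := box_self f.
have aT (i j : nat) : adm (fun z w => f`_i`_j * (z ^ (i%:Z - s%:Z) * w ^ (j%:Z - l%:Z))).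
  by apply: adm_mul; [exact: adm_cst|exact: adm_mon].
transitivity (I (fun z w => \sum_(i < a) \sum_(j < b) f`_i`_j * (z ^ (i%:Z - s%:Z) * w ^ (j%:Z - l%:Z)))).
  apply: (tm_ext hI) => z w z1 w1; rewrite (evalE _ _ bf) mulr_suml; apply: eq_bigr => i _.
  rewrite mulr_suml; apply: eq_bigr => j _; rewrite !expfzDr ?unit_neq0 // -!exprnP; ring.
rewrite (tm_sum hI); last by move=> i; apply: adm_sum => j; exact: aT.
have E (i : 'I_a) : I (fun z w => \sum_(j < b) f`_i`_j * (z ^ (i%:Z - s%:Z) * w ^ (j%:Z - l%:Z)))
   = \sum_(j < b) f`_i`_j * (((i : nat) == s) && ((j : nat) == l))%:R.
  rewrite (tm_sum hI) //; apply: eq_bigr => j _; rewrite (tm_Z hI); last exact: adm_mon.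
  by have := tm_mon hI (i%:Z - s%:Z) (j%:Z - l%:Z); rewrite !subr_eq0 !eqz_nat => ->.
under eq_bigr do rewrite E.
have [/andP[sa lb]|nb] := boolP ((s < a) && (l < b))%N; last first.
  rewrite [RHS]bf // big1 // => i _; rewrite big1 // => j _.
  case: eqP => [e1|_]; last by rewrite mulr0.
  case: eqP => [e2|_]; last by rewrite mulr0.
  by move: nb; rewrite -e1 -e2 !ltn_ord.
rewrite (bigD1 (Ordinal sa)) //= (bigD1 (Ordinal lb)) //= !eqxx mulr1.
rewrite !big1 ?addr0 // => [i ine|j jne].
  rewrite big1 // => j _; suff /negPf-> : (i : nat) != s by rewrite mulr0.
  by apply: contra ine => /eqP e; apply/eqP/val_inj.
suff /negPf-> : (j : nat) != l by rewrite mulr0.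
by apply: contra jne => /eqP e; apply/eqP/val_inj.
Qed.

Lemma eval_inj f g : (forall z w, `|z| = 1 -> `|w| = 1 -> f.[z, w] = g.[z, w]) -> f = g.
Proof.
move=> fg; apply/polyP => s; apply/polyP => l.
rewrite -!(fcoef_eval _ _ _ (torus_avg_mean R)); apply: (tm_ext (torus_avg_mean R)) => z w z1 w1.
by rewrite fg.
Qed.

Lemma eval_X z w : ('X : bipoly R).[z, w] = z. Proof. by rewrite hornerX hornerC. Qed.
Lemma eval_Y z w : ('Y : bipoly R).[z, w] = w. Proof. by rewrite hornerC hornerX. Qed.
Lemma eval_C (c z w : C) : (c%:P%:P : bipoly R).[z, w] = c. Proof. by rewrite !hornerC. Qed.

(** The reverse z^(a-1) w^(b-1) \bar f(1/z, 1/w) of [f] relative to its box. *)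
Definition refl a b f : bipoly R := \poly_(s < a) \poly_(l < b) (f`_(a.-1 - s)`_(b.-1 - l))^*.

Lemma refl_box a b f : box a b (refl a b f).
Proof.
move=> s l; rewrite negb_and coef_poly; case: ifP => [sa|_]; last by rewrite coef0.
by rewrite /= coef_poly => /negPf ->.
Qed.

Lemma refl_eval a b f z w : box a b f -> `|z| = 1 -> `|w| = 1 ->
  (refl a b f).[z, w] = z ^+ a.-1 * w ^+ b.-1 * (f.[z, w])^*.
Proof.
move=> bf z1 w1; rewrite (evalE _ _ (@refl_box a b f)) (evalE _ _ bf).
rewrite rmorph_sum mulr_sumr (reindex_inj rev_ord_inj) /=; apply: eq_bigr => s _.
rewrite rmorph_sum mulr_sumr (reindex_inj rev_ord_inj) /=; apply: eq_bigr => l _.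
have e1 : (a - s.+1 = a.-1 - s)%N by lia.
have e2 : (b - l.+1 = b.-1 - l)%N by lia.
have la : (s <= a.-1)%N by have := ltn_ord s; lia.
have lb : (l <= b.-1)%N by have := ltn_ord l; lia.
have l1 : (a.-1 - s < a)%N by rewrite -e1; exact: (ltn_ord (rev_ord s)).
have l2 : (b.-1 - l < b)%N by rewrite -e2; exact: (ltn_ord (rev_ord l)).
rewrite e1 e2 coef_poly l1 coef_poly l2 !subKn // !rmorphM /= !rmorphXn /= (conj_unit z1) (conj_unit w1).
have za : z ^+ a.-1 = z ^+ (a.-1 - s) * z ^+ s by rewrite -exprD subnK.
have wb : w ^+ b.-1 = w ^+ (b.-1 - l) * w ^+ l by rewrite -exprD subnK.
rewrite za wb.
have zs : z ^+ s * z^-1 ^+ s = 1 by rewrite -exprMn divff ?unit_neq0 // expr1n.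
have ws : w ^+ l * w^-1 ^+ l = 1 by rewrite -exprMn divff ?unit_neq0 // expr1n.
rewrite (_ : z ^+ (a.-1 - s) * z ^+ s * (w ^+ (b.-1 - l) * w ^+ l) * _ =
  (f`_s`_l)^* * z ^+ (a.-1 - s) * w ^+ (b.-1 - l) * (z ^+ s * z^-1 ^+ s) * (w ^+ l * w^-1 ^+ l)); last by ring.
by rewrite zs ws !mulr1.
Qed.

Lemma reflK a b f : box a b f -> refl a b (refl a b f) = f.
Proof.
move=> bf; apply: eval_inj => z w z1 w1.
rewrite (refl_eval (@refl_box _ _ _)) // refl_eval // !rmorphM /= conjCK !rmorphXn /= (conj_unit z1) (conj_unit w1).
by rewrite !exprVn mulrA [_ * (_ * _)]mulrACA !mulfV ?expf_neq0 ?unit_neq0 // !mul1r.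
Qed.

Lemma refl0 a b : refl a b 0 = 0.
Proof.
apply/polyP => s; apply/polyP => l; rewrite coef_poly.
by case: ifP; rewrite ?coef0 // coef_poly !coef0 conjC0; case: ifP.
Qed.

Lemma refl_X a b f : box a b f -> refl a.+1 b f = 'X * refl a b f.
Proof.
(* For [a = 0] the exponent [a.-1] is truncated to 0, but then the box contains only 0. *)
move=> bf; have [a0|a0] := posnP a.
  have -> : f = 0 by apply/polyP => s; apply/polyP => l; rewrite bf ?coef0 // a0.
  by rewrite !refl0 mulr0.
apply: eval_inj => z w z1 w1; rewrite hornerM hornerM eval_X !refl_eval //; last exact: boxS bf.
have za : z ^+ a.+1.-1 = z * z ^+ a.-1 by rewrite -exprS prednK.
by rewrite za !mulrA.
Qed.

Lemma refl_Y a b f : box a b f -> refl a b.+1 f = 'Y * refl a b f.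
Proof.
move=> bf; have [b0|b0] := posnP b.
  have -> : f = 0 by apply/polyP => s; apply/polyP => l; rewrite bf ?coef0 // b0 andbF.
  by rewrite !refl0 mulr0.
apply: eval_inj => z w z1 w1; rewrite hornerM hornerM eval_Y !refl_eval //; last exact: boxS bf.
have wb : w ^+ b.+1.-1 = w * w ^+ b.-1 by rewrite -exprS prednK.
by rewrite wb; ring.
Qed.

(** The result f(z0, w) is kept as a bivariate polynomial constant in z, so that forms in w are
    again forms on [bipoly R] and the abstract lemmas apply to them unchanged. *)
Definition evz (z0 : C) f : bipoly R := (f.[z0%:P])%:P.

Lemma evz_lin z0 c f g : evz z0 (c%:P%:P * f + g) = c%:P%:P * evz z0 f + evz z0 g.
Proof. by rewrite /evz hornerD hornerM hornerC rmorphD rmorphM. Qed.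

Lemma evz_eval z0 f z w : (evz z0 f).[z, w] = f.[z0, w].
Proof. by rewrite /evz hornerC. Qed.

Lemma evz_box a b z0 f : box a b f -> box 1 b (evz z0 f).
Proof.
move=> bf s l; rewrite /evz coefC; case: s => [|s] /=; last by rewrite coef0.
rewrite -leqNgt => bl; rewrite (@horner_coef_wide _ a) ?(box_size bf) // coef_sum big1 // => i _.
by rewrite -rmorphXn coefMC bf ?mul0r // [(l < b)%N]ltnNge bl andbF.
Qed.

Lemma evzX z0 f : evz z0 ('X * f) = z0%:P%:P * evz z0 f.
Proof. by rewrite /evz hornerM hornerX rmorphM. Qed.

Lemma evzY z0 f : evz z0 ('Y * f) = 'Y * evz z0 f.
Proof. by rewrite /evz hornerM hornerC rmorphM. Qed.

Lemma evz_id z0 b f : box 1 b f -> evz z0 f = f.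
Proof.
move=> bf; apply: eval_inj => z w z1 w1; rewrite evz_eval !(evalE _ _ bf).
by apply: eq_bigr => s _; apply: eq_bigr => l _; rewrite (ord1 s) !expr0.
Qed.

Lemma evz_refl a b z0 f : box a b f -> `|z0| = 1 ->
  evz z0 (refl a b f) = (z0 ^+ a.-1)%:P%:P * refl 1 b (evz z0 f).
Proof.
move=> bf z1; apply: eval_inj => z w z1' w1.
rewrite evz_eval refl_eval // !hornerM !hornerC refl_eval //; last exact: (evz_box _ bf).
by rewrite evz_eval mul1r mulrA.
Qed.

End BiPoly.

(** * Inner products given by a positive weight on the torus *)

Section WeightedForm.
Variable R : realType.
Local Notation C := R[i].
Local Notation ii := ((polyC \o polyC)%FUN : {rmorphism C -> bipoly R}).
Implicit Types (f g h : bipoly R).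

Definition wip (I : (C -> C -> C) -> C) (om : C -> C -> C) f g : C :=
  I (fun z w => f.[z, w] * (g.[z, w])^* * om z w).

(** Shared by the weights 1/t, 1/|p|^2 and, for fixed z0, 1/|p(z0, w)|^2. Such a form lives on all
    polynomials, so multiplication by z or w never leaves its domain. *)
Record toeplitz_ip (ip : bipoly R -> bipoly R -> C) : Prop := ToeplitzIp {
  ti_herm : herm ii ip;
  ti_pos : forall f, f != 0 -> 0 < ip f f;
  ti_X : forall f g, ip ('X * f) ('X * g) = ip f g;
  ti_Y : forall f g, ip ('Y * f) ('Y * g) = ip f g;
  ti_refl : forall a b f g, box a b f -> box a b g -> ip (refl a b f) (refl a b g) = ip g f }.

Variable I : (C -> C -> C) -> C.
Hypothesis hI : torus_mean I.

Section Weight.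
Variable om : C -> C -> C.
Hypothesis aom : adm om.
Hypothesis om0 : forall z w, `|z| = 1 -> `|w| = 1 -> 0 < om z w.

Lemma adm_wip f g : adm (fun z w => f.[z, w] * (g.[z, w])^* * om z w).
Proof. by apply: adm_mul => //; apply: adm_mul; [|apply: adm_conj]; exact: adm_eval. Qed.

Lemma mulC_unit (z : C) : `|z| = 1 -> z * z^* = 1.
Proof. by move=> z1; rewrite -normCK z1 expr1n. Qed.

Lemma wip_toeplitz : toeplitz_ip (wip I om).
Proof.
split.
- split=> [h c f g|f g].
    rewrite /wip -(tm_lin hI); [|exact: adm_wip..].
    by apply: (tm_ext hI) => z w _ _; rewrite !hornerD !hornerM !hornerC; ring.
  rewrite /wip -(tm_conj hI); last exact: adm_wip.
  apply: (tm_ext hI) => z w z1 w1; rewrite !rmorphM /= conjCK.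
  by rewrite (CrealP (gtr0_real (om0 z1 w1))); ring.
- move=> f f0; have ge0 z w : `|z| = 1 -> `|w| = 1 -> 0 <= f.[z, w] * (f.[z, w])^* * om z w.
    by move=> z1 w1; rewrite mulr_ge0 ?mul_conjC_ge0 // ltW // om0.
  rewrite lt_neqAle eq_sym (tm_ge0 hI) ?andbT //; last exact: adm_wip.
  apply: contra_neq f0 => I_0; apply: (@eval_inj R) => z w z1 w1.
  have /eqP := tm_eq0 hI (adm_wip f f) ge0 I_0 z1 w1.
  by rewrite mulf_eq0 mul_conjC_eq0 (gt_eqF (om0 z1 w1)) orbF !horner0 => /eqP.
- move=> f g; apply: (tm_ext hI) => z w z1 w1; rewrite !hornerM eval_X rmorphM /=.
  by rewrite mulrACA mulC_unit // mul1r.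
- move=> f g; apply: (tm_ext hI) => z w z1 w1; rewrite !hornerM eval_Y rmorphM /=.
  by rewrite mulrACA mulC_unit // mul1r.
- move=> a b f g bf bg; apply: (tm_ext hI) => z w z1 w1; rewrite !refl_eval //.
  rewrite rmorphM /= conjCK mulrACA mulC_unit ?mul1r; first by congr (_ * _); rewrite mulrC.
  by rewrite normrM !normrX z1 w1 !expr1n mulr1.
Qed.

Lemma wip_Xn_bound f g : exists B, forall k, `|wip I om f ('X ^+ k * g)| <= B.
Proof.
eexists=> k; have := fcoef_bound hI k 0 (adm_wip f g).
rewrite (_ : fcoef _ _ _ _ = wip I om f ('X ^+ k * g)); first exact.
apply: (tm_ext hI) => z w z1 _.
rewrite !hornerM !horner_exp eval_X rmorphM rmorphXn /= (conj_unit z1) exprVn exprnN oppr0 expr0z; ring.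
Qed.

End Weight.
End WeightedForm.

(** * The spaces E^1 and the unit vector p produced by the split-shift condition *)

Section ToeplitzIp.
Variable R : realType.
Local Notation C := R[i].
Local Notation ii := ((polyC \o polyC)%FUN : {rmorphism C -> bipoly R}).
Implicit Types (f g h x y : bipoly R) (K : set (bipoly R)).
Variable ip : bipoly R -> bipoly R -> C.
Hypothesis hip : toeplitz_ip ip.
Let hh := ti_herm hip.
Let hp K : posdef K ip. Proof. by move=> f _; exact: (ti_pos hip). Qed.

Lemma ip_eq0 f : ip f f = 0 -> f = 0.
Proof. by move=> f0; apply/eqP; apply: contra_eqT f0 => /(ti_pos hip)/lt0r_neq0. Qed.

(* [E a b] is E^1_{a-1,b}. *)
Definition E a b f := box a b.+1 f /\ forall g, box a b g -> ip f ('Y * g) = 0.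

Definition Ybox a b f := exists2 g, box a b g & f = 'Y * g.

Lemma Ybox_sub a b : Ybox a b `<=` box a b.+1.
Proof. by move=> _ [g bg ->]; exact: box_Y. Qed.

Lemma Ybox_subsp a b : subsp ii (Ybox a b).
Proof. exact: subsp_mul (box_subsp R a b). Qed.

Lemma E_subsp a b : subsp ii (E a b).
Proof. exact: (orth_subsp hh (box a b) ( *%R 'Y) (box_subsp R a b.+1)). Qed.

Lemma divY a b f : box a b.+1 f -> (forall s, f`_s`_0 = 0) -> Ybox a b f.
Proof.
move=> bf f0; exists (\poly_(s < a) \poly_(l < b) f`_s`_l.+1).
  move=> s l; rewrite negb_and coef_poly; case: ifP => [sa|_]; last by rewrite coef0.
  by rewrite /= coef_poly => /negPf ->.
apply/polyP => s; apply/polyP => l; rewrite coefYz; case: l => [|l]; first exact: f0.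
rewrite coef_poly; case: ifPn => [sa|nsa].
  by rewrite coef_poly; case: ifPn => // nlb; rewrite bf // negb_and ltnS nlb orbT.
by rewrite coef0 bf // negb_and nsa.
Qed.

(** An element with f(z, 0) = 0 lies in the space wP to which it is orthogonal. Together with
    [E_exists] this identifies [E a b] with the polynomials in z of degree below [a], by restriction
    to w = 0. *)
Lemma E_eq0 a b f : E a b f -> (forall s, f`_s`_0 = 0) -> f = 0.
Proof.
move=> [bf Ef] f0; apply: ip_eq0; have [g bg e] := divY bf f0.
by rewrite {2}e Ef.
Qed.

Lemma box_decomp a b f : box a b.+1 f ->
  exists2 e, E a b e & exists2 g, box a b g & f = e + 'Y * g.
Proof.
move=> bf; have [_ [g bg ->] Hr] := proj_exists hh f (@Ybox_subsp a b) (fdimS (@Ybox_sub a b) (box_fdim R a b.+1)) (hp (K := _)).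
exists (f - 'Y * g); last by exists g => //; rewrite subrK.
split; first by apply: (subspB (box_subsp R a b.+1)) => //; exact: box_Y.
by move=> h bh; apply: Hr; exists h.
Qed.

Lemma E_exists a b u : box a 1 u -> exists2 f, E a b f & forall s, f`_s`_0 = u`_s`_0.
Proof.
move=> bu; have [|e Ee [g bg ue]] := @box_decomp a b u; first exact: boxS bu.
by exists e => // s; rewrite ue !coefD coefYz addr0.
Qed.

(** The split-shift condition for a form on all polynomials; [E n m] is E^1_{n-1,m} and [E n.+1 m]
    is E^1_{n,m}. Directness of the sum follows from orthogonality and positivity. *)
Record split_pair n m (K1 K2 : set (bipoly R)) : Prop := SplitPair {
  sp_sub1 : subsp ii K1;
  sp_sub2 : subsp ii K2;
  sp_E : forall f, E n m f <-> exists2 k1, K1 k1 & exists2 k2, K2 k2 & f = k1 + k2;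
  sp_orth : forall k1 k2, K1 k1 -> K2 k2 -> ip k1 k2 = 0;
  sp_orthX : forall k1 k2, K1 k1 -> K2 k2 -> ip k1 ('X * k2) = 0;
  sp_E1 : forall k, K1 k -> E n.+1 m k;
  sp_E2 : forall k, K2 k -> E n.+1 m ('X * k) }.

Section SplitShift.
Variables (n m : nat) (K1 K2 : set (bipoly R)).
Hypothesis sp : split_pair n m K1 K2.
Let sK1 := sp_sub1 sp.
Let sK2 := sp_sub2 sp.
Let EK := sp_E sp.
Let K12 := sp_orth sp.
Let K1X2 := sp_orthX sp.
Let K1E := sp_E1 sp.
Let XK2E := sp_E2 sp.

Lemma K1_sub k : K1 k -> E n m k.
Proof. by move=> Kk; apply/EK; exists k => //; exists 0; [case: sK2|rewrite addr0]. Qed.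
Lemma K2_sub k : K2 k -> E n m k.
Proof. by move=> Kk; apply/EK; exists 0; [case: sK1|exists k => //; rewrite add0r]. Qed.

Lemma K12_eq0 k1 k2 : K1 k1 -> K2 k2 -> k1 + k2 = 0 -> k1 = 0 /\ k2 = 0.
Proof.
move=> h1 h2 e; have e1 : k1 = - k2 by apply/eqP; rewrite -addr_eq0 e.
have k10 : k1 = 0.
  apply: ip_eq0; rewrite {2}e1 -[- k2]mulN1r -(rmorphN1 ii) (ipZr hh) K12 //.
  by rewrite mulr0.
by split => //; move: e; rewrite k10 add0r.
Qed.

Lemma coef_lin (s l : nat) : linf ii (fun f => f`_s`_l).
Proof. by move=> c f g; rewrite !coefD coefCz. Qed.

(* E^1_{n,m} has dimension n + 1 and K1 + zK2 has dimension n, so that p spans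
   the orthogonal complement. *)
Lemma split_shift_vector : exists p, [/\ E n.+1 m p, ip p p = 1,
  (forall k, K1 k -> ip p k = 0), (forall k, K2 k -> ip p ('X * k) = 0) &
  forall f, E n.+1 m f -> (forall k, K1 k -> ip f k = 0) -> (forall k, K2 k -> ip f ('X * k) = 0) ->
    f = ii (ip f p) * p].
Proof.
pose mon s : bipoly R := 'X ^+ s.
have monE s t l : (mon s)`_t`_l = ((t == s) && (l == 0%N))%:R.
  by rewrite /mon coefXn; case: eqP => _ /=; rewrite ?coef0 ?coef1.
have mbox a s : (s < a)%N -> box a 1 (mon s).
  by move=> sa t l; rewrite monE; case: eqP => [->|//]; rewrite sa; case: l.
have /choice[b Hb] : forall s, exists f, (s < n)%N -> E n m f /\ forall t, f`_t`_0 = (mon s)`_t`_0.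
  move=> s; case: (ltnP s n) => sn; last by exists 0.
  by have [f Ef Hf] := E_exists m (mbox _ _ sn); exists f.
have /choice[k1 Hk] : forall s, exists k1, (s < n)%N -> exists k2, [/\ K1 k1, K2 k2 & b s = k1 + k2].
  move=> s; case: (ltnP s n) => sn; last by exists 0.
  by have [/(Hb s) [/EK[k1 h1 [k2 h2 e]] _]] := sn; exists k1 => _; exists k2.
pose k2 s := b s - k1 s.
have Hk2 s : (s < n)%N -> [/\ K1 (k1 s), K2 (k2 s) & b s = k1 s + k2 s].
  by move=> sn; have [k [h1 h2 e]] := Hk s sn; rewrite /k2 e addrC addKr -e.
(* The [b s], with b_s(z, 0) = z^s, are a basis of E^1_{n-1,m}. The map k1 + k2 -> k1 + zk2 sends
   them to the [v s], which span K1 + zK2. *)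
clearbody k2; pose v s := k1 s + 'X * k2 s.
have span f : E n m f -> f = \sum_(s < n) ii f`_s`_0 * b s.
  move=> Ef; apply/eqP; rewrite -subr_eq0; apply/eqP; apply: (@E_eq0 n m).
    apply: (subspB (@E_subsp n m)) => //; apply: (subsp_sum _ (@E_subsp n m)) => s _.
    by apply: (subspZ _ (@E_subsp n m)); case: (Hb s (ltn_ord s)).
  move=> t; rewrite !coefB (linf_sum _ _ _ (@coef_lin t 0)) /=.
  under eq_bigr => s _ do rewrite coefCz (Hb s (ltn_ord s)).2 monE andbT.
  case: (ltnP t n) => tn.
    rewrite (bigD1 (Ordinal tn)) //= eqxx mulr1 big1 ?addr0 ?subrr // => s st.
    by case: eqP => [e|_]; [case/eqP: st; apply/val_inj|rewrite mulr0].
  rewrite big1 ?subr0 => [|s _]; first by case: Ef => bf _; rewrite bf // negb_and ltnNge tn.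
  case: eqP => [e|_]; last by rewrite mulr0.
  by have := ltn_ord s; rewrite -e ltnNge tn.
have Kspan j1 j2 : K1 j1 -> K2 j2 -> exists c : nat -> C,
    j1 = \sum_(s < n) ii (c s) * k1 s /\ j2 = \sum_(s < n) ii (c s) * k2 s.
  move=> h1 h2; have Ej : E n m (j1 + j2) by apply/EK; exists j1 => //; exists j2.
  set f := j1 + j2 in Ej; exists (fun s => f`_s`_0).
  set u1 := \sum_(s < n) _; set u2 := \sum_(s < n) _.
  have Ku1 : K1 u1 by apply: (subsp_sum _ sK1) => s _; apply: (subspZ _ sK1); case: (Hk2 s (ltn_ord s)).
  have Ku2 : K2 u2 by apply: (subsp_sum _ sK2) => s _; apply: (subspZ _ sK2); case: (Hk2 s (ltn_ord s)).
  have e : (j1 - u1) + (j2 - u2) = 0.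
    rewrite addrACA -opprD -/f; apply/eqP; rewrite subr_eq0; apply/eqP.
    rewrite /u1 /u2 -big_split {1}(span f Ej); apply: eq_bigr => s _ /=.
    by have [_ _ ->] := Hk2 s (ltn_ord s); rewrite mulrDr.
  have [] := K12_eq0 (subspB sK1 h1 Ku1) (subspB sK2 h2 Ku2) e.
  by move=> /eqP; rewrite subr_eq0 => /eqP <- /eqP; rewrite subr_eq0 => /eqP <-.
have Ev s : (s < n)%N -> E n.+1 m (v s).
  by move=> sn; have [h1 h2 _] := Hk2 s sn; apply: (subspD (@E_subsp n.+1 m)); [exact: K1E|exact: XK2E].
have orthK f : (forall s, (s < n)%N -> ip f (v s) = 0) ->
    (forall k, K1 k -> ip f k = 0) /\ (forall k, K2 k -> ip f ('X * k) = 0).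
  move=> fv; split=> k Kk.
    have [c [e1 e2]] := Kspan k 0 Kk sK2.1.
    have -> : k = \sum_(s < n) ii (c s) * v s.
      transitivity (k + 'X * 0); first by rewrite mulr0 addr0.
      rewrite {1}e1 [X in _ + 'X * X]e2 mulr_sumr -big_split /=.
      by apply: eq_bigr => s _; rewrite /v mulrDr; congr (_ + _); rewrite mulrCA.
    by rewrite (ip_sumr hh) big1 // => s _; rewrite (ipZr hh) fv // mulr0.
  have [c [e1 e2]] := Kspan 0 k sK1.1 Kk.
  have -> : 'X * k = \sum_(s < n) ii (c s) * v s.
    transitivity (0 + 'X * k); first by rewrite add0r.
    rewrite [X in X + _]e1 [X in _ + 'X * X]e2 mulr_sumr -big_split /=.
    by apply: eq_bigr => s _; rewrite /v mulrDr; congr (_ + _); rewrite mulrCA.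
  by rewrite (ip_sumr hh) big1 // => s _; rewrite (ipZr hh) fv // mulr0.
have /choice[e He] : forall s, exists f, (s < n.+1)%N -> E n.+1 m f /\ forall t, f`_t`_0 = (mon s)`_t`_0.
  move=> s; case: (ltnP s n.+1) => sn; last by exists 0.
  by have [f Ef Hf] := E_exists m (mbox _ _ sn); exists f.
(* The [n] conditions of orthogonality to the [v s] leave a nonzero vector in the span of the [n.+1]
   elements [e j] of E^1_{n,m}. *)
have [c [i0 i0n ci0] Hc] := @more_unknowns _ _ ii n (fun i f => ip f (v i)) e (fun i => hh.1 (v i)).
set q := \sum_(j < n.+1) _ in Hc.
have Eq : E n.+1 m q.
  apply: (subsp_sum _ (@E_subsp n.+1 m)) => s _; apply: (subspZ _ (@E_subsp n.+1 m)).
  by case: (He s (ltn_ord s)).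
have q0 : q != 0.
  apply: contra_neq ci0 => /(congr1 (fun f : bipoly R => f`_i0`_0)).
  rewrite /q (linf_sum _ _ _ (@coef_lin i0 0)) /= !coef0.
  under eq_bigr => s _ do rewrite coefCz (He s (ltn_ord s)).2 monE andbT.
  have i0n' : (i0 < n.+1)%N by [].
  rewrite (bigD1 (Ordinal i0n')) //= eqxx mulr1 big1 ?addr0 // => s st.
  by case: eqP => [es|_]; [case/eqP: st; apply/val_inj|rewrite mulr0].
have qq := ti_pos hip q0.
pose r := sqrtC (ip q q); have r0 : r != 0 by rewrite sqrtC_eq0 lt0r_neq0.
have rr : r * r^* = ip q q.
  by rewrite (CrealP (ger0_real _)) ?sqrtC_ge0 ?ltW // -expr2 sqrtCK.
pose p := ii r^-1 * q.
have pq f : (ip q f = 0) -> ip p f = 0 by move=> h; rewrite (ipZl hh) h mulr0.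
have [qK1 qK2] := orthK q Hc.
have Ep : E n.+1 m p by exact: (subspZ _ (@E_subsp n.+1 m)).
have pp : ip p p = 1.
  by rewrite (ipZl hh) (ipZr hh) mulrA fmorphV /= -invfM rr mulVf ?lt0r_neq0.
clearbody p; exists p; split => // [k Kk|k Kk|]; first by apply: pq; exact: qK1.
  by apply: pq; exact: qK2.
move=> f Ef fK1 fK2; pose f' := f - ii (ip f p) * p.
have Ef' : E n.+1 m f' by apply: (subspB (@E_subsp n.+1 m)) => //; exact: (subspZ _ (@E_subsp n.+1 m)).
have f'p : ip f' p = 0 by rewrite (ipBl hh) (ipZl hh) pp mulr1 subrr.
have f'v s : (s < n)%N -> ip f' (v s) = 0.
  move=> sn; have [h1 h2 _] := Hk2 s sn; rewrite (ipBl hh) (ipZl hh) !(ipDr hh) fK1 // fK2 //.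
  by rewrite !pq ?addr0 ?mulr0 ?subrr //; [exact: qK2|exact: qK1].
have pv s : (s < n)%N -> ip p (v s) = 0.
  by move=> sn; have [h1 h2 _] := Hk2 s sn; rewrite !(ipDr hh) !pq ?addr0 //; [exact: qK2|exact: qK1].
suff f'0 : f' = 0 by move/eqP: f'0; rewrite subr_eq0 => /eqP.
apply/eqP; apply: contraT => f'0; exfalso.
(* Otherwise the [v s], p and f' would be n + 2 vectors in a space of dimension n + 1. In a relation
   between them, orthogonality kills the coefficients of p and f', and those of the [v s] vanish
   because the [v s] are independent. *)
pose V s := if (s < n)%N then v s else if s == n then p else f'.
have [d [j0 j0n dj0] Hd] := @more_unknowns _ _ ii n.+1 (fun i f => f`_i`_0) V (fun i => @coef_lin i 0).
set W := \sum_(j < n.+2) _ in Hd.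
have EV s : E n.+1 m (V s) by rewrite /V; case: ifP => [/Ev //|_]; case: ifP.
have W0 : W = 0.
  have EW : E n.+1 m W.
    by apply: (subsp_sum _ (@E_subsp n.+1 m)) => s _; apply: (subspZ _ (@E_subsp n.+1 m)).
  apply: (@E_eq0 n.+1 m) => // s; case: (ltnP s n.+1) => [/Hd //|sn].
  by case: EW => bW _; rewrite bW // negb_and ltnNge sn.
have WE : W = \sum_(s < n) ii (d s) * v s + ii (d n) * p + ii (d n.+1) * f'.
  rewrite /W !big_ord_recr /= {2 3}/V !ltnn ltnNge leqnSn /= eqxx (gtn_eqF (ltnSn n)).
  by congr (_ + _ + _); apply: eq_bigr => s _; rewrite /V ltn_ord.
have sv g : (forall s, (s < n)%N -> ip g (v s) = 0) -> ip (\sum_(s < n) ii (d s) * v s) g = 0.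
  by move=> h; rewrite (ip_suml hh) big1 // => s _; rewrite (ipZl hh) (ip_eq0C hh) ?mulr0 // h.
have dn : d n = 0.
  have := ip0l hh p; rewrite -W0 WE !(ipDl hh) sv // !(ipZl hh) pp f'p.
  by rewrite mulr1 mulr0 addr0 add0r.
have dn1 : d n.+1 = 0.
  have := ip0l hh f'; rewrite -W0 WE !(ipDl hh) sv // !(ipZl hh) (ip_eq0C hh f'p) mulr0 addr0 add0r.
  by move/eqP; rewrite mulf_eq0 (gt_eqF (ti_pos hip f'0)) orbF => /eqP.
have sv0 : \sum_(s < n) ii (d s) * v s = 0.
  by have := W0; rewrite WE dn dn1 !rmorph0 !mul0r !addr0.
(* K1 being orthogonal to zK2, both parts of the relation u1 + zu2 = 0 vanish; hence u1 + u2 = 0, a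
   relation between the basis vectors [b s]. *)
have sb0 : \sum_(s < n) ii (d s) * b s = 0.
  set u1 := \sum_(s < n) ii (d s) * k1 s; set u2 := \sum_(s < n) ii (d s) * k2 s.
  have Ku1 : K1 u1 by apply: (subsp_sum _ sK1) => s _; apply: (subspZ _ sK1); case: (Hk2 s (ltn_ord s)).
  have Ku2 : K2 u2 by apply: (subsp_sum _ sK2) => s _; apply: (subspZ _ sK2); case: (Hk2 s (ltn_ord s)).
  have e12 : u1 + 'X * u2 = 0.
    rewrite -sv0 /u1 /u2 mulr_sumr -big_split; apply: eq_bigr => s _.
    by rewrite /v mulrDr; congr (_ + _); rewrite mulrCA.
  have u10 : u1 = 0.
    apply: ip_eq0; have := congr1 (ip u1) e12.
    by rewrite (ipDr hh) (ip0r hh) K1X2 // addr0.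
  have u20 : u2 = 0.
    by apply/eqP; move: e12; rewrite u10 add0r => /eqP; rewrite mulf_eq0 polyX_eq0.
  transitivity (u1 + u2); last by rewrite u10 u20 addr0.
  by rewrite -big_split; apply: eq_bigr => s _ /=; have [_ _ ->] := Hk2 s (ltn_ord s); rewrite mulrDr.
have dz s : (s < n)%N -> d s = 0.
  move=> sn; have := congr1 (fun f : bipoly R => f`_s`_0) sb0.
  rewrite /= (linf_sum _ _ _ (@coef_lin s 0)) /= !coef0.
  under eq_bigr => t _ do rewrite coefCz (Hb t (ltn_ord t)).2 monE andbT.
  rewrite (bigD1 (Ordinal sn)) //= eqxx mulr1 big1 ?addr0 // => t st.
  by case: eqP => [es|_]; [case/eqP: st; apply/val_inj|rewrite mulr0].
move/eqP: dj0; apply; have [/dz //|nj] := ltnP j0 n.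
by move: nj; rewrite leq_eqVlt => /orP[/eqP <- //|nj]; have -> : j0 = n.+1 by apply/eqP; rewrite eqn_leq j0n nj.
Qed.

End SplitShift.
End ToeplitzIp.

(** * Weights 1/|r|^2 for polynomials without zeros in the closed disc *)

Section StableOneVariable.
Variable R : realType.
Local Notation C := R[i].
Variable I : (C -> C -> C) -> C.
Hypothesis hI : torus_mean I.
Variable r : {poly C}.
Hypothesis str : forall w, `|w| <= 1 -> r.[w] != 0.
Definition invsq1 : C -> C -> C := fun _ w => (`|r.[w]| ^+ 2)^-1.

Lemma adm_invsq1 : adm invsq1.
Proof.
apply: (@adm_ext _ (fun _ w => (r.[w] * (r.[w])^* )^-1)) => [z w _ _|]; first by rewrite /invsq1 normCK.
apply: adm_inv => [z w _ w1|]; first by rewrite mul_conjC_eq0 str ?w1.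
by apply: adm_mul; [|apply: adm_conj]; exact: adm1_horner.
Qed.

Lemma invsq1_gt0 z w : `|z| = 1 -> `|w| = 1 -> 0 < invsq1 z w.
Proof. by move=> _ w1; rewrite /invsq1 invr_gt0 exprn_gt0 // normr_gt0 str ?w1. Qed.

(** On the circle g \bar r / |r|^2 equals g/r, whose mean is its value at 0. *)
Lemma wip_invsq1 (g : {poly C}) : wip I invsq1 (g%:P : bipoly R) (r%:P) = g.[0] / r.[0].
Proof.
rewrite -(cm_div (circ_mean_w hI) g str); apply: (tm_ext hI) => z w z1 w1.
rewrite !hornerC /invsq1 normCK; have u0 : r.[w] != 0 by rewrite str ?w1.
by field; rewrite u0 conjC_eq0 u0.
Qed.

End StableOneVariable.

Section StableWeight.
Variable R : realType.
Local Notation C := R[i].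
Variable p : bipoly R.
Hypothesis stab : forall z w, `|z| = 1 -> `|w| <= 1 -> p.[z, w] != 0.

Definition invsq : C -> C -> C := fun z w => (`|p.[z, w]| ^+ 2)^-1.

Lemma adm_invsq : adm invsq.
Proof.
apply: (@adm_ext _ (fun z w => (p.[z, w] * (p.[z, w])^* )^-1)) => [z w _ _|]; first by rewrite /invsq normCK.
apply: adm_inv => [z w z1 w1|]; first by rewrite mul_conjC_eq0 stab ?w1.
by apply: adm_mul; [|apply: adm_conj]; exact: adm_eval.
Qed.

Lemma invsq_gt0 z w : `|z| = 1 -> `|w| = 1 -> 0 < invsq z w.
Proof. by move=> z1 w1; rewrite /invsq invr_gt0 exprn_gt0 // normr_gt0 stab ?w1. Qed.

End StableWeight.

(** * Transport of the form to polynomials in w by evaluation at a point z0 of the circle *)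

Section Bracket.
Variable R : realType.
Local Notation C := R[i].
Local Notation ii := ((polyC \o polyC)%FUN : {rmorphism C -> bipoly R}).
Implicit Types (f g h x y : bipoly R) (K W : set (bipoly R)).
Variable ip : bipoly R -> bipoly R -> C.
Hypothesis hip : toeplitz_ip ip.
Let hh := ti_herm hip.
Let hp K : posdef K ip. Proof. by move=> f _; exact: (ti_pos hip). Qed.
Variable z0 : C.
Hypothesis z01 : `|z0| = 1.
Local Notation ev := (evz z0).

Lemma evz0 : ev 0 = 0. Proof. by rewrite /evz horner0 polyC0. Qed.
Lemma evzD f g : ev (f + g) = ev f + ev g.
Proof. by have := evz_lin z0 1 f g; rewrite !mul1r. Qed.
Lemma evzZ c f : ev (ii c * f) = ii c * ev f.
Proof. exact: (linZ (iota := ii) c f (evz_lin z0)). Qed.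
Lemma evzN f : ev (- f) = - ev f.
Proof. by rewrite -mulN1r -(rmorphN1 ii) evzZ rmorphN1 mulN1r. Qed.
Lemma evzB f g : ev (f - g) = ev f - ev g. Proof. by rewrite evzD evzN. Qed.
Lemma evz_sum (J : Type) (r : seq J) (p : pred J) (F : J -> bipoly R) :
  ev (\sum_(i <- r | p i) F i) = \sum_(i <- r | p i) ev (F i).
Proof. by apply: (big_morph ev evzD evz0). Qed.

Lemma box_div a b x : box a.+1 b x -> ev x = 0 ->
  exists2 f, box a b f & 'X * f = x + ii z0 * f.
Proof.
move=> bx /eqP; rewrite /evz polyC_eq0 => rx.
have /factor_theorem[f xf] : root x z0%:P by [].
exists f; last by rewrite xf mulrBr mulrC [f * _%:P]mulrC subrK.
have szf : (size f <= a)%N.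
  have [->|f0] := eqVneq f 0; first by rewrite size_poly0.
  by have := box_size bx; rewrite xf size_Mmonic ?monicXsubC // size_XsubC addn2.
have cf s : f`_s = x`_s.+1 + z0%:P * f`_s.+1.
  by rewrite xf mulrBr coefB coefMX coefMC /= [_ * z0%:P]mulrC subrK.
(* Division by z - z0 must not raise the degree in w; the coefficients of the quotient are
   determined from the top one downwards. *)
have key k s : (a - s <= k)%N -> (size (f`_s)%R <= b)%N.
  elim: k s => [|k IH] s; first by rewrite leqn0 subn_eq0 => as_; rewrite nth_default ?size_poly0 // (leq_trans szf).
  move=> h; have {}IH := IH s.+1 ltac:(lia).
  rewrite cf (leq_trans (size_polyD _ _)) // geq_max (box_size2 _ bx) /=.
  by rewrite mul_polyC (leq_trans (size_scale_leq _ _)).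
move=> s l; rewrite negb_and -!leqNgt => /orP[h|h].
  by rewrite [f`_s]nth_default ?coef0 // (leq_trans szf).
by rewrite nth_default // (leq_trans (key a s (leq_subr _ _))).
Qed.

(** The complements in P_{a,b-1} of P_{a-1,b-1} and, for [Xc'], of zP_{a-1,b-1}. Reversal exchanges
    the two. *)
Definition Xc a b f := box a.+1 b f /\ forall g, box a b g -> ip f g = 0.
Definition Xc' a b f := box a.+1 b f /\ forall g, box a b g -> ip f ('X * g) = 0.

Lemma Xc_subsp a b : subsp ii (Xc a b).
Proof. exact: (orth_subsp hh (box a b) id (box_subsp R a.+1 b)). Qed.

Lemma Xc'_subsp a b : subsp ii (Xc' a b).
Proof. exact: (orth_subsp hh (box a b) ( *%R 'X) (box_subsp R a.+1 b)). Qed.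

Lemma zz : z0^* * z0 = 1. Proof. by rewrite mulrC mulC_unit. Qed.

Lemma ip_z0 f : ip (ii z0 * f) (ii z0 * f) = ip f f.
Proof. by rewrite (ipZl hh) (ipZr hh) mulrA mulC_unit // mul1r. Qed.

(** If x = (z - z0)f, then zf = x + z0 f with orthogonal terms, and both zf and z0 f have the norm
    of f; this leaves no room for x. *)
Lemma Xc_inj a b x : Xc a b x -> ev x = 0 -> x = 0.
Proof.
move=> [bx x0] /(box_div bx)[f bf e]; apply: (ip_eq0 hip).
have := ti_X hip f f; rewrite e (ipDl hh) !(ipDr hh) ip_z0.
rewrite (ipZl hh) (ipZr hh) (ip_eq0C hh (x0 _ bf)) (x0 _ bf) !mulr0 add0r addr0 -[RHS]add0r.
exact: addIr.
Qed.

Lemma Xc'_inj a b x : Xc' a b x -> ev x = 0 -> x = 0.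
Proof.
move=> [bx x0] /(box_div bx)[f bf e]; apply: (ip_eq0 hip).
have e2 : ii z0 * f = 'X * f - x by rewrite e addrAC subrr add0r.
have := ip_z0 f; rewrite e2 (ipBl hh) !(ipBr hh) (ti_X hip).
rewrite (ip_eq0C hh (x0 _ bf)) (x0 _ bf) subr0 sub0r opprK -[RHS]addr0.
exact: addrI.
Qed.

(* Evaluation at z0 is a bijection from W onto the polynomials in w; [xs] is its
   inverse, and ip (xs f) (xs g) is the form it transports. *)
Record bracket W b (xs : bipoly R -> bipoly R) : Prop := BracketProps {
  br_lin : forall c f g, xs (ii c * f + g) = ii c * xs f + xs g;
  br_in : forall g, W (xs g);
  br_ev : forall g, box 1 b g -> ev (xs g) = g;
  br_K : forall x, W x -> xs (ev x) = x }.

Lemma bracket_exists W a b (e : nat -> bipoly R) : subsp ii W -> W `<=` box a b ->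
  (forall f, W f -> ev f = 0 -> f = 0) -> (forall k, W (e k)) ->
  (forall c : nat -> C, \sum_(k < b) ii (c k) * e k = 0 -> forall k, (k < b)%N -> c k = 0) ->
  exists xs, bracket W b xs.
Proof.
move=> sW Wb inj We indep.
have surj g : box 1 b g -> exists2 x, W x & ev x = g.
  (* The evaluations of the [e k] and [g] are b + 1 vectors in a space of dimension b. In a relation
     between them the coefficient of [g] is nonzero, since evaluation is injective on W and the
     [e k] are independent. *)
  move=> bg; pose v k := if (k < b)%N then ev (e k) else g.
  have [c [j0 j0n cj0] Hc] := @more_unknowns _ _ ii b (fun i f => f`_0`_i) v (fun i => @coef_lin R 0 i).
  have bv k : box 1 b (v k) by rewrite /v; case: ifP => // _; exact: (evz_box _ (Wb _ (We k))).
  have S0 : \sum_(j < b.+1) ii (c j) * v j = 0.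
    have bS : box 1 b (\sum_(j < b.+1) ii (c j) * v j).
      by apply: (subsp_sum _ (box_subsp R 1 b)) => j _; apply: (subspZ _ (box_subsp R 1 b)).
    apply/polyP => s; apply/polyP => l; rewrite !coef0.
    case: (ltnP l b) => lb; last by rewrite bS // negb_and -!leqNgt lb orbT.
    by case: s => [|s]; [exact: Hc|rewrite bS].
  move: S0; rewrite big_ord_recr /= {2}/v ltnn.
  set x := \sum_(j < b) ii (c j) * e j.
  have Wx : W x by apply: (subsp_sum _ sW) => j _; exact: (subspZ _ sW).
  rewrite (_ : \sum_(j < b) _ = ev x); last first.
    by rewrite /x evz_sum; apply: eq_bigr => j _; rewrite evzZ /v ltn_ord.
  move=> S0; have [cb|cb] := eqVneq (c b) 0.
    move: S0; rewrite cb rmorph0 mul0r addr0 => /(inj _ Wx)/indep ci.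
    move: j0n cj0; rewrite leq_eqVlt => /orP[/eqP->|/ci ->]; by rewrite ?cb eqxx.
  exists (ii (- (c b)^-1) * x); first exact: (subspZ _ sW).
  have -> : ev (ii (- (c b)^-1) * x) = ii (- (c b)^-1) * ev x by exact: evzZ.
  move/eqP: S0; rewrite addr_eq0 => /eqP ->.
  by rewrite mulrN rmorphN mulNr opprK mulrA -rmorphM mulVf // rmorph1 mul1r.
have /choice[x Hx] : forall k, exists x, (k < b)%N -> W x /\ ev x = 'Y ^+ k.
  move=> k; case: (ltnP k b) => kb; last by exists 0.
  have [|x Wx ex] := surj ('Y ^+ k); last by exists x.
  move=> s l; rewrite -rmorphXn coefC; case: s => [|s] /=; last by rewrite coef0.
  by rewrite coefXn; case: eqP => // ->; rewrite kb.
pose xs g := \sum_(k < b) ii g`_0`_k * x k.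
have Wxs g : W (xs g).
  by apply: (subsp_sum _ sW) => k _; apply: (subspZ _ sW); case: (Hx k (ltn_ord k)).
have exs g : box 1 b g -> ev (xs g) = g.
  move=> bg; rewrite /xs evz_sum; apply: eval_inj => z w z1 w1.
  rewrite (evalE _ _ bg) big_ord1 horner_sum horner_sum; apply: eq_bigr => k _.
  by rewrite evzZ (Hx k (ltn_ord k)).2 hornerM horner_exp !hornerM eval_C !hornerC expr0 mulr1 horner_exp hornerX.
exists xs; split => // [c f g|y Wy].
  rewrite /xs mulr_sumr -big_split; apply: eq_bigr => k _ /=.
  by rewrite !coefD coefCz !rmorphD !rmorphM mulrDl mulrA.
apply/eqP; rewrite -subr_eq0; apply/eqP; apply: inj; first exact: (subspB sW).
by rewrite evzB exs ?subrr //; exact: (evz_box _ (Wb _ Wy)).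
Qed.

Lemma mon_box a b s l : (s < a)%N -> (l < b)%N -> box a b ('X ^+ s * 'Y ^+ l : bipoly R).
Proof.
move=> sa lb i j; rewrite mulrC -rmorphXn coefCM coefXn; case: eqP => [->|_]; last by rewrite mulr0 coef0.
by rewrite mulr1 coefXn; case: eqP => [->|//]; rewrite sa lb.
Qed.

Lemma mon_coef s l i j : ('X ^+ s * 'Y ^+ l : bipoly R)`_i`_j = ((i == s) && (j == l))%:R.
Proof.
rewrite mulrC -rmorphXn coefCM coefXn; case: eqP => _; last by rewrite mulr0 coef0.
by rewrite mulr1 coefXn.
Qed.

Lemma Xbox_sub a b : (fun f => exists2 g, box a b g & f = 'X * g) `<=` box a.+1 b.
Proof. by move=> _ [g bg ->]; exact: box_X. Qed.

Lemma Xbox_subsp a b : subsp ii (fun f => exists2 g, box a b g & f = 'X * g).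
Proof. exact: subsp_mul (box_subsp R a b). Qed.

Lemma Xc_decomp a b f : box a.+1 b f -> exists2 x, Xc a b x & exists2 g, box a b g & f = x + g.
Proof.
move=> bf; have [g bg Hg] := proj_exists hh f (box_subsp R a b) (box_fdim R a b) (hp (K := _)).
exists (f - g); last by exists g => //; rewrite subrK.
by split => //; apply: (subspB (box_subsp R a.+1 b)) => //; exact: boxS bg.
Qed.

Lemma Xc'_decomp a b f : box a.+1 b f -> exists2 x, Xc' a b x & exists2 g, box a b g & f = x + 'X * g.
Proof.
move=> bf; have [_ [g bg ->] Hg] := proj_exists hh f (@Xbox_subsp a b) (fdimS (@Xbox_sub a b) (box_fdim R a.+1 b)) (hp (K := _)).
exists (f - 'X * g); last by exists g => //; rewrite subrK.
split; first by apply: (subspB (box_subsp R a.+1 b)) => //; exact: box_X.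
by move=> h bh; apply: Hg; exists h.
Qed.

Lemma dual_coef_indep b s (e : nat -> bipoly R) (c : nat -> C) :
  (forall j k, (j < b)%N -> (e j)`_s`_k = (k == j)%:R) ->
  \sum_(k < b) ii (c k) * e k = 0 -> forall k, (k < b)%N -> c k = 0.
Proof.
move=> eE S0 k kb; have := congr1 (fun f : bipoly R => f`_s`_k) S0.
rewrite /= (linf_sum _ _ _ (@coef_lin R s k)) /= !coef0.
under eq_bigr => j _ do rewrite coefCz eE //.
rewrite (bigD1 (Ordinal kb)) //= eqxx mulr1 big1 ?addr0 // => j jk.
by case: eqP => [ej|_]; [case/eqP: jk; apply/val_inj|rewrite mulr0].
Qed.

(** The components in [Xc] of the monomials z^a w^k, k < b, are independent, because projecting away
    P_{a-1,b-1} does not touch the coefficients of z^a. *)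
Lemma Xc_bracket a b : exists xs, bracket (Xc a b) b xs.
Proof.
have /choice[e He] : forall k, exists x, Xc a b x /\
   ((k < b)%N -> exists2 g, box a b g & 'X ^+ a * 'Y ^+ k = x + g).
  move=> k; case: (ltnP k b) => kb; last by exists 0; split=> //; case: (Xc_subsp a b).
  by have [x Xx Hx] := Xc_decomp (mon_box (ltnSn a) kb); exists x.
apply: (@bracket_exists _ a.+1 b e (Xc_subsp a b)); [by move=> f []|exact: Xc_inj|by move=> k; case: (He k)|].
move=> c; apply: (@dual_coef_indep _ a) => j k jb; have [_ /(_ jb)[g bg eg]] := He j.
by have := mon_coef a j a k; rewrite eqxx /= => <-; rewrite eg !coefD bg ?addr0 // ltnn.
Qed.

Lemma Xc'_bracket a b : exists xs, bracket (Xc' a b) b xs.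
Proof.
have /choice[e He] : forall k, exists x, Xc' a b x /\
   ((k < b)%N -> exists2 g, box a b g & 'X ^+ 0 * 'Y ^+ k = x + 'X * g).
  move=> k; case: (ltnP k b) => kb; last by exists 0; split=> //; case: (Xc'_subsp a b).
  by have [x Xx Hx] := Xc'_decomp (mon_box (ltn0Sn a) kb); exists x.
apply: (@bracket_exists _ a.+1 b e (Xc'_subsp a b)); [by move=> f []|exact: Xc'_inj|by move=> k; case: (He k)|].
move=> c; apply: (@dual_coef_indep _ 0) => j k jb; have [_ /(_ jb)[g bg eg]] := He j.
by have := mon_coef 0 j 0 k; rewrite eqxx /= => <-; rewrite eg !coefD coefXz addr0.
Qed.

(** For [be f = l (ev f)] the vector [r] is the reproducing kernel of S at z = z0, contracted with
    the functional [l] in the variable w. *)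
Definition rep (S : set (bipoly R)) (be : bipoly R -> C) r := S r /\ forall f, S f -> be f = ip f r.

Lemma rep_uniq S be r r' : subsp ii S -> rep S be r -> rep S be r' -> r = r'.
Proof.
move=> sS [Sr Hr] [Sr' Hr']; apply/eqP; rewrite -subr_eq0; apply/eqP; apply: (ip_eq0 hip).
have Sd := subspB sS Sr Sr'.
by rewrite (ipBr hh) -Hr // -Hr' // subrr.
Qed.

Lemma linf_ev l : linf ii l -> linf ii (fun f => l (ev f)).
Proof. by move=> ll c f g; rewrite evz_lin ll. Qed.

Lemma rep_exists S a b be : subsp ii S -> S `<=` box a b -> linf ii be -> exists r, rep S be r.
Proof.
move=> sS Sb lb; have [r Sr Hr] := riesz hh sS (fdimS Sb (box_fdim R a b)) (hp (K := _)) lb.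
by exists r.
Qed.

Lemma Xc_rep_add a b be x r : linf ii be -> rep (Xc a b) be x -> rep (box a b) be r ->
  rep (box a.+1 b) be (x + r).
Proof.
move=> lb [Xx Hx] [br Hr].
split; first by apply: (subspD (box_subsp R a.+1 b)); [case: Xx|exact: boxS br].
move=> f /Xc_decomp[y Xy [g bg ->]]; rewrite (linfD _ _ lb) Hx // Hr //.
rewrite (ipDl hh) !(ipDr hh) (Xy.2 r br) (ip_eq0C hh (Xx.2 g bg)).
by rewrite addr0 add0r.
Qed.

(** The kernel of P_{a,b-1} is computed along both decompositions. The remaining summands, the
    kernel [r] of P_{a-1,b-1} and \bar z0 z [r], take the same value at z0. *)
Lemma Xc_Xc'_rep a b l x x' : linf ii l -> rep (Xc a b) (fun f => l (ev f)) x ->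
  rep (Xc' a b) (fun f => l (ev f)) x' -> ev x = ev x'.
Proof.
move=> ll [Xx Hx] [Xx' Hx']; have lb := linf_ev ll.
have [r [br Hr]] := rep_exists (box_subsp R a b) (fun f (h : box a b f) => h) lb.
have r1 := Xc_rep_add lb (conj Xx Hx) (conj br Hr).
have r2 : rep (box a.+1 b) (fun f => l (ev f)) (x' + ii z0^* * ('X * r)).
  split.
    apply: (subspD (box_subsp R a.+1 b)); first by case: Xx'.
    by apply: (subspZ _ (box_subsp R a.+1 b)); exact: box_X.
  move=> f /Xc'_decomp[y Xy [g bg ->]]; rewrite (linfD _ _ lb) Hx' // evzX (linfZ _ _ ll) Hr //.
  rewrite (ipDl hh) !(ipDr hh) !(ipZr hh) (Xy.2 r br) (ip_eq0C hh (Xx'.2 g bg)) (ti_X hip).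
  by rewrite conjCK mulr0 addr0 add0r.
have := congr1 ev (rep_uniq (box_subsp R a.+1 b) r1 r2).
rewrite !evzD evzZ evzX mulrA -rmorphM zz rmorph1 mul1r; exact: addIr.
Qed.

Section Compare.
Variables (a b : nat) (xs xs' : bipoly R -> bipoly R).
Hypotheses (hx : bracket (Xc a b) b xs) (hx' : bracket (Xc' a b) b xs').

Lemma xsZ c f : xs (ii c * f) = ii c * xs f.
Proof. exact: linZ (br_lin hx). Qed.

Lemma bracket_rep l x g : linf ii l -> rep (Xc a b) (fun f => l (ev f)) x -> box 1 b g ->
  ip (xs g) (xs (ev x)) = l g.
Proof.
move=> ll [Xx Hx] bg; rewrite (br_K hx) // -Hx; last exact: (br_in hx).
by rewrite (br_ev hx).
Qed.

(** A positive form is determined by its reproducing kernels, and by [Xc_Xc'_rep] those of the two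
    transported forms coincide. *)
Lemma bracket_eq f g : box 1 b f -> box 1 b g -> ip (xs f) (xs g) = ip (xs' f) (xs' g).
Proof.
move=> bf bg; pose l h := ip (xs' h) (xs' g).
have ll : linf ii l by move=> c u v; rewrite /l (br_lin hx') (ipDl hh) (ipZl hh).
have [x rx] := rep_exists (Xc_subsp a b) (fun f (h : Xc a b f) => h.1) (linf_ev ll).
have rx' : rep (Xc' a b) (fun f => l (ev f)) (xs' g).
  by split=> [|y Xy]; [exact: (br_in hx')|rewrite /l (br_K hx')].
have e := Xc_Xc'_rep ll rx rx'; rewrite (br_ev hx') // in e.
by rewrite -[RHS]/(l f) -(bracket_rep ll rx bf) e.
Qed.

(** Reversal is antiunitary and carries [Xc] to [Xc'], and these transport the same form. The factor
    z0^a acquired at z0 has modulus one. *)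
Lemma bracket_refl f g : box 1 b f -> box 1 b g ->
  ip (xs (refl 1 b f)) (xs (refl 1 b g)) = ip (xs g) (xs f).
Proof.
move=> bf bg; rewrite bracket_eq; [|exact: refl_box..].
have bxs h : box a.+1 b (xs h) by case: (br_in hx h).
have key h : box 1 b h -> refl a.+1 b (xs h) = xs' (ii (z0 ^+ a) * refl 1 b h).
  move=> bh; rewrite -[in RHS](br_ev hx bh) -(evz_refl (bxs h) z01) (br_K hx') //.
  split; first exact: refl_box.
  move=> u bu; have [a0|a0] := posnP a.
    have -> : u = 0; last by rewrite mulr0 (ip0r hh).
    by apply/polyP => s; apply/polyP => t; rewrite bu ?coef0 // a0.
  have -> : 'X * u = refl a.+1 b (refl a b u).
    apply: eval_inj => z w z1 w1; rewrite hornerM hornerM eval_X.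
    rewrite !refl_eval //; last by apply: boxS (@refl_box R a b u).
    rewrite !rmorphM /= conjCK !rmorphXn /= (conj_unit z1) (conj_unit w1).
    have za : z ^+ a.+1.-1 = z * z ^+ a.-1 by rewrite -exprS prednK.
    rewrite za !exprVn.
    field.
    by rewrite !expf_neq0 ?unit_neq0.
  rewrite (ti_refl hip) //; last exact: boxS (@refl_box R a b u).
  by rewrite (ip_eq0C hh) //; case: (br_in hx h) => _; apply; exact: refl_box.
have xs'Z c h : xs' (ii c * h) = ii c * xs' h := linZ c h (br_lin hx').
rewrite -(ti_refl hip (bxs f) (bxs g)) !key // !xs'Z (ipZl hh) (ipZr hh) mulrA mulC_unit ?mul1r //.
by rewrite normrX z01 expr1n.
Qed.

End Compare.
End Bracket.

(** * The kernel recurrence and its consequences: the transported form is Toeplitz and p is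
    stable *)

Section Star.
Variable R : realType.
Local Notation C := R[i].
Local Notation ii := ((polyC \o polyC)%FUN : {rmorphism C -> bipoly R}).
Implicit Types (f g h x y : bipoly R) (K W : set (bipoly R)).
Variable ip : bipoly R -> bipoly R -> C.
Hypothesis hip : toeplitz_ip ip.
Let hh := ti_herm hip.
Let hp K : posdef K ip. Proof. by move=> f _; exact: (ti_pos hip). Qed.

Variables (n m : nat) (K1 K2 : set (bipoly R)).
Hypothesis sp : split_pair ip n m K1 K2.
Let sK1 := sp_sub1 sp.
Let sK2 := sp_sub2 sp.
Let EK := sp_E sp.
Let K12 := sp_orth sp.
Let K1X2 := sp_orthX sp.
Let K1E := sp_E1 sp.
Let XK2E := sp_E2 sp.
Variable p : bipoly R.
Hypotheses (Ep : E ip n.+1 m p) (pp : ip p p = 1) (pK1 : forall k, K1 k -> ip p k = 0)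
  (pK2 : forall k, K2 k -> ip p ('X * k) = 0)
  (p_span : forall f, E ip n.+1 m f -> (forall k, K1 k -> ip f k = 0) ->
     (forall k, K2 k -> ip f ('X * k) = 0) -> f = ii (ip f p) * p).

Lemma K1box k : K1 k -> box n m.+1 k.
Proof. by move=> /(K1_sub sp)[]. Qed.
Lemma K2box k : K2 k -> box n m.+1 k.
Proof. by move=> /(K2_sub sp)[]. Qed.

Definition XK2 f := exists2 k, K2 k & f = 'X * k.
Lemma XK2_subsp : subsp ii XK2. Proof. exact: subsp_mul sK2. Qed.

Lemma E_span e : E ip n.+1 m e -> exists c, exists2 j1, K1 j1 & exists2 j2, K2 j2 &
  e = ii c * p + j1 + 'X * j2.
Proof.
move=> Ee; have [j1 K1j1 H1] := proj_exists hh e sK1 (fdimS K1box (box_fdim R n m.+1)) (hp (K := _)).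
have XB : XK2 `<=` box n.+1 m.+1 by move=> _ [k /XK2E[] h _ ->].
have [_ [j2 K2j2 ->] H2] := proj_exists hh e XK2_subsp (fdimS XB (box_fdim R n.+1 m.+1)) (hp (K := _)).
pose f := e - j1 - 'X * j2.
have Ef : E ip n.+1 m f.
  by apply: (subspB (E_subsp hip n.+1 m)); [apply: (subspB (E_subsp hip n.+1 m))|]; rewrite ?K1E // ?XK2E; auto.
exists (ip f p), j1 => //; exists j2 => //.
rewrite -(p_span Ef) => [|k Kk|k Kk]; first by rewrite /f addrAC subrK subrK.
  by rewrite /f (ipBl hh) H1 // (ip_eq0C hh (K1X2 Kk K2j2)) subrr.
by rewrite /f addrAC (ipBl hh) H2 ?K1X2 ?subrr //; exists k.
Qed.

Variable z0 : C.
Hypothesis z01 : `|z0| = 1.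
Local Notation ev := (evz z0).

(* The reproducing kernel of P_{n,m} is computed along P_{n,m} = Xc + P_{n-1,m} and
   along P_{n,m} = <p> + K1 + zK2 + wP_{n,m-1}; since |z0| = 1, the contributions of
   K1 and K2 cancel after evaluation at z0. *)
Lemma star l x y : linf ii l -> rep ip (Xc ip n m.+1) (fun f => l (ev f)) x ->
  rep ip (Xc ip n m) (fun f => l (ev ('Y * f))) y ->
  ev x = ii (l (ev p))^* * ev p + 'Y * ev y.
Proof.
move=> ll rx ry; have lb := linf_ev z0 ll.
have lbY : linf ii (fun f => l (ev ('Y * f))).
  by move=> c f g; rewrite mulrDr mulrCA lb.
have [r rr] := rep_exists hip (box_subsp R n m.+1) (fun f (h : box n m.+1 f) => h) lb.
have [rho rrho] := rep_exists hip (box_subsp R n m) (fun f (h : box n m f) => h) lbY.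
have [k1 [Kk1 H1]] := rep_exists hip sK1 K1box lb.
have [k2 [Kk2 H2]] := rep_exists hip sK2 K2box lb.
have rA := Xc_rep_add hip lb rx rr.
have [bA' HA'] := Xc_rep_add hip lbY ry rrho.
have [brho Hrho] := rrho.
have rB : rep ip (box n.+1 m.+1) (fun f => l (ev f))
    (ii (l (ev p))^* * p + k1 + ii z0^* * ('X * k2) + 'Y * (y + rho)).
  have sb := box_subsp R n.+1 m.+1; split.
    apply: (subspD sb); last exact: box_Y.
    apply: (subspD sb); last by apply: (subspZ _ sb); case: (XK2E Kk2).
    by apply: (subspD sb); [apply: (subspZ _ sb); case: Ep|case: (K1E Kk1)].
  move=> f /(box_decomp hip)[e Ee [g bg ->]].
  rewrite (linfD _ _ lb) HA' // (ipDl hh) [ip e (_ + 'Y * _)](ipDr hh) (Ee.2 _ bA') addr0.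
  have YB u : E ip n.+1 m u -> ip ('Y * g) u = 0 by move=> [_ Hu]; exact: (ip_eq0C hh (Hu g bg)).
  rewrite [ip ('Y * g) _](ipDr hh) (ti_Y hip); congr (_ + _); last first.
    by rewrite !(ipDr hh) !(ipZr hh) !YB ?mulr0 ?addr0 ?add0r //; [exact: XK2E|exact: K1E].
  have [c [j1 K1j1 [j2 K2j2 ->]]] := E_span Ee.
  rewrite !(linfD _ _ lb) (linfZ _ _ lb) evzX (linfZ _ _ ll) (H1 _ K1j1) (H2 _ K2j2).
  rewrite !(ipDl hh) (ipZl hh) !(ipDr hh) !(ipZr hh) pp (pK1 Kk1) (pK2 Kk2).
  rewrite (ip_eq0C hh (pK1 K1j1)) (ip_eq0C hh (pK2 K2j2)) (K1X2 K1j1 Kk2) (ip_eq0C hh (K1X2 Kk1 K2j2)).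
  by rewrite (ti_X hip) !conjCK; ring.
(* The kernel of P_{n-1,m} along K1 + K2 + wP_{n-1,m-1}. It involves the same [k1] and [k2] as the
   kernel of P_{n,m}, since the functional on zK2 is z0 times the one on K2. *)
have rr' : rep ip (box n m.+1) (fun f => l (ev f)) (k1 + k2 + 'Y * rho).
  have sb := box_subsp R n m.+1; split.
    apply: (subspD sb); last exact: box_Y.
    by apply: (subspD sb); [exact: K1box|exact: K2box].
  move=> f /(box_decomp hip)[e Ee [g bg ->]].
  have Ek1 := K1_sub sp Kk1; have Ek2 := K2_sub sp Kk2.
  rewrite (linfD _ _ lb) Hrho // (ipDl hh) [ip e (_ + 'Y * _)](ipDr hh) (Ee.2 _ brho) addr0.
  rewrite [ip ('Y * g) _](ipDr hh) (ti_Y hip) [ip ('Y * g) (_ + _)](ipDr hh).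
  rewrite (ip_eq0C hh (Ek1.2 _ bg)) (ip_eq0C hh (Ek2.2 _ bg)) addr0 add0r; congr (_ + _).
  have /EK[j1 K1j1 [j2 K2j2 ->]] := Ee.
  rewrite (linfD _ _ lb) (H1 _ K1j1) (H2 _ K2j2) (ipDl hh) !(ipDr hh) (K12 K1j1 Kk2) (ip_eq0C hh (K12 Kk1 K2j2)).
  by rewrite addr0 add0r.
have e1 := rep_uniq hip (box_subsp R n m.+1) rr rr'.
have := congr1 ev (rep_uniq hip (box_subsp R n.+1 m.+1) rA rB); rewrite e1.
have -> : ev (x + (k1 + k2 + 'Y * rho)) = ev x + (ev k1 + ev k2 + 'Y * ev rho).
  by rewrite !evzD evzY.
set c := (l (ev p))^*.
have -> : ev (ii c * p + k1 + ii z0^* * ('X * k2) + 'Y * (y + rho)) =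
    ii c * ev p + ev k1 + ev k2 + 'Y * (ev y + ev rho).
  rewrite evzD evzD evzD (evzZ z0 c p) (evzZ z0 z0^* ('X * k2)) evzX evzY evzD.
  have zc u : ii z0^* * ((z0%:P)%:P * u) = u.
    by have := congr1 ii (zz z01); rewrite rmorphM rmorph1 mulrA => ->; rewrite mul1r.
  by rewrite zc.
by move=> e; apply: (addIr (ev k1 + ev k2 + 'Y * ev rho)); rewrite e; ring.
Qed.

Local Notation q := (ev p).
Variables xs ys : bipoly R -> bipoly R.
Hypotheses (hx : bracket z0 (Xc ip n m.+1) m.+1 xs) (hy : bracket z0 (Xc ip n m) m ys).

Lemma xs_lin_ip h : linf ii (fun f => ip (xs f) (xs h)).
Proof. by move=> c f g; rewrite (br_lin hx) (ipDl hh) (ipZl hh). Qed.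

Lemma xs_herm : herm ii (fun f g => ip (xs f) (xs g)).
Proof. by split=> [h|f g]; [exact: xs_lin_ip|exact: (ipC hh)]. Qed.

(** The case of [star] where the functional is g -> g(0): it kills multiples of w, so only the term
    in p survives. Thus q is, for the transported form, the unit vector orthogonal to the multiples
    of w. *)
Lemma br_q g : box 1 m.+1 g -> ip (xs g) (xs q) * q`_0`_0 = g`_0`_0.
Proof.
move=> bg; have ll := @coef_lin R 0 0.
have [x rx] := rep_exists hip (Xc_subsp hip n m.+1) (fun f (h : Xc ip n m.+1 f) => h.1) (linf_ev z0 ll).
have ry : rep ip (Xc ip n m) (fun f => (ev ('Y * f))`_0`_0) 0.
  split; first by case: (Xc_subsp hip n m).
  by move=> f _; rewrite evzY coefYz (ip0r hh).
have e := star ll rx ry; rewrite evz0 mulr0 addr0 in e.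
rewrite -[RHS](bracket_rep hx ll rx bg) e (xsZ hx) (ipZr hh) conjCK.
by rewrite mulrC.
Qed.

Lemma q00_neq0 : q`_0`_0 != 0.
Proof.
have b1 : box 1 m.+1 (1 : bipoly R).
  by have := @mon_box R 1 m.+1 0 0 isT isT; rewrite !expr0 mulr1.
have := br_q b1; rewrite !coef1 /= => e; apply/eqP => q0; move/eqP: e.
by rewrite q0 mulr0 eq_sym oner_eq0.
Qed.

Lemma q_box : box 1 m.+1 q. Proof. by case: Ep => bp _; exact: (evz_box _ bp). Qed.

Lemma br_qq : ip (xs q) (xs q) = 1.
Proof. by apply: (mulIf q00_neq0); rewrite mul1r; apply: br_q; exact: q_box. Qed.

Lemma br_Yq g : box 1 m g -> ip (xs ('Y * g)) (xs q) = 0.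
Proof.
move=> bg; apply: (mulIf q00_neq0); rewrite mul0r br_q ?coefYz //; exact: box_Y.
Qed.

(** A functional given by pairing with a multiple of w vanishes at q, so the term in p drops out of
    [star] and the kernel of the form in degree m - 1 remains. *)
Lemma br_YY g h : box 1 m g -> box 1 m h -> ip (xs ('Y * h)) (xs ('Y * g)) = ip (ys h) (ys g).
Proof.
move=> bg bh; pose l f := ip (xs f) (xs ('Y * g)).
have ll : linf ii l := xs_lin_ip _.
have rx : rep ip (Xc ip n m.+1) (fun f => l (ev f)) (xs ('Y * g)).
  by split=> [|f Xf]; [exact: (br_in hx)|rewrite /l (br_K hx)].
have lY : linf ii (fun f => l ('Y * f)) by move=> c u v; rewrite mulrDr mulrCA ll.
have [y ry] := rep_exists hip (Xc_subsp hip n m) (fun f (h : Xc ip n m f) => h.1) (linf_ev z0 lY).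
have ry' : rep ip (Xc ip n m) (fun f => l (ev ('Y * f))) y.
  by case: ry => h1 h2; split=> // f Xf; rewrite evzY h2.
have := star ll rx ry'; rewrite (br_ev hx) ?box_Y //; last exact: box_Y.
rewrite {1}/l (ip_eq0C hh (br_Yq bg)) conjC0 rmorph0 mul0r add0r => /mulfI e.
have eg : ev y = g by rewrite e // polyC_eq0 polyX_eq0.
by have := bracket_rep hy lY ry bh; rewrite eg => ->.
Qed.

(** Reversal in degree m turns polynomials of degree below m into multiples of w. There [br_YY]
    passes to the form [ys] of degree m - 1, whose own reversal symmetry undoes the first reversal,
    and [br_YY] leads back. *)
Lemma br_toeplitz f g : box 1 m f -> box 1 m g -> ip (xs ('Y * f)) (xs ('Y * g)) = ip (xs f) (xs g).
Proof.
have [xs' hx'] := Xc'_bracket hip z01 n m.+1.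
have [ys' hy'] := Xc'_bracket hip z01 n m.
move=> bf bg; have bf1 := boxS (leqnn 1) (leqnSn m) bf; have bg1 := boxS (leqnn 1) (leqnSn m) bg.
rewrite -[RHS](bracket_refl hip z01 hx hx' bg1 bf1) !refl_Y //.
rewrite [RHS]br_YY; [|exact: refl_box..].
by rewrite (bracket_refl hip z01 hy hy' bg bf) br_YY.
Qed.

(* If p(z0, .) = (w - w0) g, then the transported norm satisfies
   |w0|^2 |g|^2 = |wg - p|^2 = |g|^2 + 1. *)
Lemma stable_at w0 : `|w0| <= 1 -> p.[z0, w0] != 0.
Proof.
move=> w01; apply/negP => rp.
have [g pg] : exists g : {poly C}, p.[z0%:P] = g * ('X - w0%:P) by apply/factor_theorem.
pose G : bipoly R := g%:P.
have qG : q = 'Y * G - ii w0 * G by rewrite /evz pg /G mulrBr polyCB !polyCM mulrC [_ * (w0%:P)%:P]mulrC.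
have szg : (size g <= m)%N.
  have [->|g0] := eqVneq g 0; first by rewrite size_poly0.
  have : (size (q`_0)%R <= m.+1)%N by exact: (box_size2 _ q_box).
  by rewrite /evz coefC /= pg size_Mmonic ?monicXsubC // size_XsubC addn2.
have bG : box 1 m G.
  move=> s l; rewrite coefC; case: s => [|s] /=; last by rewrite coef0.
  by rewrite -leqNgt => ml; rewrite nth_default // (leq_trans szg).
have wG : ii w0 * G = 'Y * G - q by rewrite qG opprB addrC subrK.
pose N u v := ip (xs u) (xs v); have hN : herm ii N := xs_herm.
have e1 : N ('Y * G - q) ('Y * G - q) = N G G + 1.
  rewrite (ipBl hN) !(ipBr hN) (ip_eq0C hN (br_Yq bG)) [N ('Y * G) q]br_Yq // [N q q]br_qq.
  by rewrite [N _ _]br_toeplitz // subr0 sub0r opprK.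
have e : N G G + 1 = `|w0| ^+ 2 * N G G by rewrite -e1 -wG (ipZl hN) (ipZr hN) mulrA -normCK.
rewrite /N in e.
have N0 : 0 <= ip (xs G) (xs G).
  have [->|h] := eqVneq (xs G) 0; first by rewrite (ip0l hh).
  by rewrite ltW // (ti_pos hip).
have : ip (xs G) (xs G) + 1 <= ip (xs G) (xs G) by rewrite e ler_piMl // exprn_ile1.
by rewrite gerDl ler10.
Qed.

Variable I : (C -> C -> C) -> C.
Hypothesis hI : torus_mean I.
Local Notation om := (invsq1 p.[z0%:P]).
Let stz w : `|w| <= 1 -> (p.[z0%:P]).[w] != 0. Proof. exact: stable_at. Qed.
Let hom := wip_toeplitz hI (adm_invsq1 stz) (invsq1_gt0 stz).

Lemma wip_q h : box 1 m.+1 h -> wip I om h q = h`_0`_0 / q`_0`_0.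
Proof.
move=> bh; have -> : h = (h`_0)%:P by apply/size1_polyC; exact: box_size bh.
by rewrite (wip_invsq1 hI stz) !horner_coef0 /evz !coefC.
Qed.

(** Both forms are Toeplitz in w and pair in the same way with q, which spans the complement of the
    multiples of w. [toeplitz_form_eq0] with Z = w applies to their difference; reversal supplies
    the complement of the polynomials of lower degree. *)
Lemma bracket_wip f g : box 1 m.+1 f -> box 1 m.+1 g -> ip (xs f) (xs g) = wip I om f g.
Proof.
have [xs' hx'] := Xc'_bracket hip z01 n m.+1.
pose D u v := ip (xs u) (xs v) - wip I om u v.
have hw := ti_herm hom.
have hD : herm ii D.
  split=> [v c u u'|u v].
    by rewrite /D (ipDl xs_herm) (ipZl xs_herm) (ipDl hw) (ipZl hw); ring.
  by rewrite /D (ipC xs_herm) (ipC hw) rmorphB.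
have Yq g' : box 1 m g' -> wip I om ('Y * g') q = 0.
  by move=> bg'; rewrite wip_q ?coefYz ?mul0r //; exact: box_Y.
have Dq h : box 1 m.+1 h -> D h q = 0.
  move=> bh; apply/eqP; rewrite subr_eq0 wip_q // -(br_q bh) mulfK ?q00_neq0 //.
have D' x h : box 1 m.+1 x -> (forall g', box 1 m g' -> wip I om x ('Y * g') = 0) ->
    box 1 m.+1 h -> D h x = 0.
  move=> bx x0 bh; pose c := x`_0`_0 / q`_0`_0.
  have bd : box 1 m.+1 (x - ii c * q).
    by apply: (subspB (box_subsp R 1 m.+1)) => //; apply: (subspZ _ (box_subsp R 1 m.+1)); exact: q_box.
  have [s|u bu eu] := divY bd.
    rewrite !coefB coefCz; case: s => [|s]; first by rewrite /c divfK ?q00_neq0 // subrr.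
    by rewrite bx // q_box // mulr0 subrr.
  have xq : x = ii c * q.
    apply/eqP; rewrite -subr_eq0; apply/eqP; apply: (ip_eq0 hom).
    rewrite {2}eu (ipBl hw) x0 // (ipZl hw) (ip_eq0C hw (Yq _ bu)) mulr0 subrr //.
  by rewrite xq (ipZr hD) Dq // mulr0.
have Drefl u v : box 1 m.+1 u -> box 1 m.+1 v -> D (refl 1 m.+1 u) (refl 1 m.+1 v) = D v u.
  by move=> bu bv; rewrite /D (bracket_refl hip z01 hx hx') // (ti_refl hom).
move=> bf bg; apply/eqP; rewrite -subr_eq0; apply/eqP.
move: f g bf bg; apply: (@toeplitz_form_eq0 _ _ ii _ _ _ (box 1 m) 'Y (wip I om) D
   (box_subsp R 1 m.+1) (box_subsp R 1 m) _ _ (box_fdim R 1 m.+1) hw _ hD).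
- by move=> f; exact: boxS.
- by move=> f; exact: box_Y.
- by move=> f _; exact: (ti_pos hom).
- by move=> f g _ _; exact: (ti_Y hom).
- by move=> f g bf bg; rewrite /D br_toeplitz // (ti_Y hom).
- move=> f Hf; apply/polyP => s; apply/polyP => l; rewrite !coef0.
  have := Hf m s (l + m)%N; rewrite -rmorphXn coefCM coefXnM [(l + m < m)%N]ltnNge leq_addl andbF /= addnK; exact.
- move=> x h bx x0 bh; rewrite -Drefl // (ip_eq0C hD) // D' ?refl_box //; [exact: refl_box| |exact: refl_box].
  move=> g' bg'; rewrite -(reflK bg') -refl_Y ?refl_box //; last exact: refl_box.
  rewrite (ti_refl hom) //; last exact: boxS (@refl_box R 1 m g').
  by rewrite (ip_eq0C hw) // x0 //; exact: refl_box.
- exact: D'.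
Qed.

End Star.

(** * The weights 1/t and 1/|p|^2 give the same form on P_{n,m} *)

Section Backward.
Variable R : realType.
Local Notation C := R[i].
Local Notation ii := ((polyC \o polyC)%FUN : {rmorphism C -> bipoly R}).
Implicit Types (f g h x y : bipoly R) (K W : set (bipoly R)).
Variable I : (C -> C -> C) -> C.
Hypothesis hI : torus_mean I.
Variable ot : C -> C -> C.
Hypotheses (aot : adm ot) (ot0 : forall z w, `|z| = 1 -> `|w| = 1 -> 0 < ot z w).
Local Notation ip := (wip I ot).
Let hip := wip_toeplitz hI aot ot0.
Let hh := ti_herm hip.

Variables (n m : nat) (p : bipoly R).
Hypotheses (stab : forall z w, `|z| = 1 -> `|w| <= 1 -> p.[z, w] != 0).
Local Notation op := (invsq p).

Local Notation pip := (wip I op).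
Let hpp := wip_toeplitz hI (adm_invsq stab) (invsq_gt0 stab).
Let ph := ti_herm hpp.

Hypothesis fiber : forall z0 x y, `|z0| = 1 -> Xc ip n m.+1 x -> Xc ip n m.+1 y ->
  wip I (invsq1 p.[z0%:P]) (evz z0 x) (evz z0 y) = ip x y.

(** By [fiber] the integral over w is z^(-k) times a constant, so only the mean of z^(-k) is
    left. *)
Lemma pip_Xc x y (k : nat) : Xc ip n m.+1 x -> Xc ip n m.+1 y ->
  pip x ('X ^+ k * y) = (k == 0%N)%:R * ip x y.
Proof.
move=> Xx Xy; rewrite /wip.
have aF : adm (fun z w => x.[z, w] * (y.[z, w])^* * op z w) := adm_wip (adm_invsq stab) x y.
rewrite (tm_fub hI (phi := fun z => ip x y * (z ^ (- k%:Z) * 1))).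
- have e := tm_Z hI (ip x y) (adm_mon R (- k%:Z) 0).
  have e0 := tm_mon hI (- k%:Z) 0; rewrite eqxx andbT oppr_eq0 in e0.
  apply: etrans (etrans _ e) _; last by rewrite e0 mulrC.
  by apply: (tm_ext hI) => z w _ _; rewrite expr0z.
- exact: (adm_wip (adm_invsq stab) x ('X ^+ k * y)).
- apply: adm_mul; [exact: adm_cst|apply: adm_mul; [exact: adm_expz_z|exact: adm_cst]].
- move=> z z1; rewrite -(fiber z1 Xx Xy).
  have az : adm (invsq1 p.[z%:P]) by apply: adm_invsq1 => w; exact: stab.
  have e := tm_Z hI (z ^ (- k%:Z)) (adm_wip az (evz z x) (evz z y)).
  apply: etrans (etrans _ e) _; last by rewrite mulr1 mulrC.
  apply: (tm_ext hI) => z' w _ w1; rewrite !evz_eval !hornerM !horner_exp eval_X rmorphM rmorphXn /= conj_unit //.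
  by rewrite exprVn exprnN /invsq /invsq1; ring.
Qed.

Section Compression.
Variable x : bipoly R.
Hypothesis Xx : Xc ip n m.+1 x.
Variable e : nat -> bipoly R.
Hypotheses (Xe : forall k, Xc ip n m.+1 (e k))
  (le : forall k j, (k < m.+1)%N -> (j < m.+1)%N -> (e k)`_n`_j = (j == k)%:R).

(* The compression of multiplication by z to P_{n-1,m}. *)
Definition cmp f := 'X * f - \sum_(k < m.+1) ii ('X * f)`_n`_k * e k.

Lemma cmp_Xc f : Xc ip n m.+1 ('X * f - cmp f).
Proof.
rewrite /cmp opprB addrC subrK; apply: (subsp_sum _ (Xc_subsp hip n m.+1)) => k _.
exact: (subspZ _ (Xc_subsp hip n m.+1)).
Qed.

Lemma cmp_box f : box n m.+1 f -> box n m.+1 (cmp f).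
Proof.
move=> bf; have b1 : box n.+1 m.+1 (cmp f).
  apply: (subspB (box_subsp R n.+1 m.+1)); first exact: box_X.
  apply: (subsp_sum _ (box_subsp R n.+1 m.+1)) => k _; apply: (subspZ _ (box_subsp R n.+1 m.+1)).
  by case: (Xe k).
move=> s l h; have [/andP[sn lm]|h'] := boolP ((s < n.+1) && (l < m.+1))%N; last exact: b1.
have es : s = n by apply/eqP; move: h; rewrite lm andbT -leqNgt eqn_leq => ->; rewrite -ltnS sn.
rewrite es /cmp !coefB (linf_sum _ _ _ (@coef_lin R n l)) /=.
under eq_bigr => k _ do rewrite coefCz le //.
rewrite (bigD1 (Ordinal lm)) //= eqxx mulr1 big1 ?addr0 ?subrr // => k kl.
by case: eqP => [ek|_]; [case/eqP: kl; apply/val_inj|rewrite mulr0].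
Qed.

Lemma cmp_lin c f g : cmp (ii c * f + g) = ii c * cmp f + cmp g.
Proof.
rewrite /cmp mulrDr mulrCA mulrBr mulr_sumr addrACA -opprD -big_split; congr (_ - _).
apply: eq_bigr => k _; rewrite !coefD coefCz /= !rmorphD !rmorphM mulrDl mulrA; ring.
Qed.

(** Pythagoras for zf: the compression is a contraction whose defect is the component of zf in
    [Xc]. *)
Lemma ip_cmp f : box n m.+1 f ->
  ip f f = ip ('X * f - cmp f) ('X * f - cmp f) + ip (cmp f) (cmp f).
Proof.
move=> bf; have h0 := (cmp_Xc f).2 _ (cmp_box bf).
have e1 := subrK (cmp f) ('X * f); set y := _ - _ in e1 h0 *.
rewrite -[LHS](ti_X hip) -e1.
rewrite (ipDl hh) [ip y (_ + _)](ipDr hh) h0 addr0.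
by rewrite [ip (cmp f) _](ipDr hh) (ip_eq0C hh h0) add0r.
Qed.

Definition gam (k : nat) f := pip f ('X ^+ k * x).

Lemma gam_lin k : linf ii (gam k). Proof. exact: ph.1. Qed.

(* zf and its compression differ by an element of Xc, orthogonal to z^(k+1) x. *)
Lemma gam_cmp k f : gam k f = gam k.+1 (cmp f).
Proof.
rewrite /gam -(ti_X hpp) mulrA -exprS -{1}(subrK (cmp f) ('X * f)) (ipDl ph).
by rewrite pip_Xc ?mul0r ?add0r //; exact: cmp_Xc.
Qed.

Local Notation act chi v := (appr ii chi (fun s => iter s cmp v) 0).

Lemma iter_box s v : box n m.+1 v -> box n m.+1 (iter s cmp v).
Proof. by move=> bv; elim: s => //= s IH; exact: cmp_box. Qed.

Lemma act_box chi v : box n m.+1 v -> box n m.+1 (act chi v).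
Proof.
move=> bv; apply: (subsp_sum _ (box_subsp R n m.+1)) => s _; apply: (subspZ _ (box_subsp R n m.+1)).
exact: iter_box.
Qed.

Lemma cmp0 : cmp 0 = 0.
Proof. exact: lin0 cmp_lin. Qed.
Lemma cmpD f g : cmp (f + g) = cmp f + cmp g.
Proof. by have := cmp_lin 1 f g; rewrite !mul1r. Qed.
Lemma cmpZ c f : cmp (ii c * f) = ii c * cmp f.
Proof. exact: linZ cmp_lin. Qed.

Lemma act_XsubC1 chi la v : act (chi * ('X - la%:P)) v = cmp (act chi v) - ii la * act chi v.
Proof.
rewrite appr_XsubC; congr (_ - _); rewrite /appr (big_morph cmp cmpD cmp0).
by apply: eq_bigr => s _; rewrite cmpZ.
Qed.

Lemma act_XsubC2 chi la v : act (chi * ('X - la%:P)) v = act chi (cmp v - ii la * v).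
Proof.
rewrite appr_XsubC /appr mulr_sumr -sumrB; apply: eq_bigr => s _.
rewrite [X in _ - X]mulrCA -mulrBr; congr (_ * _); rewrite !add0n add1n iterSr.
have itl u w : iter s cmp (u - ii la * w) = iter s cmp u - ii la * iter s cmp w.
  elim: (nat_of_ord s) => //= i ->; rewrite -mulNr -(rmorphN ii) cmpD cmpZ.
  by rewrite rmorphN mulNr.
by rewrite itl.
Qed.

(** The hypothesis and [gam_cmp] give gam_k(v) = la^N gam_(k+N)(v), where the last factor is bounded
    in N. *)
Lemma gam_eq0_eig la v : `|la| < 1 -> (forall k, gam k (cmp v - ii la * v) = 0) -> forall k, gam k v = 0.
Proof.
move=> la1 H k; have [B HB] := wip_Xn_bound hI (adm_invsq stab) v x.
have st j : gam j v = la * gam j.+1 v.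
  rewrite gam_cmp; have := H j.+1; rewrite (linfB _ _ (@gam_lin _)) (linfZ _ _ (@gam_lin _)) => /eqP.
  by rewrite subr_eq0 => /eqP.
have stN j N : gam j v = la ^+ N * gam (j + N)%N v.
  elim: N => [|N IH]; first by rewrite addn0 mul1r.
  by rewrite IH st exprSr -mulrA addnS.
apply: (@geometric_eq0 _ la _ B la1) => N.
rewrite (stN k N) normrM normrX; apply: ler_wpM2l; [by rewrite exprn_ge0|exact: HB].
Qed.

(** An eigenvalue of modulus at least 1 leaves no defect in [ip_cmp], so zu equals its compression
    and (z - la)u = 0. *)
Lemma cmp_eig la u : box n m.+1 u -> 1 <= `|la| -> cmp u = ii la * u -> u = 0.
Proof.
move=> bu la1 e1; have := ip_cmp bu.
set y := _ - _ => e2.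
have u0 : 0 <= ip u u by have [->|h] := eqVneq u 0; [rewrite (ip0l hh)|rewrite ltW // (ti_pos hip)].
have ec : ip (cmp u) (cmp u) = `|la| ^+ 2 * ip u u by rewrite e1 (ipZl hh) (ipZr hh) mulrA -normCK.
have y0 : y = 0.
  apply/eqP; apply: contraT => /(ti_pos hip) yp.
  suff : ip u u < ip u u by rewrite ltxx.
  rewrite {2}e2 ec -[X in X < _]add0r ltr_leD // ler_peMl //.
  by rewrite expr_ge1.
have : ('X - (la%:P)%:P) * u = 0 by rewrite mulrBl -y0 /y e1.
by move/eqP; rewrite mulf_eq0 polyXsubC_eq0 => /eqP.
Qed.

(** The linear factors of [chi] are stripped one at a time: a root outside the open disc is not an
    eigenvalue of the compression, a root inside is handled by [gam_eq0_eig]. No normal form of the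
    compression is needed. *)
Lemma act_eq0_gam chi v : box n m.+1 v -> chi != 0 -> act chi v = 0 -> forall k, gam k v = 0.
Proof.
have [N] := ubnP (size chi); elim: N chi v => // N IH chi v szN bv chi0.
have [szc|szc] := eqVneq (size chi) 1%N.
  have [c c0 ->] : exists2 c, c != 0 & chi = c%:P.
    by move/eqP: szc => /size_poly1P.
  rewrite /appr size_polyC c0 big_ord1 coefC /= => /eqP.
  rewrite mulf_eq0 !polyC_eq0 (negPf c0) => /eqP -> k; exact: (linf0 (@gam_lin k)).
have /closed_rootP[la /factor_theorem[chi' ec]] := szc.
have chi'0 : chi' != 0 by apply: contra_neq chi0 => h; rewrite ec h mul0r.
have sz' : (size chi' < N)%N.
  by move: szN; rewrite ec size_Mmonic ?monicXsubC // size_XsubC addn2 ltnS.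
have [la1|la1] := real_leP (real1 C) (normr_real la).
  rewrite ec act_XsubC1 => /eqP; rewrite subr_eq0 => /eqP /cmp_eig h.
  by apply: (IH chi') => //; apply: h => //; exact: act_box.
rewrite ec act_XsubC2 => /IH h; apply: (gam_eq0_eig la1); apply: h => //.
apply: (subspB (box_subsp R n m.+1)); first exact: cmp_box.
exact: (subspZ _ (box_subsp R n m.+1)).
Qed.

Lemma gam_eq0 v : box n m.+1 v -> gam 0 v = 0.
Proof.
move=> bv; have [fl inj] := box_fdim R n m.+1.
(* The iterates of [v] under the compression stay in a space of dimension [n * m.+1], so a nonzero
   polynomial in the compression annihilates [v]. *)
have [c [j0 j0n cj0] Hc] := @more_unknowns _ _ ii (n * m.+1) (bcoef m.+1) (fun s => iter s cmp v) fl.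
pose chi := \poly_(j < (n * m.+1).+1) c j.
apply: (@act_eq0_gam chi v bv).
  apply: contra_neq cj0 => /(congr1 (fun q : {poly C} => q`_j0)).
  by rewrite coef_poly ltnS j0n coef0.
rewrite (@apprE _ _ _ _ _ _ (n * m.+1).+1) ?size_poly //.
rewrite (eq_bigr (fun j : 'I_(n * m.+1).+1 => ii (c j) * iter j cmp v)); last first.
  by move=> j _; rewrite coef_poly ltn_ord.
apply: inj => //; apply: (subsp_sum _ (box_subsp R n m.+1)) => s _.
by apply: (subspZ _ (box_subsp R n m.+1)); exact: iter_box.
Qed.

End Compression.

Lemma pip_box_Xc f x : box n m.+1 f -> Xc ip n m.+1 x -> pip f x = 0.
Proof.
move=> bf Xx; have /choice[e He] : forall k, exists x, Xc ip n m.+1 x /\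
   ((k < m.+1)%N -> exists2 g, box n m.+1 g & 'X ^+ n * 'Y ^+ k = x + g).
  move=> k; case: (ltnP k m.+1) => kb; last by exists 0; split=> //; case: (Xc_subsp hip n m.+1).
  by have [u Xu Hu] := Xc_decomp hip (mon_box R (ltnSn n) kb); exists u.
have := @gam_eq0 x Xx e _ _ f bf; rewrite /gam mul1r; apply; first by move=> k; case: (He k).
move=> k j km jm; have [_ /(_ km)[g bg eg]] := He k.
have := mon_coef R n k n j; rewrite eqxx /= => <-.
by rewrite eg !coefD bg ?addr0 // ltnn.
Qed.

(** [toeplitz_form_eq0] with Z = z, applied to the difference of the forms: they agree on [Xc],
    which both make orthogonal to P_{n-1,m}. Reversal gives the complement of zP_{n-1,m}. *)
Lemma pip_eq f g : box n.+1 m.+1 f -> box n.+1 m.+1 g -> pip f g = ip f g.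
Proof.
pose D u v := ip u v - pip u v.
have hD : herm ii D.
  split=> [v c u u'|u v].
    by rewrite /D (ipDl hh) (ipZl hh) (ipDl ph) (ipZl ph); ring.
  by rewrite /D (ipC hh) (ipC ph) rmorphB.
have DX x h : box n.+1 m.+1 x -> (forall g', box n m.+1 g' -> ip x g' = 0) -> box n.+1 m.+1 h -> D h x = 0.
  move=> bx x0 /(Xc_decomp hip)[y Xy [g' bg' ->]].
  have Xx : Xc ip n m.+1 x by [].
  rewrite /D (ipDl hh) (ipDl ph) (ip_eq0C hh (x0 _ bg')) (pip_box_Xc bg' Xx) !addr0.
  by have := pip_Xc 0 Xy Xx; rewrite !mul1r => ->; rewrite subrr.
have Drefl u v : box n.+1 m.+1 u -> box n.+1 m.+1 v -> D (refl n.+1 m.+1 u) (refl n.+1 m.+1 v) = D v u.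
  by move=> bu bv; rewrite /D (ti_refl hip) // (ti_refl hpp).
move=> bf bg; apply/esym/eqP; rewrite -subr_eq0; apply/eqP.
move: f g bf bg; apply: (@toeplitz_form_eq0 _ _ ii _ _ _ (box n m.+1) 'X ip D
   (box_subsp R n.+1 m.+1) (box_subsp R n m.+1) _ _ (box_fdim R n.+1 m.+1) hh _ hD).
- by move=> f; exact: boxS.
- by move=> f; exact: box_X.
- by move=> f _; exact: (ti_pos hip).
- by move=> f g _ _; exact: (ti_X hip).
- by move=> f g _ _; rewrite /D (ti_X hip) (ti_X hpp).
- move=> f Hf; apply/polyP => s; apply/polyP => l; rewrite !coef0.
  by have := Hf n (s + n)%N l; rewrite coefXnM [(s + n < n)%N]ltnNge leq_addl /= addnK; exact.
- exact: DX.
- move=> x h bx x0 bh; rewrite -Drefl // (ip_eq0C hD) // DX ?refl_box //; [exact: refl_box| |exact: refl_box].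
  move=> g' bg'.
  have Xr := esym (refl_X bg').
  have bg1 : box n.+1 m.+1 g' by exact: boxS bg'.
  have := x0 _ (@refl_box R n m.+1 g'); rewrite Xr => h0.
  have : ip (refl n.+1 m.+1 x) (refl n.+1 m.+1 (refl n.+1 m.+1 g')) = ip (refl n.+1 m.+1 g') x.
    by rewrite (ti_refl hip) //; exact: refl_box.
  by rewrite reflK // => ->; rewrite (ip_eq0C hh h0).
Qed.

(** Agreement on P_{n,m} means that d = 1/t - 1/|p|^2 integrates to zero against trigonometric
    polynomials of degree at most (n, m), such as t and |p|^2. The integrand (|p|^2 - t)d is the
    nonnegative function (|p|^2 - t)^2/(t|p|^2). *)
Lemma square_modulus_eq (t : laurent R n m) :
  (forall z w, `|z| = 1 -> `|w| = 1 -> ot z w = (leval t z w)^-1) -> box n.+1 m.+1 p ->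
  forall z w, `|z| = 1 -> `|w| = 1 -> leval t z w = `|p.[z, w]| ^+ 2.
Proof.
move=> ott bp.
pose d z w := ot z w - op z w.
have ad : adm d.
  apply: (@adm_ext _ (fun z w => ot z w + (- 1) * op z w)) => [z w _ _|]; first by rewrite mulN1r.
  by apply: adm_add => //; apply: adm_mul; [exact: adm_cst|exact: (adm_invsq stab)].
have aFd (F : C -> C -> C) : adm F -> adm (fun z w => F z w * d z w) by move=> aF; exact: adm_mul.
have dmon (s l s' l' : nat) : (s < n.+1)%N -> (l < m.+1)%N -> (s' < n.+1)%N -> (l' < m.+1)%N ->
    I (fun z w => z ^ (s%:Z - s'%:Z) * w ^ (l%:Z - l'%:Z) * d z w) = 0.
  move=> hs hl hs' hl'; have := pip_eq (mon_box R hs hl) (mon_box R hs' hl') => /esym/eqP.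
  rewrite -subr_eq0 /wip -(tm_B hI); [|exact: adm_wip aot _ _|exact: adm_wip (adm_invsq stab) _ _].
  move/eqP => <-; apply: (tm_ext hI) => z w z1 w1.
  rewrite !hornerM !horner_exp eval_X eval_Y rmorphM !rmorphXn /= !conj_unit // !exprVn !exprnN.
  by rewrite !expfzDr ?unit_neq0 // -!exprnP /d; ring.
have dt : I (fun z w => leval t z w * d z w) = 0.
  have at_ (a : 'I_n.*2.+1) (b : 'I_m.*2.+1) : adm (fun z w => t a b * (z ^ (a%:Z - n%:Z) * w ^ (b%:Z - m%:Z) * d z w)).
    by apply: adm_mul; [exact: adm_cst|apply: aFd; exact: adm_mon].
  transitivity (I (fun z w => \sum_a \sum_b t a b * (z ^ (a%:Z - n%:Z) * w ^ (b%:Z - m%:Z) * d z w))).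
    apply: (tm_ext hI) => z w _ _; rewrite /leval mulr_suml; apply: eq_bigr => a _.
    by rewrite mulr_suml; apply: eq_bigr => b _; ring.
  rewrite (tm_sum hI) => [|a]; last by apply: adm_sum => b; exact: at_.
  rewrite big1 // => a _; rewrite (tm_sum hI) => [|b]; last exact: at_.
  rewrite big1 // => b _; rewrite (tm_Z hI); last by apply: aFd; exact: adm_mon.
  (* Subtraction is truncated: one of the two exponents is 0 and the other is the absolute value of
     the difference. *)
  have [s [s' [hs hs' ->]]] : exists s s' : nat, [/\ (s < n.+1)%N, (s' < n.+1)%N & a%:Z - n%:Z = s%:Z - s'%:Z].
    by have := ltn_ord a; exists (a - n)%N, (n - a)%N; split; lia.
  have [l [l' [hl hl' ->]]] : exists l l' : nat, [/\ (l < m.+1)%N, (l' < m.+1)%N & b%:Z - m%:Z = l%:Z - l'%:Z].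
    by have := ltn_ord b; exists (b - m)%N, (m - b)%N; split; lia.
  by rewrite dmon // mulr0.
have dp : I (fun z w => p.[z, w] * (p.[z, w])^* * d z w) = 0.
  have := pip_eq bp bp => /esym/eqP.
  rewrite -subr_eq0 /wip -(tm_B hI); [|exact: adm_wip aot _ _|exact: adm_wip (adm_invsq stab) _ _].
  by move/eqP => <-; apply: (tm_ext hI) => z w _ _; rewrite /d mulrBr.
have app : adm (fun z w => p.[z, w] * (p.[z, w])^* ) by apply: adm_mul; [|apply: adm_conj]; exact: adm_eval.
have alt := adm_leval t.
pose G z w := p.[z, w] * (p.[z, w])^* * d z w - leval t z w * d z w.
have aG : adm G.
  apply: (@adm_ext _ (fun z w => p.[z, w] * (p.[z, w])^* * d z w + (-1) * (leval t z w * d z w))) => [z w _ _|].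
    by rewrite mulN1r.
  by apply: adm_add; [exact: aFd|apply: adm_mul; [exact: adm_cst|exact: aFd]].
have IG : I G = 0 by rewrite /G (tm_B hI) ?dt ?dp ?subrr //; exact: aFd.
have GE z w : `|z| = 1 -> `|w| = 1 -> G z w = (`|p.[z, w]| ^+ 2 - leval t z w) ^+ 2 * (ot z w * op z w).
  move=> z1 w1; have tp := ot0 z1 w1; have pp := invsq_gt0 stab z1 w1.
  rewrite /G /d -normCK; have -> : leval t z w = (ot z w)^-1 by rewrite ott ?invrK.
  have -> : `|p.[z, w]| ^+ 2 = (op z w)^-1 by rewrite /invsq invrK.
  by field; rewrite !gt_eqF.
move=> z w z1 w1.
have H0 : forall u v, `|u| = 1 -> `|v| = 1 -> 0 <= G u v.
  move=> u v u1 v1; rewrite GE //; apply: mulr_ge0; last by rewrite ltW // mulr_gt0 ?ot0 ?(invsq_gt0 stab).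
  have rt : leval t u v \is Num.real.
    by rewrite -[leval t u v]invrK -ott // realV gtr0_real // ot0.
  by apply: real_exprn_even_ge0 => //; rewrite realB // realX // normr_real.
have /eqP := tm_eq0 hI aG H0 IG z1 w1; rewrite GE //.
rewrite mulf_eq0 (gt_eqF (mulr_gt0 (ot0 z1 w1) (invsq_gt0 stab z1 w1))) orbF expf_eq0 /= subr_eq0.
by move/eqP.
Qed.

End Backward.

(** * Admissible functions are bounded on the torus *)

Section AdmBound.
Variable R : realType.
Local Notation C := R[i].

Lemma normc_le_ReIm (x : C) : `|x| <= (`|complex.Re x| + `|complex.Im x|)%:C.
Proof.
rewrite {1}[x]complexE (le_trans (ler_normD _ _)) // rmorphD lerD //.
  by rewrite normc_def /= expr0n addr0 sqrtr_sqr.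
by rewrite normrM !normc_def /= !expr0n /= expr1n add0r addr0 sqrtr1 mul1r sqrtr_sqr.
Qed.

Lemma adm_bound (F : C -> C -> C) : adm F -> exists2 B : C, 0 < B & forall z w, `|z| = 1 -> `|w| = 1 -> `|F z w| <= B.
Proof.
move=> [F1 F2]; pose D : set (R * R) := `[0, 2 * pi] `*` `[0, 2 * pi].
have cD : compact D by apply: compact_setX; exact: segment_compact.
have bd (f : R * R -> R) : continuous f -> exists M, forall x, D x -> `|f x| <= M.
  move=> cf; have [|M [_ HM]] := @compact_bounded R R^o (f @` D) _.
    by apply: (@continuous_compact _ R^o) => //; apply: continuous_subspaceT.
  by exists (M + 1) => x Dx; apply: (HM (M + 1)); [rewrite ltrDl|exists x].
have [M1 H1] := bd _ F1; have [M2 H2] := bd _ F2.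
have D0 : D (0, 0) by split; rewrite /= in_itv /= lexx mulr_ge0 ?pi_ge0.
exists (M1 + M2 + 1)%:C.
  rewrite -[0]/(0%:C) ltcR; have := le_trans (normr_ge0 _) (H1 _ D0); have := le_trans (normr_ge0 _) (H2 _ D0); lra.
move=> z w /cis_surj[x xi ->] /cis_surj[y yi ->].
have Dxy : D (x, y) by split; rewrite /= in_itv.
apply: (le_trans (normc_le_ReIm _)); rewrite lecR.
by have := H1 _ Dxy; have := H2 _ Dxy; rewrite /pull /=; lra.
Qed.

End AdmBound.

(** * The basis dual to the powers of w for 1/|p(z, .)|^2, in polynomial dependence on z *)

Section DualBasis.
Variable R : realType.
Local Notation C := R[i].
Local Notation ii := ((polyC \o polyC)%FUN : {rmorphism C -> bipoly R}).
Implicit Types (f g h x y : bipoly R).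

Variables (n m : nat) (p : bipoly R).
Hypothesis bp : box n.+1 m.+1 p.

Definition liftz (a : {poly C}) : bipoly R := map_poly polyC a.

Lemma liftz_eval a z w : (liftz a).[z, w] = a.[z].
Proof. by rewrite /liftz horner_map hornerC. Qed.

Lemma evz_liftz z a f : evz z (liftz a * f) = ii a.[z] * evz z f.
Proof. by rewrite /evz hornerM /liftz horner_map /= rmorphM. Qed.

(** The coefficient of w^l in p; on the circle [q l] below is z^n times its conjugate. *)
Let c l : {poly C} := (swapXY p)`_l.
Let rp := refl n.+1 m.+1 p.
Let q l : {poly C} := if (l <= m)%N then (swapXY rp)`_(m - l) else 0.

(* [gam_s k] is [Gam k] with the variables exchanged; [Gam k] is the solution of the
   recurrence [Gam_rec], built from the coefficients c of p and q of its reverse. *)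
Definition gam_s k : bipoly R := \sum_(j < k.+1) 'X ^+ j * ((q (k - j))%:P * swapXY p - (c (m - (k - j)))%:P * swapXY rp).
Definition Gam k : bipoly R := swapXY (gam_s k).

Lemma c_gt l : (m < l)%N -> c l = 0.
Proof. by move=> ml; apply/polyP => s; rewrite coef_swapXY bp ?coef0 // negb_and -!leqNgt ml orbT. Qed.

Lemma swap_rp l : (swapXY rp)`_l = if (l <= m)%N then q (m - l) else 0.
Proof.
case: leqP => lm; first by rewrite /q leq_subr subKn.
by apply/polyP => s; rewrite coef_swapXY (@refl_box R n.+1 m.+1 p) ?coef0 // negb_and -!leqNgt lm orbT.
Qed.

Lemma sz_c l : (size (c l) <= n.+1)%N.
Proof. by apply/leq_sizeP => s ns; rewrite coef_swapXY bp // negb_and -!leqNgt ns. Qed.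

Lemma sz_q l : (size (q l) <= n.+1)%N.
Proof.
rewrite /q; case: ifP => _; last by rewrite size_poly0.
by apply/leq_sizeP => s ns; rewrite coef_swapXY (@refl_box R n.+1 m.+1 p) // negb_and -!leqNgt ns.
Qed.

Let T i l := q i * c l - (if (l <= m)%N then c (m - i) * q (m - l) else 0).

Lemma gam_s_coef k l : (gam_s k)`_l = \sum_(j < k.+1) if (l < j)%N then 0 else T (k - j) (l - j).
Proof.
rewrite /gam_s coef_sum; apply: eq_bigr => j _; rewrite coefXnM; case: ltnP => // jl.
by rewrite coefB !coefCM swap_rp /T; case: ifP => // _; rewrite mulr0.
Qed.

(* T (i, l) is antisymmetric under (i, l) -> (m - l, m - i). *)
Lemma gam_s_coef0 k l : (k < m)%N -> (m <= l)%N -> (gam_s k)`_l = 0.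
Proof.
move=> km ml; rewrite gam_s_coef.
have [kd|dk] := ltnP k (l - m).
  rewrite big1 // => j _; have jk := ltn_ord j; case: ltnP => // jl.
  rewrite /T (c_gt (l := l - j)); last by lia.
  by rewrite ifF ?mulr0 ?subrr //; apply/negbTE; rewrite -ltnNge; lia.
pose d := (l - m)%N; pose K := (k - d)%N.
(* Terms with l - j > m vanish. In the remaining sum of T(K - i, m - i) the antisymmetry exchanges i
   and K - i, so the sum is its own negative. *)
have -> : \sum_(j < k.+1) (if (l < j)%N then 0 else T (k - j) (l - j)) = \sum_(i < K.+1) T (K - i) (m - i).
  rewrite -(big_mkord xpredT (fun j => if (l < j)%N then 0 else T (k - j) (l - j))).
  rewrite (@big_cat_nat _ _ _ d) //=; last by rewrite /d; lia.
  rewrite big_nat big1 ?add0r => [|j /andP[_ jd]]; last first.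
    rewrite ifF; last by apply/negbTE; rewrite -leqNgt /d in jd *; lia.
    rewrite /T (c_gt (l := l - j)); last by rewrite /d in jd; lia.
    by rewrite ifF ?mulr0 ?subrr //; apply/negbTE; rewrite -ltnNge /d in jd *; lia.
  rewrite -[d]add0n big_addn (_ : (k.+1 - d = K.+1)%N); last by rewrite /K /d; lia.
  rewrite big_mkord; apply: eq_bigr => i _; have := ltn_ord i => iK.
  rewrite ifF; last by apply/negbTE; rewrite -leqNgt /K /d in iK *; lia.
  by congr T; rewrite /K /d in iK *; lia.
set S := \sum_(i < _) _; suff : S + S = 0.
  by move/eqP; rewrite -mulr2n -scaler_nat scaler_eq0 pnatr_eq0 => /eqP.
rewrite {2}/S (reindex_inj rev_ord_inj) /= -big_split big1 // => i _ /=.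
have iK := ltn_ord i; have Km : (K < m)%N by rewrite /K; lia.
have -> : (K - (K.+1 - i.+1) = i)%N by lia.
have -> : (m - (K.+1 - i.+1) = m - K + i)%N by lia.
rewrite /T !ifT; [|by lia..].
have -> : (m - (m - K + i) = K - i)%N by lia.
have -> : (m - (m - i) = i)%N by lia.
have -> : (m - (K - i) = m - K + i)%N by lia.
by rewrite mulrC [c _ * q _ in X in _ - X + _]mulrC; ring.
Qed.

(** The degree 2n in z is what matters: z^(j-n) times [Gam k] has degree at most j + n, whence the
    shift by n in the growth estimate of [one_sided]. *)
Lemma Gam_box k : (k < m)%N -> box (n + n).+1 m (Gam k).
Proof.
move=> km s l; rewrite negb_and -!leqNgt /Gam coef_swapXY => /orP[h|h]; last first.
  by rewrite gam_s_coef0 ?coef0.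
rewrite gam_s_coef coef_sum big1 // => j _; case: ifP => _; rewrite ?coef0 //.
have szM (u v : {poly C}) : (size u <= n.+1)%N -> (size v <= n.+1)%N -> (u * v)`_s = 0.
  move=> su sv; rewrite nth_default //; apply: leq_trans h; apply: (leq_trans (size_polyMleq _ _)).
  by have := leq_add su sv; lia.
by rewrite /T coefB szM ?sz_q ?sz_c //; case: ifP => _; rewrite ?coef0 ?szM ?sz_q ?sz_c ?subrr.
Qed.

Lemma Gam_rec k z : evz z (Gam k) = (if k is k'.+1 then 'Y * evz z (Gam k') else 0) +
  ii (q k).[z] * evz z p - ii (c (m - k)).[z] * evz z rp.
Proof.
have E0 j : swapXY ((q j)%:P * swapXY p - (c (m - j))%:P * swapXY rp) = liftz (q j) * p - liftz (c (m - j)) * rp.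
  by rewrite rmorphB !rmorphM /= !swapXYK !swapXY_polyC.
rewrite -addrA; transitivity ((if k is k'.+1 then 'Y * evz z (Gam k') else 0) + evz z (liftz (q k) * p - liftz (c (m - k)) * rp)); last first.
  by rewrite evzB !evz_liftz.
rewrite /Gam /gam_s big_ord_recl expr0 mul1r subn0 rmorphD /= E0 evzD addrC; congr (_ + _).
case: k => [|k]; first by rewrite big_ord0 rmorph0 evz0.
rewrite -evzY; congr evz; rewrite -swapXY_X -rmorphM; congr swapXY.
rewrite mulr_sumr; apply: eq_bigr => j _.
by rewrite /bump /= add1n exprS mulrA subSS.
Qed.

Variable I : (C -> C -> C) -> C.
Hypothesis hI : torus_mean I.
Hypothesis stab : forall z w, `|z| = 1 -> `|w| <= 1 -> p.[z, w] != 0.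

Lemma evz_coef z f l : (evz z f)`_0`_l = ((swapXY f)`_l).[z].
Proof.
rewrite /evz coefC /= horner_coef coef_sum.
have sz : (size ((swapXY f)`_l)%R <= size f)%N.
  by apply/leq_sizeP => s sf; rewrite coef_swapXY [f`_s]nth_default ?coef0.
rewrite (horner_coef_wide _ sz); apply: eq_bigr => s _.
by rewrite -rmorphXn coefMC coef_swapXY.
Qed.

Lemma conj_q k z : `|z| = 1 -> (k <= m)%N -> ((q k).[z])^* = z ^ (- n%:Z) * (c k).[z].
Proof.
move=> z1 km; rewrite /q km -evz_coef evz_refl // coefCM coefCM.
have bq : box 1 m.+1 (evz z p) := evz_box _ bp.
rewrite coef_poly /= coef_poly ltnS leq_subr subKn // evz_coef rmorphM /= conjCK rmorphXn /= conj_unit //.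
by rewrite exprVn exprnN.
Qed.

Lemma divY1 b (u : bipoly R) : box 1 b.+1 u -> u`_0`_0 = 0 ->
  exists2 v, box 1 b v & u = 'Y * v /\ forall k, v`_0`_k = u`_0`_k.+1.
Proof.
move=> bu u0; have [|v bv uv] := @divY R 1 b u bu.
  by case=> [//|s]; rewrite bu.
by exists v => //; split=> // k; rewrite uv coefYz.
Qed.

(** Induction along [Gam_rec]. The reverse of p is orthogonal to degrees below m, p itself reads off
    g(0) up to a factor, and g minus a multiple of p is divisible by w, which lowers the index by
    one; the term in [q k] compensates for that multiple of p. *)
Lemma Gam_dual z k g : `|z| = 1 -> (k < m)%N -> box 1 m g ->
  wip I (invsq1 p.[z%:P]) g (evz z (Gam k)) = z ^ (- n%:Z) * g`_0`_k.
Proof.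
move=> z1; have str w : `|w| <= 1 -> (p.[z%:P]).[w] != 0 by exact: stab.
have ht := wip_toeplitz hI (adm_invsq1 str) (invsq1_gt0 str); have hh := ti_herm ht.
have bq : box 1 m.+1 (evz z p) := evz_box _ bp.
have q00 : (evz z p)`_0`_0 != 0.
  by rewrite /evz coefC /= -horner_coef0 str // normr0 ler01.
have wq h b : box 1 b h -> wip I (invsq1 p.[z%:P]) h (evz z p) = h`_0`_0 / (evz z p)`_0`_0.
  move=> bh; have -> : h = (h.[0%:P])%:P by rewrite -[LHS](evz_id 0 bh).
  by rewrite (wip_invsq1 hI str) /evz !coefC /= -!horner_coef0.
have Yq h b : box 1 b h -> wip I (invsq1 p.[z%:P]) ('Y * h) (evz z p) = 0.
  by move=> bh; rewrite (wq _ b.+1) ?coefYz ?mul0r //; exact: box_Y.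
have rq h : box 1 m h -> wip I (invsq1 p.[z%:P]) h (evz z rp) = 0.
  move=> bh; rewrite evz_refl // (ipZr hh).
  have bh1 : box 1 m.+1 h by exact: boxS bh.
  rewrite -(reflK bh1) (ti_refl ht) //; last exact: refl_box.
  by rewrite refl_Y // (ip_eq0C hh) ?mulr0 //; apply: (Yq _ m); exact: refl_box.
elim: k g => [|k IH] g km bg.
  rewrite Gam_rec add0r (ipBr hh) !(ipZr hh) rq // mulr0 subr0 (wq _ m) // conj_q //.
  by rewrite evz_coef in q00 *; rewrite -mulrA [_ * (_ / _)]mulrC divfK.
rewrite Gam_rec (ipBr hh) (ipDr hh) !(ipZr hh) rq // mulr0 subr0 (wq _ m) // conj_q //; last exact: ltnW.
pose ga := g`_0`_0 / (evz z p)`_0`_0.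
have bd : box 1 m.+1 (g - ii ga * evz z p).
  apply: (subspB (box_subsp R 1 m.+1)); first exact: boxS bg.
  exact: (subspZ _ (box_subsp R 1 m.+1)).
have [|v bv [gv vE]] := divY1 bd.
  by rewrite !coefB coefCz /ga divfK // subrr.
have {1}-> : g = ii ga * evz z p + 'Y * v by rewrite -gv addrC subrK.
rewrite (ipDl hh) (ipZl hh) (ti_Y ht) IH //; last exact: ltnW.
have bG : box 1 m (evz z (Gam k)) by apply: evz_box; apply: Gam_box; exact: ltnW.
rewrite (ip_eq0C hh (Yq _ m bG)) mulr0 add0r vE !coefB coefCz -/ga.
by rewrite [(evz z p)`_0`_k.+1]evz_coef -/(c k.+1); ring.
Qed.

End DualBasis.

(** * Propagation of one-sided orthogonality *)

Section OneSided.
Variable R : realType.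
Local Notation C := R[i].
Local Notation ii := ((polyC \o polyC)%FUN : {rmorphism C -> bipoly R}).
Implicit Types (f g h x y : bipoly R).
Variables (n m : nat) (p : bipoly R).
Hypothesis bp : box n.+1 m.+1 p.
Variable I : (C -> C -> C) -> C.
Hypothesis hI : torus_mean I.
Hypothesis stab : forall z w, `|z| = 1 -> `|w| <= 1 -> p.[z, w] != 0.

Local Notation ip := (wip I (invsq p)).
Local Notation om := (invsq p).
Let hip := wip_toeplitz hI (adm_invsq stab) (invsq_gt0 stab).
Let hh := ti_herm hip.

Lemma adm_z_horner_div (j : int) (a b : {poly C}) : (forall z, `|z| = 1 -> b.[z] != 0) ->
  adm (fun z _ : C => z ^ j * (a.[z] / b.[z])).
Proof.
move=> b0; apply: adm_mul; first exact: adm_expz_z.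
by apply: adm_swap; apply: adm1_mul; [exact: adm1_horner|apply: adm1_inv => //; exact: adm1_horner].
Qed.

Definition lo f : {poly C} := (swapXY f)`_0.

Lemma lo_eval f z : (lo f).[z] = f.[z, 0].
Proof. by rewrite -horner2_swapXY /lo polyC0 horner_coef0. Qed.

Lemma lo_p_neq0 z : `|z| = 1 -> (lo p).[z] != 0.
Proof. by move=> z1; rewrite lo_eval stab ?normr0 ?ler01. Qed.

(** For |z| = 1 the denominator has no zeros in |w| <= 1, so the mean of f/p over w is its value at
    w = 0. *)
Lemma mean_z_div f (j : int) : I (fun z w => z ^ j * (f.[z, w] / p.[z, w])) =
  I (fun z _ => z ^ j * ((lo f).[z] / (lo p).[z])).
Proof.
apply: (tm_fub hI).
- apply: adm_mul; first exact: adm_expz_z.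
  apply: adm_mul; first exact: adm_eval.
  by apply: adm_inv; [move=> z w z1 w1; rewrite stab ?w1|exact: adm_eval].
- by apply: adm_z_horner_div; exact: lo_p_neq0.
- move=> z z1.
  have st w : `|w| <= 1 -> (p.[z%:P]).[w] != 0 by exact: stab.
  have az := adm1_horner_div (f.[z%:P]) st.
  have e := tm_Z hI (z ^ j) az; apply: etrans e _.
  by rewrite (cm_div (circ_mean_w hI) _ st) !lo_eval.
Qed.

Lemma ip_Xp f (j : nat) : ip f ('X ^+ j * p) = I (fun z _ => z ^ (- j%:Z) * ((lo f).[z] / (lo p).[z])).
Proof.
rewrite -mean_z_div; apply: (tm_ext hI) => z w z1 w1.
rewrite !hornerM !horner_exp eval_X rmorphM rmorphXn /= conj_unit // exprVn exprnN /invsq normCK.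
by have u0 : p.[z, w] != 0 by [rewrite stab ?w1]; field; rewrite u0 conjC_eq0 u0.
Qed.

Lemma fiber_ip z f g : `|z| = 1 ->
  I (fun _ w => f.[z, w] * (g.[z, w])^* * om z w) = wip I (invsq1 p.[z%:P]) (evz z f) (evz z g).
Proof. by move=> z1; apply: (tm_ext hI) => z' w _ _; rewrite !evz_eval. Qed.

Lemma ip_fub f g (j : int) phi : adm (fun z _ => phi z) ->
  (forall z, `|z| = 1 -> wip I (invsq1 p.[z%:P]) (evz z f) (evz z g) = phi z) ->
  I (fun z w => z ^ j * (f.[z, w] * (g.[z, w])^* * om z w)) = I (fun z _ => z ^ j * phi z).
Proof.
move=> ap H; apply: (tm_fub hI).
- by apply: adm_mul; [exact: adm_expz_z|exact: adm_wip (adm_invsq stab) _ _].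
- by apply: adm_mul ap; exact: adm_expz_z.
- move=> z z1; rewrite -H // -fiber_ip //.
  have az : adm (fun _ w => f.[z, w] * (g.[z, w])^* * om z w).
    apply: (@adm_ext _ (fun _ w => f.[z%:P].[w] * (g.[z%:P].[w])^* * invsq1 p.[z%:P] 0 w)) => //.
    apply: adm_mul; last by apply: adm_invsq1 => w; exact: stab.
    by apply: adm_mul; [|apply: adm_conj]; exact: adm1_horner.
  exact: (tm_Z hI (z ^ j) az).
Qed.

(** The exponent of w is shifted so that [k < m] enumerates the powers w, ..., w^m. *)
Definition em j k : bipoly R := 'X ^+ j * 'Y ^+ k.+1.

Lemma emE j k : em j k = 'X ^+ j * ('Y * 'Y ^+ k). Proof. by rewrite /em exprS. Qed.

Lemma Y_pow_box k b : (k < b)%N -> box 1 b ('Y ^+ k : bipoly R).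
Proof. by move=> kb; have := mon_box R (ltn0Sn 0) kb; rewrite expr0 mul1r. Qed.

Local Notation Gm := (Gam n m p).

(** [Gam k] carries a factor z^n relative to the dual basis, which z^(j-n) turns into z^j; hence the
    restriction to j >= n. *)
Lemma ip_em_Gam i l j k : (l < m)%N -> (k < m)%N -> (n <= j)%N ->
  ip (em i l) ('X ^+ (j - n) * ('Y * Gm k)) = ((i == j) && (l == k))%:R.
Proof.
move=> lm km nj.
transitivity (I (fun z w => z ^ (i%:Z - (j%:Z - n%:Z)) * (('Y * 'Y ^+ l : bipoly R).[z, w] * (('Y * Gm k).[z, w])^* * om z w))).
  apply: (tm_ext hI) => z w z1 w1; rewrite emE ['X ^+ (j - n) * _]mulrC !hornerM !horner_exp eval_X !rmorphM rmorphXn /= (conj_unit z1).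
  rewrite exprVn exprnN -subzn // expfzDr ?unit_neq0 // -exprnP.
  ring.
rewrite (@ip_fub _ _ _ (fun z => z ^ (- n%:Z) * (k == l)%:R)).
- have am := adm_mon R (i%:Z - j%:Z) 0.
  have e := tm_Z hI ((k == l)%:R) am.
  have e0 := tm_mon hI (i%:Z - j%:Z) 0; rewrite eqxx andbT subr_eq0 eqz_nat in e0.
  apply: etrans (etrans _ e) _; last by rewrite e0 -natrM mulnb andbC [k == l]eq_sym.
  apply: (tm_ext hI) => z w z1 _; rewrite expr0z mulr1 mulrA -expfzDr ?unit_neq0 // mulrC.
  by congr (_ * z ^ _); ring.
- by apply: adm_mul; [exact: adm_expz_z|exact: adm_cst].
- move=> z z1; rewrite !evzY; have str w : `|w| <= 1 -> (p.[z%:P]).[w] != 0 by exact: stab.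
  rewrite (ti_Y (wip_toeplitz hI (adm_invsq1 str) (invsq1_gt0 str))).
  rewrite (evz_id _ (Y_pow_box lm)) (Gam_dual bp hI stab) //; last exact: Y_pow_box.
  by rewrite -rmorphXn coefC /= coefXn.
Qed.

Variable f : bipoly R.
Hypotheses (bf : box n m.+1 f) (f_em : forall j k, (j < n)%N -> (k < m)%N -> ip f (em j k) = 0)
  (f_Xp : forall j, ip f ('X ^+ j * p) = 0).

(** On each fibre f - (f(z,0)/p(z,0))p is divisible by w, and [Gam k] reads off its coefficient of
    w^(k+1). The part from f contains no power z^j with j >= n; the part from p is a combination of
    the pairings of f with z^(j-s) p. *)
Lemma ip_f_Gam j k : (k < m)%N -> (n <= j)%N -> ip f ('X ^+ (j - n) * ('Y * Gm k)) = 0.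
Proof.
move=> km nj.
transitivity (I (fun z w => z ^ (- (j%:Z - n%:Z)) * (f.[z, w] * (('Y * Gm k).[z, w])^* * om z w))).
  apply: (tm_ext hI) => z w z1 w1; rewrite ['X ^+ (j - n) * _]mulrC !hornerM !horner_exp eval_X !rmorphM rmorphXn /= (conj_unit z1).
  by rewrite exprVn exprnN -subzn //; ring.
pose fk := (swapXY f)`_k.+1; pose pk := (swapXY p)`_k.+1.
rewrite (@ip_fub _ _ _ (fun z => z ^ (- n%:Z) * (fk.[z] - pk.[z] * ((lo f).[z] / (lo p).[z])))).
- have a1 : adm (fun z _ : C => z ^ (- j%:Z) * fk.[z]).
    by apply: adm_mul; [exact: adm_expz_z|apply: adm_swap; exact: adm1_horner].
  have a2 s : adm (fun z _ : C => pk`_s * (z ^ (s%:Z - j%:Z) * ((lo f).[z] / (lo p).[z]))).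
    by apply: adm_mul; [exact: adm_cst|apply: adm_z_horner_div; exact: lo_p_neq0].
  transitivity (I (fun z w => z ^ (- j%:Z) * fk.[z] - \sum_(s < n.+1) pk`_s * (z ^ (s%:Z - j%:Z) * ((lo f).[z] / (lo p).[z])))).
    apply: (tm_ext hI) => z w z1 _; rewrite mulrA -expfzDr ?unit_neq0 //.
    rewrite (_ : - (j%:Z - n%:Z) + - n%:Z = - j%:Z); last by ring.
    rewrite mulrBr (@horner_coef_wide _ n.+1 pk); last first.
      by apply/leq_sizeP => s ns; rewrite coef_swapXY bp // negb_and -!leqNgt ns.
    congr (_ - _); rewrite mulrCA mulr_suml; apply: eq_bigr => s _.
    by rewrite expfzDr ?unit_neq0 // -exprnP; ring.
  rewrite (tm_B hI) //; last by apply: adm_sum => s; exact: a2.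
  rewrite (tm_sum hI) // big1 ?subr0 => [|s _].
    have e := fcoef_eval (liftz fk) j 0 hI; rewrite /liftz coef_map coefC /= in e.
    transitivity (fk`_j); last by rewrite /fk coef_swapXY bf // negb_and -leqNgt nj.
    rewrite -e; apply: (tm_ext hI) => z w z1 _; rewrite liftz_eval oppr0 expr0z; ring.
  rewrite (tm_Z hI); last by apply: adm_z_horner_div; exact: lo_p_neq0.
  have sj : (s <= j)%N by apply: leq_trans nj; rewrite -ltnS.
  have := f_Xp (j - s); rewrite ip_Xp -subzn // opprB => ->; exact: mulr0.
- apply: adm_mul; first exact: adm_expz_z.
  have a3 : adm (fun z _ : C => pk.[z] * (z ^ 0 * ((lo f).[z] / (lo p).[z]))).
    by apply: adm_mul; [apply: adm_swap; exact: adm1_horner|apply: adm_z_horner_div; exact: lo_p_neq0].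
  apply: (@adm_ext _ (fun z _ => fk.[z] + (-1) * (pk.[z] * (z ^ 0 * ((lo f).[z] / (lo p).[z]))))).
    by move=> z w _ _; rewrite expr0z; ring.
  by apply: adm_add; [apply: adm_swap; exact: adm1_horner|apply: adm_mul; [exact: adm_cst|]].
- move=> z z1; rewrite evzY; have str w : `|w| <= 1 -> (p.[z%:P]).[w] != 0 by exact: stab.
  have ht := wip_toeplitz hI (adm_invsq1 str) (invsq1_gt0 str); have ph := ti_herm ht.
  have bq : box 1 m.+1 (evz z p) := evz_box _ bp.
  have bfz : box 1 m.+1 (evz z f) := evz_box _ bf.
  have q00 : (evz z p)`_0`_0 != 0.
    by rewrite evz_coef lo_p_neq0.
  pose ga := (evz z f)`_0`_0 / (evz z p)`_0`_0.
  have bd : box 1 m.+1 (evz z f - ii ga * evz z p).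
    apply: (subspB (box_subsp R 1 m.+1)) => //; exact: (subspZ _ (box_subsp R 1 m.+1)).
  have [|v bv [gv vE]] := divY1 bd; first by rewrite !coefB coefCz /ga divfK // subrr.
  have -> : evz z f = ii ga * evz z p + 'Y * v by rewrite -gv addrC subrK.
  rewrite (ipDl ph) (ipZl ph) (ti_Y ht) (Gam_dual bp hI stab) //.
  have -> : wip I (invsq1 p.[z%:P]) (evz z p) ('Y * evz z (Gm k)) = 0.
    apply: (ip_eq0C ph); rewrite -evzY /evz (wip_invsq1 hI str) hornerM hornerC hornerM hornerX mul0r mul0r //.
  rewrite mulr0 add0r vE !coefB coefCz /ga !evz_coef -/fk -/pk /lo; ring.
Qed.

Let y j k := ip f (em j k).

Lemma box_sum a b u : box a b u -> u = \sum_(s < a) \sum_(l < b) ii u`_s`_l * ('X ^+ s * 'Y ^+ l).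
Proof.
move=> bu; apply: eval_inj => z w _ _; rewrite (evalE _ _ bu) !horner_sum; apply: eq_bigr => s _.
rewrite !horner_sum; apply: eq_bigr => l _.
by rewrite !hornerM !horner_exp eval_X eval_Y eval_C mulrA.
Qed.

Lemma box_sumY a b u : box a b u -> 'Y * u = \sum_(s < a) \sum_(l < b) ii u`_s`_l * em s l.
Proof.
move=> bu; rewrite {1}(box_sum bu) mulr_sumr; apply: eq_bigr => s _; rewrite mulr_sumr.
by apply: eq_bigr => l _; rewrite emE mulrCA; congr (_ * _); rewrite mulrCA.
Qed.

Let A N : C := \sum_(j < N.+1) \sum_(k < m) `|y j k| ^+ 2.

Lemma y_bessel u (s : seq (nat * nat)) : uniq s ->
  \sum_(t <- s) `|ip u (em t.1 t.2)| ^+ 2 <= I (fun z w => (u.[z, w] * om z w) * (u.[z, w] * om z w)^* ).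
Proof.
move=> us; have au : adm (fun z w => u.[z, w] * om z w) by apply: adm_mul; [exact: adm_eval|exact: (adm_invsq stab)].
have us' : uniq [seq (t.1%:Z, t.2.+1%:Z) | t <- s].
  by rewrite map_inj_uniq // => -[a b] [a' b'] [-> ->].
apply: le_trans (bessel hI au us'); rewrite big_map.
rewrite le_eqVlt; apply/orP; left; apply/eqP; apply: eq_bigr => t _; congr (`|_| ^+ 2).
apply: (tm_ext hI) => z w z1 w1; rewrite /em !hornerM !horner_exp eval_X eval_Y.
by rewrite !rmorphM !rmorphXn /= !conj_unit // !exprVn !exprnN /=; ring.
Qed.

Definition pairs a b c : seq (nat * nat) := [seq (j, k) | j <- iota a b, k <- iota 0 c].

Lemma pairs_uniq a b c : uniq (pairs a b c).
Proof. by apply: allpairs_uniq; rewrite ?iota_uniq // => -[a1 b1] [a2 b2] _ _ [-> ->]. Qed.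

Lemma sum_pairs (F : nat -> nat -> C) N : \sum_(t <- pairs 0 N m) F t.1 t.2 = \sum_(j < N) \sum_(k < m) F j k.
Proof.
rewrite /pairs big_allpairs_dep /= -{1}[N]subn0 -/(index_iota 0 N) big_mkord.
by apply: eq_bigr => j _; rewrite -{1}[m]subn0 -/(index_iota 0 m) big_mkord.
Qed.

(* The sums A N of the |y j k|^2, j <= N, satisfy A N <= C (A (N + n) - A N) (pair f
   with g, the combination of the dual basis with coefficients y), so that they are
   either 0 or grow geometrically; Bessel's inequality bounds them. *)
Lemma one_sided j k : (k < m)%N -> y j k = 0.
Proof.
have [B1 B10 HB1] := adm_bound (adm_invsq stab).
have [B2 B20 HB2] : exists2 B : C, 0 < B & forall z w, `|z| = 1 -> `|w| = 1 -> `|(om z w)^-1| <= B.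
  by apply: adm_bound; apply: adm_inv; [move=> z w z1 w1; rewrite gt_eqF ?(invsq_gt0 stab)|exact: (adm_invsq stab)].
have A0 N : 0 <= A N by apply: sumr_ge0 => i _; apply: sumr_ge0 => l _; rewrite exprn_ge0.
(* [Lg] counts the pairs in a block of n powers of z and m powers of w. With this [ka], summing the
   arithmetic-geometric bounds over the block uses up only Lg/(Lg + 1) of [ip g g]. *)
pose Lg := n%:R * m%:R : C.
pose ka := (Lg + 1) * B2.
have Lg0 : 0 <= Lg by rewrite mulr_ge0 ?ler0n.
have ka0 : 0 < ka by rewrite mulr_gt0 // ltr_wpDl.
have step N : A N <= (B1 * ka) * (A (N + n)%N - A N).
  (* [g] has the same pairings as f with z^i w^(l+1) for i <= N, and zero pairings beyond. Where
     [j - n] is truncated, [y j k] is 0. *)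
  pose g := \sum_(j < N.+1) \sum_(k < m) ii (y j k) * ('X ^+ (j - n) * ('Y * Gm k)).
  have y0 i l : (i < n)%N -> (l < m)%N -> y i l = 0 by exact: f_em.
  have g_em i l : (l < m)%N -> ip (em i l) g = if (i < N.+1)%N then (y i l)^* else 0.
    move=> lm; rewrite /g (ip_sumr hh).
    have E (j0 : 'I_N.+1) : ip (em i l) (\sum_(k < m) ii (y j0 k) * ('X ^+ (j0 - n) * ('Y * Gm k))) =
        if (i == j0)%N then (y i l)^* else 0.
      rewrite (ip_sumr hh).
      have [j0n|nj0] := ltnP j0 n.
        rewrite big1 => [|k0 _]; last by rewrite (ipZr hh) y0 // conjC0 mul0r.
        by case: eqP => // ->; rewrite y0 // conjC0.
      rewrite (bigD1 (Ordinal lm)) //= (ipZr hh) ip_em_Gam // eqxx andbT big1 ?addr0 => [|k0 k0l].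
        by case: eqP => [->|_]; rewrite ?mulr1 ?mulr0.
      rewrite (ipZr hh) ip_em_Gam //; case: eqP => // _; rewrite /= ?mulr0 //.
      by case: eqP => [e|_]; [case/eqP: k0l; apply/val_inj|rewrite mulr0].
    rewrite (eq_bigr _ (fun j0 _ => E j0)); case: ltnP => iN.
      rewrite (bigD1 (Ordinal iN)) //= eqxx big1 ?addr0 // => j0 j0i.
      by case: eqP => // e; case/eqP: j0i; apply/val_inj.
    by rewrite big1 // => j0 _; case: eqP => // e; move: (ltn_ord j0); rewrite -e ltnNge iN.
  have fg : ip f g = 0.
    rewrite /g (ip_sumr hh) big1 // => j0 _; rewrite (ip_sumr hh) big1 // => k0 _.
    have [j0n|nj0] := ltnP j0 n; first by rewrite y0 // rmorph0 mul0r (ip0r hh).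
    by rewrite (ipZr hh) ip_f_Gam // mulr0.
  have [G bG gG] : exists2 G, box (N + n).+1 m G & g = 'Y * G.
    exists (\sum_(j < N.+1) \sum_(k < m) ii (y j k) * ('X ^+ (j - n) * Gm k)).
      have sb := box_subsp R (N + n).+1 m.
      apply: (subsp_sum _ sb) => j0 _; apply: (subsp_sum _ sb) => k0 _.
      have [j0n|nj0] := ltnP j0 n; first by rewrite y0 // rmorph0 mul0r; case: sb.
      apply: (subspZ _ sb).
      have bX d b (u : bipoly R) a : box a b u -> box (d + a) b ('X ^+ d * u).
        by move=> bu; elim: d => [|d IH]; rewrite ?mul1r // exprS -mulrA addSn; exact: box_X.
      have := bX (j0 - n)%N _ _ _ (Gam_box bp (ltn_ord k0)); apply: boxS => //.
      by have := ltn_ord j0; lia.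
    rewrite /g mulr_sumr; apply: eq_bigr => j0 _; rewrite mulr_sumr; apply: eq_bigr => k0 _.
    by rewrite [RHS]mulrCA; congr (_ * _); rewrite mulrCA.
  have gE : g = \sum_(i < (N + n).+1) \sum_(l < m) ii G`_i`_l * em i l by rewrite gG; exact: box_sumY.
  have split_sum (F : nat -> C) : \sum_(i < (N + n).+1) F i = \sum_(i < N.+1) F i + \sum_(i < n) F (N.+1 + i)%N.
    by rewrite -addSn big_split_ord.
  have gg0 : 0 <= ip g g.
    by have [->|h] := eqVneq g 0; [rewrite (ip0l hh)|rewrite ltW // (ti_pos hip)].
  (* Expanding [g], whose degree in z is at most N + n, the powers z^i with i <= N contribute
     [ip g g] to the pairing with f. That pairing is 0, so the block N < i <= N + n contributes the
     opposite. *)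
  pose blk : C := \sum_(i < n) \sum_(l < m) G`_(N.+1 + i)`_l * (y (N.+1 + i)%N l)^*.
  have ggE : ip g g = - blk.
    have e1 : ip g g = \sum_(i < N.+1) \sum_(l < m) G`_i`_l * (y i l)^*.
      rewrite {1}gE (ip_suml hh) (split_sum (fun i => ip (\sum_(l < m) ii G`_i`_l * em i l) g)) [X in _ + X]big1 ?addr0 => [|i _]; last first.
        by rewrite (ip_suml hh) big1 // => l _; rewrite (ipZl hh) g_em // ltnNge leq_addr mulr0.
      by apply: eq_bigr => i _; rewrite (ip_suml hh); apply: eq_bigr => l _; rewrite (ipZl hh) g_em // ltn_ord.
    have e2 : \sum_(i < (N + n).+1) \sum_(l < m) G`_i`_l * (y i l)^* = 0.
      rewrite -[RHS](ip_eq0C hh fg) gE (ip_suml hh); apply: eq_bigr => i _.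
      by rewrite (ip_suml hh); apply: eq_bigr => l _; rewrite (ipZl hh) (ipC hh f).
    rewrite (split_sum (fun i => \sum_(l < m) G`_i`_l * (y i l)^* )) in e2.
    by rewrite e1; apply/eqP; rewrite -addr_eq0 e2.
  have agg : adm (fun z w => g.[z, w] * (g.[z, w])^* ) by apply: adm_mul; [|apply: adm_conj]; exact: adm_eval.
  have bessel_g i l : `|G`_i`_l| ^+ 2 <= B2 * ip g g.
    have ag : adm (fun z w => g.[z, w]) by exact: adm_eval.
    have := bessel hI (r := [:: (i%:Z, l.+1%:Z)]) ag isT; rewrite big_seq1 /= fcoef_eval // gG coefYz -gG => h.
    apply: (le_trans h); rewrite -(tm_Z hI); last exact: adm_wip (adm_invsq stab) _ _.
    rewrite -subr_ge0 -(tm_B hI) //; last by apply: adm_mul; [exact: adm_cst|exact: adm_wip (adm_invsq stab) _ _].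
    have aB : adm (fun z w => B2 * (g.[z, w] * (g.[z, w])^* * om z w)) by apply: adm_mul; [exact: adm_cst|exact: adm_wip (adm_invsq stab) _ _].
    apply: (tm_ge0 hI).
      apply: (@adm_ext _ (fun z w => B2 * (g.[z, w] * (g.[z, w])^* * om z w) + (-1) * (g.[z, w] * (g.[z, w])^* ))) => [z w _ _|].
        by rewrite mulN1r.
      by apply: adm_add => //; apply: adm_mul => //; exact: adm_cst.
    move=> z w z1 w1; rewrite subr_ge0 mulrCA ler_peMr ?mul_conjC_ge0 //.
    have o0 := invsq_gt0 stab z1 w1; have := HB2 z w z1 w1.
    rewrite gtr0_norm => [hB|]; last by rewrite invr_gt0; exact: o0.
    by rewrite -(mulVf (lt0r_neq0 o0)) ler_wpM2r ?(ltW o0).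
  pose Y2 : C := \sum_(i < n) \sum_(l < m) `|y (N.+1 + i)%N l| ^+ 2.
  have AY : A (N + n)%N - A N = Y2.
    by rewrite /A (split_sum (fun i => \sum_(k < m) `|y i k| ^+ 2)) addrC addKr.
  have ggY : ip g g <= ka * Y2.
    have amgm (a b : C) : 2 * (`|a| * `|b|) <= `|a| ^+ 2 / ka + ka * `|b| ^+ 2.
      rewrite -subr_ge0 (_ : _ - _ = (`|a| - ka * `|b|) ^+ 2 / ka); last by field; rewrite gt_eqF.
      apply: divr_ge0; last exact: ltW.
      apply: real_exprn_even_ge0 => //; apply: realB; first exact: normr_real.
      by apply: realM; [exact: gtr0_real|exact: normr_real].
    have h1 : ip g g <= \sum_(i < n) \sum_(l < m) `|G`_(N.+1 + i)`_l| * `|y (N.+1 + i)%N l|.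
      rewrite -(ger0_norm gg0) ggE normrN; apply: (le_trans (ler_norm_sum _ _ _)).
      apply: ler_sum => i _; apply: (le_trans (ler_norm_sum _ _ _)); apply: ler_sum => l _.
      by rewrite normrM norm_conjC.
    have h2 : 2 * ip g g <= ip g g + ka * Y2.
      apply: (le_trans (ler_wpM2l _ h1)); first by rewrite ler0n.
      apply: (@le_trans _ _ (\sum_(i < n) \sum_(l < m) (B2 * ip g g / ka + ka * `|y (N.+1 + i)%N l| ^+ 2))).
        rewrite mulr_sumr; apply: ler_sum => i _; rewrite mulr_sumr; apply: ler_sum => l _.
        apply: (le_trans (amgm _ _)); rewrite lerD2r; apply: ler_wpM2r; last exact: bessel_g.
        by rewrite invr_ge0 ltW.
      rewrite (eq_bigr (fun i : 'I_n => m%:R * (B2 * ip g g / ka) + ka * \sum_(l < m) `|y (N.+1 + i)%N l| ^+ 2)); last first.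
        by move=> i _; rewrite big_split /= sumr_const card_ord mulr_sumr mulr_natl.
      rewrite big_split /= sumr_const card_ord -mulr_sumr lerD2r -[(_ * _) *+ n]mulr_natl [n%:R * _]mulrA -/Lg /ka.
      rewrite (_ : Lg * (B2 * ip g g / ((Lg + 1) * B2)) = (Lg / (Lg + 1)) * ip g g); last first.
        by field; rewrite !gt_eqF // ltr_wpDl.
      rewrite ler_piMl // ler_pdivrMr ?mul1r ?lerDl ?ler01 //; by rewrite ltr_wpDl.
    by move: h2; rewrite mulr_natl mulr2n lerD2l.
  (* [A N] is a sum of squared Fourier coefficients of g/|p|^2, whose norm is controlled by [ip g g]
     because the weight is at most [B1]. *)
  rewrite AY -mulrA; apply: (@le_trans _ _ (B1 * ip g g)); last by rewrite ler_wpM2l // ltW.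
  have -> : A N = \sum_(t <- pairs 0 N.+1 m) `|ip g (em t.1 t.2)| ^+ 2.
    rewrite (sum_pairs (fun a b => `|ip g (em a b)| ^+ 2)); apply: eq_bigr => i _; apply: eq_bigr => l _.
    by rewrite (ipC hh (em i l)) g_em // ltn_ord conjCK.
  apply: (le_trans (y_bessel g (pairs_uniq _ _ _))).
  have awg : adm (fun z w => (g.[z, w] * om z w) * (g.[z, w] * om z w)^* ).
    have a0 : adm (fun z w => g.[z, w] * om z w) by apply: adm_mul; [exact: adm_eval|exact: (adm_invsq stab)].
    by apply: adm_mul => //; exact: adm_conj.
  have aB : adm (fun z w => B1 * (g.[z, w] * (g.[z, w])^* * om z w)) by apply: adm_mul; [exact: adm_cst|exact: adm_wip (adm_invsq stab) _ _].
  rewrite -(tm_Z hI); last exact: adm_wip (adm_invsq stab) _ _.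
  rewrite -subr_ge0 -(tm_B hI) //.
  apply: (tm_ge0 hI).
    apply: (@adm_ext _ (fun z w => B1 * (g.[z, w] * (g.[z, w])^* * om z w) + (-1) * ((g.[z, w] * om z w) * (g.[z, w] * om z w)^* ))) => [z w _ _|].
      by rewrite mulN1r.
    by apply: adm_add => //; apply: adm_mul => //; exact: adm_cst.
  move=> z w z1 w1; have o0 := invsq_gt0 stab z1 w1; have := HB1 z w z1 w1; rewrite gtr0_norm // => oB.
  rewrite rmorphM /= (CrealP (gtr0_real o0)).
  rewrite (_ : _ - _ = g.[z, w] * (g.[z, w])^* * om z w * (B1 - om z w)); last by ring.
  by apply: mulr_ge0; [apply: mulr_ge0; [exact: mul_conjC_ge0|exact: ltW]|rewrite subr_ge0].
have [M HM] : exists M, forall N, A N <= M.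
  exists (I (fun z w => (f.[z, w] * om z w) * (f.[z, w] * om z w)^* )) => N.
  have := y_bessel f (pairs_uniq 0 N.+1 m).
  by rewrite (sum_pairs (fun a b => `|ip f (em a b)| ^+ 2)).
pose c := B1 * ka; have c0 : 0 < c by rewrite mulr_gt0.
have stepc N : A N <= (c / (c + 1)) * A (N + n)%N.
  have c10 : 0 < c + 1 by rewrite addr_gt0.
  rewrite mulrAC ler_pdivlMr // mulrDr mulr1 [A N * c]mulrC.
  by have := step N; rewrite -/c mulrBr lerBrDl.
have d0 : 0 <= c / (c + 1) by rewrite ltW // divr_gt0 // addr_gt0.
have stepN N q : A N <= (c / (c + 1)) ^+ q * A (N + q * n)%N.
  elim: q => [|q IH]; first by rewrite mul1r addn0.
  apply: (le_trans IH); rewrite exprSr -mulrA; apply: ler_wpM2l; first by rewrite exprn_ge0.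
  by rewrite mulSn [(n + _)%N]addnC addnA; exact: stepc.
move=> km; have Aj : A j = 0.
  apply: (@geometric_eq0 _ (c / (c + 1)) _ M).
    by rewrite ger0_norm // ltr_pdivrMr ?addr_gt0 // mul1r ltrDl ltr01.
  move=> q; rewrite !ger0_norm //; apply: (le_trans (stepN j q)).
  by apply: ler_wpM2l; [rewrite exprn_ge0|].
move/eqP: Aj; rewrite /A psumr_eq0 => [|i _]; last by apply: sumr_ge0 => l _; rewrite exprn_ge0.
move/allP => /(_ ord_max (mem_index_enum _)) /=; rewrite psumr_eq0 => [|l _]; last by rewrite exprn_ge0.
by move/allP => /(_ (Ordinal km) (mem_index_enum _)) /=; rewrite expf_eq0 normr_eq0 => /andP[_ /eqP].
Qed.

End OneSided.

(** * Factorization of a polynomial according to the position of its zeros *)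

Section CircleFactorization.
Variable R : realType.
Local Notation C := R[i].
Implicit Types (a b q u v : {poly C}).

Lemma circle_factorization q : (forall z, `|z| = 1 -> q.[z] != 0) -> exists a b,
  [/\ q = a * b, forall z, 1 <= `|z| -> a.[z] != 0 & forall z, `|z| <= 1 -> b.[z] != 0].
Proof.
move=> q1; have q0 : q != 0 by apply: contraNneq (q1 1 (normr1 _)) => ->; rewrite horner0.
have [r qE] := closed_field_poly_normal q.
have r1 x : x \in r -> `|x| != 1.
  move=> xr; apply/eqP => x1; case/negP: (q1 x x1); rewrite qE hornerZ horner_prod.
  by rewrite mulf_eq0 (big_rem x xr) /= hornerXsubC subrr mul0r eqxx orbT.
pose s := lead_coef q *: \prod_(x <- r | ~~ (`|x| < 1)) ('X - x%:P).
exists (\prod_(x <- r | `|x| < 1) ('X - x%:P)), s; split=> [|z z1|z z1].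
- by rewrite {1}qE (bigID (fun x => `|x| < 1)) /= /s scalerAr.
- rewrite horner_prod prodf_seq_neq0; apply/allP => x _; apply/implyP => x1.
  by rewrite hornerXsubC subr_eq0; apply: contraTneq x1 => <-; rewrite le_gtF.
- rewrite hornerZ mulf_neq0 ?lead_coef_eq0 // horner_prod prodf_seq_neq0.
  apply/allP => x xr; apply/implyP; apply: contraNneq.
  by rewrite hornerXsubC => /subr0_eq zx; rewrite lt_neqAle r1 // -zx z1.
Qed.

Lemma coprimep_disjoint a b : (forall z, a.[z] = 0 -> b.[z] = 0 -> False) -> coprimep a b.
Proof.
move=> H; rewrite coprimep_def; apply/negPn/negP => /closed_rootP[x].
by rewrite root_gcd => /andP[/rootP ax /rootP bx]; exact: (H x).
Qed.

Definition revc e a : {poly C} := \poly_(s < e.+1) (a`_(e - s))^*.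

Lemma revc_eval e a z : (size a <= e.+1)%N -> z != 0 ->
  (revc e a).[z] = z ^+ e * (a.[(z^-1)^*])^*.
Proof.
move=> sa z0; rewrite horner_poly (horner_coef_wide _ sa) rmorph_sum mulr_sumr.
rewrite (reindex_inj rev_ord_inj) /=; apply: eq_bigr => s _; rewrite !subSS.
have se : (s <= e)%N by rewrite -ltnS.
rewrite subKn // rmorphM rmorphXn /= conjCK mulrCA; congr (_ * _).
have : z ^+ e = z ^+ (e - s) * z ^+ s by rewrite -exprD subnK.
by move=> ->; rewrite exprVn mulfK // expf_neq0.
Qed.

Lemma revc_neq0 a : (forall z, 1 <= `|z| -> a.[z] != 0) ->
  forall z, `|z| <= 1 -> (revc (size a).-1 a).[z] != 0.
Proof.
move=> a1 z z1; have a0 : a != 0 by apply: contraNneq (a1 1 _) => [->|]; rewrite ?horner0 ?normr1.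
have [->|z0] := eqVneq z 0.
  by rewrite horner_coef0 coef_poly /= subn0 conjC_eq0 -/(lead_coef a) lead_coef_eq0.
rewrite revc_eval ?leqSpred // mulf_neq0 ?expf_neq0 // conjC_eq0 a1 //.
by rewrite norm_conjC normfV invf_ge1 // normr_gt0.
Qed.

End CircleFactorization.

(** * The spaces K1 and K2 of a stable polynomial *)

Section Forward.
Variable R : realType.
Local Notation C := R[i].
Local Notation ii := ((polyC \o polyC)%FUN : {rmorphism C -> bipoly R}).
Implicit Types (f g h x y : bipoly R).
Variables (n m : nat) (p : bipoly R).
Hypothesis bp : box n.+1 m.+1 p.
Variable I : (C -> C -> C) -> C.
Hypothesis hI : torus_mean I.
Hypothesis stab : forall z w, `|z| = 1 -> `|w| <= 1 -> p.[z, w] != 0.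
Variables a b : {poly C}.
Hypotheses (pab : lo p = a * b) (a1 : forall z, 1 <= `|z| -> a.[z] != 0)
  (b1 : forall z, `|z| <= 1 -> b.[z] != 0).

Local Notation om := (invsq p).
Local Notation ip := (wip I om).
Let aom := adm_invsq stab.
Let hip := wip_toeplitz hI aom (invsq_gt0 stab).
Let hh := ti_herm hip.

Lemma lo_coef f s : (lo f)`_s = f`_s`_0. Proof. exact: coef_swapXY. Qed.

Lemma lo_lin c f g : lo (ii c * f + g) = c *: lo f + lo g.
Proof. by apply/polyP => s; rewrite coefD coefZ !lo_coef !coefD coefCz. Qed.

Lemma lo_liftz u f : lo (liftz u * f) = u * lo f.
Proof. by rewrite /lo rmorphM /= swapXY_map_polyC coefCM. Qed.

Lemma liftzE u f : liftz u * f = \sum_(s < size u) ii u`_s * ('X ^+ s * f).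
Proof.
apply: eval_inj => z w _ _; rewrite !hornerM liftz_eval horner_coef mulr_suml !horner_sum.
by apply: eq_bigr => s _; rewrite !hornerM !horner_exp eval_X eval_C mulrA.
Qed.

Lemma box_Xn k c d f : box c d f -> box (k + c) d ('X ^+ k * f).
Proof. by move=> bf; elim: k => [|k IH]; rewrite ?mul1r // exprS -mulrA addSn; exact: box_X. Qed.

Lemma box_liftz (u : {poly C}) c d f : box c d f -> box (size u + c) d (liftz u * f).
Proof.
move=> bf; rewrite liftzE; apply: (subsp_sum _ (box_subsp R _ _)) => s _; apply: (subspZ _ (box_subsp R _ _)).
have := @box_Xn s _ _ _ bf; apply: boxS => //; rewrite leq_add2r ltnW //.
Qed.

(** On K1 the quotient f(z,0)/p(z,0) is v/a, analytic outside the disc and zero at infinity because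
    of the degree bound; on K2 it is w/b, analytic in the disc. *)
Definition K1 : set (bipoly R) := fun f => E ip n m f /\ exists2 v : {poly C}, (size v < size a)%N & lo f = b * v.
Definition K2 : set (bipoly R) := fun f => E ip n m f /\ exists w, lo f = a * w.

Let a0 : a != 0.
Proof. by apply/eqP => e; have := a1 (z := 1); rewrite e horner0 normr1 lexx eqxx => /(_ isT). Qed.

Lemma K1_subsp : subsp ii K1.
Proof.
split=> [|c f g [Ef [v sv fv]] [Eg [w sw gw]]].
  split; first by case: (E_subsp hip n m).
  by exists 0; rewrite ?mulr0 ?size_poly0 ?size_poly_gt0 //; apply/polyP => s; rewrite lo_coef !coef0.
split; first by case: (E_subsp hip n m) => _; apply.
exists (c *: v + w); last by rewrite lo_lin fv gw mulrDr scalerAr.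
by rewrite (leq_ltn_trans (size_polyD _ _)) // gtn_max sw (leq_ltn_trans (size_scale_leq _ _)).
Qed.

Lemma K2_subsp : subsp ii K2.
Proof.
split=> [|c f g [Ef [v fv]] [Eg [w gw]]].
  split; first by case: (E_subsp hip n m).
  by exists 0; rewrite mulr0; apply/polyP => s; rewrite lo_coef !coef0.
split; first by case: (E_subsp hip n m) => _; apply.
by exists (c *: v + w); rewrite lo_lin fv gw mulrDr scalerAr.
Qed.

Lemma E_em f j k : E ip n m f -> (j < n)%N -> (k < m)%N -> ip f (em R j k) = 0.
Proof.
move=> [_ H] jn km; rewrite emE mulrCA; apply: H; exact: mon_box.
Qed.

Lemma ip_Ybox N f g : box N m g -> (forall j k, (j < N)%N -> (k < m)%N -> ip f (em R j k) = 0) ->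
  ip f ('Y * g) = 0.
Proof.
move=> bg H; rewrite (box_sumY bg) (ip_sumr hh) big1 // => s _; rewrite (ip_sumr hh) big1 // => l _.
by rewrite (ipZr hh) H // mulr0.
Qed.

(** The pairing is the mean of z^(-j) v/a. Its conjugate is that of a quotient of reversed
    polynomials; reversing v in degree deg a - 1 gains the factor z that makes the mean vanish even
    for j = 0. *)
Lemma K1_Xp f j : K1 f -> ip f ('X ^+ j * p) = 0.
Proof.
move=> [Ef [v sv fv]]; rewrite ip_Xp // fv pab.
have e : I (fun z _ => z ^+ j.+1 * ((revc (size a).-2 v).[z] / (revc (size a).-1 a).[z])) = 0.
  by apply: (cm_div_eq0 (circ_mean_z hI)); exact: revc_neq0.
apply: (can_inj (@conjCK _)); rewrite conjC0 -e -(tm_conj hI).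
  apply: (tm_ext hI) => z w z1 w1.
  have z0 := unit_neq0 z1; have az : a.[z] != 0 by rewrite a1 ?z1.
  have bz : b.[z] != 0 by rewrite b1 ?z1.
  have zc : (z^-1)^* = z by rewrite -(conj_unit z1) conjCK.
  rewrite !hornerM !rmorphM !fmorphV rmorphM /= conj_unitXz // opprK.
  rewrite (@revc_eval _ _ a) ?leqSpred // zc.
  have ac : (a.[z])^* != 0 by rewrite conjC_eq0.
  have bc : (b.[z])^* != 0 by rewrite conjC_eq0.
  have sa : (0 < size a)%N by rewrite size_poly_gt0.
  have [v0|] := eqVneq v 0.
    rewrite v0 (_ : revc _ 0 = 0) ?horner0 ?conjC0; first by rewrite !(mul0r, mulr0).
    by apply/polyP => s; rewrite coef_poly !coef0 conjC0 if_same.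
  rewrite -size_poly_gt0 => v0; have e1 : (size a).-1 = (size a).-2.+1 by case: (size a) (leq_ltn_trans v0 sv) => [|[|k]].
  rewrite revc_eval // ?zc; last by rewrite -e1; case: (size a) sv.
  by rewrite e1 -exprnP !exprS; field; rewrite ac bc z0 expf_neq0.
apply: adm_z_horner_div => z z1; by rewrite hornerM mulf_neq0 ?a1 ?b1 ?z1.
Qed.

Lemma K1_em f j k : K1 f -> (k < m)%N -> ip f (em R j k) = 0.
Proof.
move=> fK; have [Ef _] := fK; apply: (one_sided bp hI stab) => [|j' k' jn km|j'].
- by case: Ef.
- exact: E_em.
- exact: K1_Xp.
Qed.

Lemma K1_E f : K1 f -> E ip n.+1 m f.
Proof.
move=> fK; split=> [|g bg]; first by case: fK => -[bf _] _; exact: boxS bf.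
by apply: (ip_Ybox bg) => j k _ km; exact: K1_em.
Qed.

(* z^(c-1) f(1/z, w): K2 is handled by applying [one_sided] to the mean in 1/z. *)
Definition zrev c f : bipoly R := \poly_(s < c) f`_(c.-1 - s).

Lemma zrev_box c d f : box c d f -> box c d (zrev c f).
Proof.
move=> bf s l; rewrite coef_poly; case: ltnP => [sc /= ld|_ _]; last by rewrite coef0.
by rewrite bf // negb_and ld orbT.
Qed.

Lemma zrev_eval c d f z w : (0 < c)%N -> box c d f -> z != 0 ->
  (zrev c f).[z, w] = z ^+ c.-1 * f.[z^-1, w].
Proof.
case: c => // c _ bf z0; rewrite (evalE _ _ (zrev_box bf)) (evalE _ _ bf) mulr_sumr.
rewrite (reindex_inj rev_ord_inj) /=; apply: eq_bigr => s _; rewrite mulr_sumr; apply: eq_bigr => l _.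
have sc : (s <= c)%N by rewrite -ltnS.
rewrite coef_poly subSS ltnS leq_subr subKn // exprVn.
have -> : z ^+ c = z ^+ (c - s) * z ^+ s by rewrite -exprD subnK.
by field; rewrite expf_neq0.
Qed.

(** After z -> 1/z, [zrev n f] meets the hypotheses of [one_sided] for [zrev n.+1 p]: its pairings
    with z^j times that polynomial are means of z^(j+1) times a function analytic in the disc. *)
Lemma K2_em f k : K2 f -> (k < m)%N -> ip ('X * f) (em R 0 k) = 0.
Proof.
move=> [Ef [v fv]] km; have [bf _] := Ef.
have [n0|n0] := posnP n.
  have -> : f = 0 by apply/polyP => s; apply/polyP => l; rewrite bf ?coef0 // n0.
  by rewrite mulr0 (ip0l hh).
have bzf := zrev_box bf; have bzp := zrev_box bp.
have pE z w : `|z| = 1 -> (zrev n.+1 p).[z, w] = z ^+ n * p.[z^-1, w].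
  by move=> z1; rewrite (zrev_eval _ _ bp) ?unit_neq0.
have fE z w : `|z| = 1 -> (zrev n f).[z, w] = z ^+ n.-1 * f.[z^-1, w].
  by move=> z1; rewrite (zrev_eval _ _ bf) ?unit_neq0.
have zstab z w : `|z| = 1 -> `|w| <= 1 -> (zrev n.+1 p).[z, w] != 0.
  move=> z1 w1; rewrite pE //; apply: mulf_neq0; first by rewrite expf_neq0 ?unit_neq0.
  by apply: stab; rewrite ?normV_unit.
have omE z w : `|z| = 1 -> invsq (zrev n.+1 p) z^-1 w = om z w.
  by move=> z1; rewrite /invsq pE ?normV_unit // invrK normrM normrX normV_unit // expr1n mul1r.
have ipE g j : wip (fun F => I (fun z w => F z^-1 w)) (invsq (zrev n.+1 p)) (zrev n f) ('X ^+ j * g) =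
    I (fun z w => z ^ (j%:Z - n.-1%:Z) * (f.[z, w] * (g.[z^-1, w])^* * om z w)).
  apply: (tm_ext hI) => z w z1 w1; rewrite fE ?normV_unit // omE // invrK !hornerM !horner_exp eval_X.
  rewrite rmorphM rmorphXn /= conj_unit ?normV_unit // invrK expfzDr ?unit_neq0 // -exprnN -exprnP exprVn.
  by ring.
have H j : (k < m)%N -> I (fun z w => z ^ (j%:Z - n.-1%:Z) * (f.[z, w] * (('Y ^+ k.+1 : bipoly R).[z^-1, w])^* * om z w)) = 0.
  rewrite -ipE; apply: (one_sided bzp (torus_mean_zV hI) zstab bzf) => [j' k' jn k'm|j'].
    rewrite ipE -(E_em (j := n.-1 - j') Ef _ k'm); last by move: n0 jn; clear; lia.
    apply: (tm_ext hI) => z w z1 w1; rewrite /em !hornerM !horner_exp eval_X !eval_Y rmorphM.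
    rewrite !rmorphXn /= (conj_unit z1) exprVn exprnN -subzn ?opprB; last by rewrite -ltnS prednK.
    by ring.
  rewrite ipE; transitivity (I (fun z w => z ^ j'.+1%:Z * (f.[z, w] / p.[z, w]))).
    apply: (tm_ext hI) => z w z1 w1; rewrite pE ?normV_unit // invrK rmorphM rmorphXn /=.
    have u0 : p.[z, w] != 0 by rewrite stab ?w1.
    rewrite conj_unit ?normV_unit // invrK /invsq normCK expfzDr ?unit_neq0 // -exprnN -{2}(prednK n0) -!exprnP.
    by rewrite !exprS; field; rewrite u0 conjC_eq0 u0 expf_neq0 ?unit_neq0.
  rewrite (mean_z_div hI stab) fv pab.
  transitivity (I (fun z _ => z ^+ j'.+1 * (v.[z] / b.[z]))).
    apply: (tm_ext hI) => z w z1 _; rewrite !hornerM -exprnP; congr (_ * _).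
    by field; rewrite a1 ?b1 ?z1.
  exact: (cm_div_eq0 (circ_mean_z hI)).
(* Index n is the first one not covered by membership in E^1_{n-1,m}; there the power of z is n - (n
   - 1) = 1. *)
rewrite -[RHS](H n km); apply: (tm_ext hI) => z w z1 w1.
rewrite /em mul1r !hornerM eval_X !horner_exp !eval_Y subzn ?leq_pred //.
by rewrite -exprnP; case: n n0 => // n' _; rewrite subSn // subnn expr1; ring.
Qed.

Lemma K2_XE f : K2 f -> E ip n.+1 m ('X * f).
Proof.
move=> fK; have [Ef _] := fK; split=> [|g bg]; first by apply: box_X; case: Ef.
apply: (ip_Ybox bg) => -[|j] k jn km; first exact: K2_em.
by rewrite /em exprS -mulrA (ti_X hip); exact: E_em.
Qed.

(* b(z) g and v(z) p agree at w = 0, so that pairing f with z^j b(z) g gives a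
   recurrence whose characteristic polynomial has no zeros in the closed disc. *)
Lemma K1_XnK2 f g j : K1 f -> K2 g -> ip f ('X ^+ j * g) = 0.
Proof.
move=> fK gK; have [_ [v gv]] := gK; have bg : box n m.+1 g by case: gK => -[].
pose y k := ip f ('X ^+ k * g).
have [M HM] := wip_Xn_bound hI aom f g.
(* The coefficients of b are conjugated because the form is antilinear in its second argument. *)
pose bc := map_poly (@Num.conj _) b : {poly C}.
apply: (bounded_rec_eq0 (B := bc) HM) => [w w1|k].
  rewrite -[w]conjCK horner_map /= conjC_eq0 b1 // norm_conjC //.
have bh : box (size b + n + (size v + n.+1)) m.+1 (liftz b * g - liftz v * p).
  apply: (subspB (box_subsp R _ _)).
    have := @box_liftz b _ _ _ bg; apply: boxS => //; exact: leq_addr.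
  have := @box_liftz v _ _ _ bp; apply: boxS => //; exact: leq_addl.
have [|h bh1 hE] := divY bh.
  by move=> s; rewrite !coefB -!lo_coef !lo_liftz gv pab; apply/eqP; rewrite subr_eq0 mulrCA [v * _]mulrC mulrA.
have y0 : ip f ('X ^+ k * (liftz b * g)) = 0.
  rewrite -[liftz b * g](subrK (liftz v * p)) hE mulrDr (ipDr hh).
  rewrite mulrCA (ip_Ybox (N := k + (size b + n + (size v + n.+1)))%N) => [|| j' k' _ k'm]; first last.
  - exact: K1_em.
  - exact: box_Xn.
  rewrite add0r liftzE mulr_sumr (ip_sumr hh) big1 // => s _.
  by rewrite mulrCA (ipZr hh) mulrA -exprD K1_Xp // mulr0.
rewrite -[RHS]y0 liftzE mulr_sumr (ip_sumr hh) (@apprE _ _ _ bc _ _ (size b)) ?size_map_poly //.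
apply: eq_bigr => s _; rewrite mulrCA (ipZr hh) mulrA -exprD /y coef_map //=.
Qed.

(** Elements of E^1_{n-1,m} can be split at w = 0. There Bezout's identity for a and b, reduced
    modulo a, gives f(z,0) = a(...) + bv with deg v < deg a, and deg a + deg b <= n bounds the
    degree of bv. *)
Lemma E_K f : E ip n m f <-> exists2 k1, K1 k1 & exists2 k2, K2 k2 & f = k1 + k2.
Proof.
split=> [Ef|[k1 [E1 _] [k2 [E2 _] ->]]]; last exact: subspD (E_subsp hip n m) E1 E2.
have /Bezout_eq1_coprimepP[[u w] /= uw] : coprimep a b.
  apply: coprimep_disjoint => z az bz; have [z1|z1] := boolP (1 <= `|z|).
    by have := a1 z1; rewrite az eqxx.
  have /b1 : `|z| <= 1.
    by move: z1; rewrite -real_ltNge ?normr_real // => /ltW.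
  by rewrite bz eqxx.
have [bf _] := Ef.
have sF : (size (lo f) <= n)%N.
  by apply/leq_sizeP => s ns; rewrite lo_coef bf // negb_and -leqNgt ns.
pose v := (lo f * w) %% a; pose d := (lo f * w) %/ a.
have vE : lo f * w = d * a + v by exact: divp_eq.
have sv : (size v < size a)%N by rewrite ltn_modp.
have fE : lo f = a * (lo f * u + d * b) + b * v.
  rewrite -{1}[lo f]mulr1 -uw mulrDr !mulrA vE; ring.
have b0 : b != 0 by apply/eqP => e; have := b1 (z := 0); rewrite e horner0 normr0 ler01 eqxx => /(_ isT).
have sbv : (size (b * v)%R <= n)%N.
  have sp : (size (lo p) <= n.+1)%N.
    by apply/leq_sizeP => s ns; rewrite lo_coef bp // negb_and -leqNgt ns.
  move: sp; rewrite pab size_mul // => sp; apply: (leq_trans (size_polyMleq _ _)).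
  move: sp sv; move: (size a) (size b) (size v) => x y z; lia.
have bu : box n 1 (liftz (b * v)).
  move=> s l; rewrite coef_map /= coefC; case: eqP => [->|//]; rewrite andbT -leqNgt => ns.
  by rewrite nth_default // (leq_trans sbv).
have [k1 Ek1 k1E] := E_exists hip m bu.
have lk1 : lo k1 = b * v by apply/polyP => s; rewrite lo_coef k1E coef_map coefC.
exists k1; first by split=> //; exists v.
exists (f - k1); last by rewrite addrC subrK.
split; first exact: subspB (E_subsp hip n m) Ef Ek1.
exists (lo f * u + d * b); apply/polyP => s.
by rewrite lo_coef !coefB -!lo_coef {1}fE lk1 -coefB addrK.
Qed.

End Forward.

(** * Both implications for an arbitrary torus mean *)

Section SplitPair.
Variable R : realType.
Local Notation C := R[i].
Local Notation ii := ((polyC \o polyC)%FUN : {rmorphism C -> bipoly R}).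
Implicit Types (f g : bipoly R).

Variable I : (C -> C -> C) -> C.
Hypothesis hI : torus_mean I.

Lemma stable_split_pair n m (p : bipoly R) : box n.+1 m.+1 p ->
  (forall z w, `|z| = 1 -> `|w| <= 1 -> p.[z, w] != 0) ->
  exists K1 K2, split_pair (wip I (invsq p)) n m K1 K2.
Proof.
move=> bp stab; have [a [b [pab a1 b1]]] := circle_factorization (lo_p_neq0 stab).
exists (K1 n m p I a b), (K2 n m p I a); split.
- exact: (K1_subsp n m hI stab b a1).
- exact: (K2_subsp n m hI stab a).
- exact: (E_K bp hI stab pab a1 b1).
- by move=> f g fK gK; have := K1_XnK2 bp hI stab pab a1 b1 0 fK gK; rewrite mul1r.
- by move=> f g fK gK; have := K1_XnK2 bp hI stab pab a1 b1 1 fK gK; rewrite expr1.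
- exact: (K1_E bp hI stab pab a1 b1).
- exact: (K2_XE bp hI stab pab a1 b1).
Qed.

Lemma split_pair_factor n m (t : laurent R n m) (ot : C -> C -> C) (K1 K2 : set (bipoly R)) :
  adm ot -> (forall z w, `|z| = 1 -> `|w| = 1 -> 0 < ot z w) ->
  (forall z w, `|z| = 1 -> `|w| = 1 -> ot z w = (leval t z w)^-1) ->
  split_pair (wip I ot) n m K1 K2 ->
  exists p : bipoly R, [/\ box n.+1 m.+1 p, forall z w, `|z| = 1 -> `|w| <= 1 -> p.[z, w] != 0 &
    forall z w, `|z| = 1 -> `|w| = 1 -> leval t z w = `|p.[z, w]| ^+ 2].
Proof.
move=> aot ot0 otE sp.
have hip := wip_toeplitz hI aot ot0.
have [p [Ep pp pK1 pK2 span]] := split_shift_vector hip sp.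
have stab z w : `|z| = 1 -> `|w| <= 1 -> p.[z, w] != 0.
  move=> z1 w1; have [xs hx] := Xc_bracket hip z1 n m.+1; have [ys hy] := Xc_bracket hip z1 n m.
  exact: (stable_at hip sp Ep pp pK1 pK2 span z1 hx hy w1).
have bp : box n.+1 m.+1 p by case: Ep.
exists p; split=> //; apply: (square_modulus_eq hI aot ot0 stab) => // z0 x y z01 Xx Xy.
have [xs hx] := Xc_bracket hip z01 n m.+1; have [ys hy] := Xc_bracket hip z01 n m.
have bev u : Xc (wip I ot) n m.+1 u -> box 1 m.+1 (evz z0 u) by case=> bu _; exact: evz_box bu.
rewrite -(bracket_wip hip sp Ep pp pK1 pK2 span z01 hx hy hI (bev _ Xx) (bev _ Xy)).
by rewrite !(br_K hx).
Qed.

End SplitPair.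

(** * From the linear form T to the inner product with weight 1/t *)

Section Translation.
Variable R : realType.
Local Notation C := R[i].
Local Notation ii := ((polyC \o polyC)%FUN : {rmorphism C -> bipoly R}).
Implicit Types (f g : bipoly R).

Lemma polys_box (a b : nat) : @polys R (a%:Z - 1) (b%:Z - 1) = box a b.
Proof.
apply/seteqP; split=> f fP s l.
  by move=> sl; apply/eqP; apply/negPn/negP => /fP; lia.
by move=> fsl; have : ((s < a) && (l < b))%N by [apply: contraNT fsl => /fP ->]; lia.
Qed.

Variables (n m : nat) (t : laurent R n m) (T : {scalar laurent R n m}).
Hypothesis t_gt0 : forall z w : C, `|z| = 1 -> `|w| = 1 -> 0 < leval t z w.
Hypothesis T_def : forall j k : int, `|j| <= n%:Z -> `|k| <= m%:Z ->
  T (lmon R n m j k) =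
  torus_integral (fun z w => z ^ j * w ^ k / (((2 * pi) ^+ 2)%:C * leval t z w)).

Definition weight : C -> C -> C := fun z w => (leval t z w)^-1.

Lemma adm_weight : adm weight.
Proof. by apply: adm_inv (adm_leval t) => z w z1 w1; rewrite gt_eqF ?t_gt0. Qed.

Lemma weight_gt0 z w : `|z| = 1 -> `|w| = 1 -> 0 < weight z w.
Proof. by move=> z1 w1; rewrite invr_gt0 t_gt0. Qed.

Let hI := torus_avg_mean R.
Local Notation ip := (wip (@torus_avg R) weight).
Let hip := wip_toeplitz hI adm_weight weight_gt0.

Lemma T_lmon j k : `|j| <= n%:Z -> `|k| <= m%:Z ->
  T (lmon R n m j k) = torus_avg (fun z w => z ^ j * w ^ k * weight z w).
Proof.
move=> jn km; have aF : adm (fun z w => z ^ j * w ^ k * weight z w).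
  by apply: adm_mul adm_weight; exact: adm_mon.
have e := tm_Z hI (((2 * pi) ^+ 2)%:C^-1) aF.
apply: (mulfI (x := ((2 * pi) ^+ 2)%:C^-1)); first by rewrite invr_eq0 sqr_2pi_neq0.
rewrite -{}e (T_def jn km) mulrC /torus_avg; congr (torus_integral _ / _).
by apply/funext => z; apply/funext => w; rewrite /weight invfM mulrCA.
Qed.

Lemma inner_wip f g : box n.+1 m.+1 f -> box n.+1 m.+1 g -> inner T f g = ip f g.
Proof.
move=> bf bg; pose c s k s' k' := f`_s`_k * (g`_s'`_k')^*.
transitivity (torus_avg (fun z w => \sum_(s < n.+1) \sum_(k < m.+1) \sum_(s' < n.+1) \sum_(k' < m.+1)
    c s k s' k' * (z ^ (s%:Z - s'%:Z) * w ^ (k%:Z - k'%:Z) * weight z w))).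
  have a0 (s k s' k' : nat) : adm (fun z w => c s k s' k' * (z ^ (s%:Z - s'%:Z) * w ^ (k%:Z - k'%:Z) * weight z w)).
    by apply: adm_mul; [exact: adm_cst|apply: adm_mul adm_weight; exact: adm_mon].
  rewrite /inner /lprod linear_sum (tm_sum hI) => [|s]; last by do 3 apply: adm_sum => ?.
  apply: eq_bigr => s _; rewrite linear_sum (tm_sum hI) => [|k]; last by do 2 apply: adm_sum => ?.
  apply: eq_bigr => k _; rewrite linear_sum (tm_sum hI) => [|s']; last by apply: adm_sum => ?.
  apply: eq_bigr => s' _; rewrite linear_sum (tm_sum hI) => [|k'] //.
  apply: eq_bigr => k' _; rewrite linearZ /= (tm_Z hI); last first.
    by apply: adm_mul adm_weight; exact: adm_mon.
  have := (ltn_ord s, ltn_ord s', ltn_ord k, ltn_ord k') => -[[[s1 s2] k1] k2].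
  by congr (_ * _); apply: T_lmon; lia.
apply: (tm_ext hI) => z w z1 w1; rewrite (evalE _ _ bf) (evalE _ _ bg) rmorph_sum !mulr_suml.
apply: eq_bigr => s _; rewrite !mulr_suml; apply: eq_bigr => k _.
rewrite mulr_sumr mulr_suml; apply: eq_bigr => s' _.
rewrite rmorph_sum mulr_sumr mulr_suml; apply: eq_bigr => k' _.
rewrite !rmorphM !rmorphXn /= (conj_unit z1) (conj_unit w1) /c !expfzDr ?unit_neq0 // !exprVn -!exprnN -!exprnP.
by ring.
Qed.

Lemma subSZ1 (k : nat) : k.+1%:Z - 1 = k%:Z.
Proof. by rewrite intS addrAC subrr add0r. Qed.

Lemma polys_nm : @polys R n m = box n.+1 m.+1.
Proof. by rewrite -polys_box !subSZ1. Qed.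

Lemma E1_E a : (a <= n.+1)%N -> E1 T (a%:Z - 1) m = E ip a m.
Proof.
move=> an; rewrite /E1 /ominus polys_box.
rewrite (_ : polys _ _ = box a m.+1); last by rewrite -polys_box subSZ1.
have ipY f g : box a m.+1 f -> box a m g -> inner T f ('Y * g) = ip f ('Y * g).
  by move=> bf bg; apply: inner_wip; [exact: boxS bf|apply: boxS (box_Y bg)].
apply/seteqP; split=> f [bf H]; split=> //.
  by move=> g bg; rewrite -ipY //; apply: H => //; exists g.
by move=> _ _ -> [g bg <-]; rewrite ipY //; exact: H.
Qed.

Lemma E_box a f : (a <= n.+1)%N -> E ip a m f -> box n.+1 m.+1 f.
Proof. by move=> an [bf _]; exact: boxS bf. Qed.

Lemma positive_form_T : positive_form T.
Proof.
by move=> f; rewrite polys_nm => bf f0; rewrite -[T _]/(inner T f f) inner_wip //; exact: (ti_pos hip).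
Qed.

Lemma split_shiftP : split_shift T <-> exists K1 K2, split_pair ip n m K1 K2.
Proof.
have EnE : E1 T (n%:Z - 1) m = E ip n m by rewrite E1_E.
have En1E : E1 T n m = E ip n.+1 m by rewrite -E1_E // subSZ1.
have bXk k : E ip n m k -> box n.+1 m.+1 ('X * k) by case=> bk _; exact: box_X.
rewrite /split_shift polys_nm EnE En1E.
split=> -[K1 [K2]].
  move=> [[s1 b1] [s2 b2] [EK K12 oK] oX [K1E XE]]; exists K1, K2.
  have sub1 k : K1 k -> E ip n m k.
    by move=> Kk; rewrite EK; exists k => //; exists 0; [case: s2|rewrite addr0].
  have sub2 k : K2 k -> E ip n m k.
    by move=> Kk; rewrite EK; exists 0; [case: s1|exists k; rewrite ?add0r].
  split=> //.
  - move=> f; rewrite EK; split=> [[k1 h1 [k2 h2 <-]]|[k1 h1 [k2 h2 ->]]]; exists k1 => //; exists k2 => //.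
  - by move=> k1 k2 h1 h2; rewrite -inner_wip; [exact: oK|exact: b1|exact: b2].
  - move=> k1 k2 h1 h2; rewrite -inner_wip; [|exact: b1|exact: (bXk _ (sub2 _ h2))].
    by apply: oX => //; exists k2.
  - by move=> k h; apply: XE; exists k.
move=> [s1 s2 EK oK oX K1E XE]; exists K1, K2.
have sub1 k : K1 k -> E ip n m k.
  by move=> Kk; apply/EK; exists k => //; exists 0; [case: s2|rewrite addr0].
have sub2 k : K2 k -> E ip n m k.
  by move=> Kk; apply/EK; exists 0; [case: s1|exists k; rewrite ?add0r].
have b1 k : K1 k -> box n.+1 m.+1 k by move=> /sub1; exact: E_box.
have b2 k : K2 k -> box n.+1 m.+1 k by move=> /sub2; exact: E_box.
split=> //.
- split.
  + apply/seteqP; split=> f; first by move/EK => [k1 h1 [k2 h2 ->]]; exists k1 => //; exists k2.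
    by move=> [k1 h1 [k2 h2 <-]]; apply/EK; exists k1 => //; exists k2.
  + apply/seteqP; split=> f; last by move=> ->; split; [case: s1|case: s2].
    by move=> [h1 h2]; apply: (ip_eq0 hip); exact: oK.
  + by move=> k1 k2 h1 h2; rewrite inner_wip; [exact: oK|exact: b1|exact: b2].
- move=> k1 _ h1 [k2 h2 <-]; rewrite inner_wip; [exact: oX|exact: b1|exact: (bXk _ (sub2 _ h2))].
- by split=> [k h|_ [k h <-]]; [exact: K1E|exact: XE].
Qed.

End Translation.

Theorem theorem2p8 (R : realType) (n m : nat) (t : laurent R n m)
    (T : {scalar laurent R n m})
    (t_gt0 : forall z w : R[i], `|z| = 1 -> `|w| = 1 -> 0 < leval t z w)
    (T_def : forall j k : int, `|j| <= n%:Z -> `|k| <= m%:Z ->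
       T (lmon R n m j k) =
       torus_integral
         (fun z w => z ^ j * w ^ k / (((2 * pi) ^+ 2)%:C * leval t z w))) :
  positive_form T /\
  ((exists p : bipoly R,
      [/\ polys n m p,
          forall z w : R[i], `|z| = 1 -> `|w| <= 1 -> p.[z, w] != 0 &
          forall z w : R[i], `|z| = 1 -> `|w| = 1 ->
            leval t z w = `|p.[z, w]| ^+ 2]) <->
   split_shift T).
Proof.
split; first exact: positive_form_T t_gt0 T_def.
have iff := split_shiftP t_gt0 T_def; rewrite polys_nm; split=> [[p [bp stab tp]]|/iff[K1 [K2 sp]]].
  apply/iff; have [K1 [K2 sp]] := stable_split_pair (torus_avg_mean R) bp stab.
  (* The weights 1/t and 1/|p|^2 agree on the torus, so they define the same form. *)
  exists K1, K2; rewrite (_ : wip _ _ = wip (@torus_avg R) (invsq p)) //.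
  apply/funext => f; apply/funext => g; apply: (tm_ext (torus_avg_mean R)) => z w z1 w1.
  by rewrite /weight tp.
by apply: (split_pair_factor (torus_avg_mean R) (adm_weight t_gt0) (weight_gt0 t_gt0)) sp.
Qed.
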